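(* Let $\alpha>0$ be real, let $k\in(0,1)$ be the modulus determined by $K(k')/K(k)=\alpha$ with $k'=\sqrt{1-k^2}$, and write $K=K(k)$, $E=E(k)$. Then $$\int_{0}^{\pi/2}\frac{\sin 2x\,\sinh \frac{x}{\alpha}}{\cosh \frac{x}{\alpha}-\cos \frac{\ln (2 \cos x)}{\alpha}}\,dx=\frac{13\pi\alpha}{48}+\frac{\pi}{24\alpha}+\frac{\pi\alpha}{4\tanh (\pi\alpha)}+\frac{\alpha}{4\pi}\left(E-\frac{2-k^2}{3}K\right)K\qquad\text{if } \alpha>\frac{\ln 2}{2\pi},$$ and $$\int_{0}^{\pi/2}\frac{\sin 2x\,\sinh \frac{x}{\alpha}}{\cosh \frac{x}{\alpha}+\cos \frac{\ln (2 \cos x)}{\alpha}}\,dx=\frac{\pi}{8\alpha}+\frac{\pi\alpha}{4\sinh (\pi\alpha)}+\frac{\alpha}{4\pi}\left(E-K\right)K\qquad\text{if } \alpha>\frac{\ln 2}{\pi}.$$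
   Context: For a modulus $k\in(0,1)$, the complementary modulus is $k'=\sqrt{1-k^2}$, and the complete elliptic integrals of the first and second kind with modulus $k$ are $K=K(k)=\int_0^{\pi/2}\frac{d\varphi}{\sqrt{1-k^2\sin^2\varphi}}$ and $E=E(k)=\int_0^{\pi/2}\sqrt{1-k^2\sin^2\varphi}\,d\varphi$; $K'=K(k')$. Given $\alpha>0$, the modulus $k$ is the one for which $\alpha=K'/K$, and $k',K,K',E$ are the corresponding quantities. *)

(* Defs.v *)
From Stdlib Require Export Reals.
From Coquelicot Require Export Coquelicot.
Open Scope R_scope.

(* The argument is the modulus k, not the parameter m = k^2. *)
Definition ellipticK (k : R) : R :=
  RInt (fun phi => 1 / sqrt (1 - k ^ 2 * sin phi ^ 2)) 0 (PI / 2).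

Definition ellipticE (k : R) : R :=
  RInt (fun phi => sqrt (1 - k ^ 2 * sin phi ^ 2)) 0 (PI / 2).

Definition compl_modulus (k : R) : R := sqrt (1 - k ^ 2).

(* At x = PI / 2 the total function [ln] is applied to 0; this single endpoint
   value is irrelevant for the integrals over [0, PI / 2]. *)
Definition integrand_minus (alpha x : R) : R :=
  sin (2 * x) * sinh (x / alpha)
  / (cosh (x / alpha) - cos (ln (2 * cos x) / alpha)).

Definition integrand_plus (alpha x : R) : R :=
  sin (2 * x) * sinh (x / alpha)
  / (cosh (x / alpha) + cos (ln (2 * cos x) / alpha)).

(* Main.v *)
Require Import Defs.
From Stdlib Require Import Reals.
From Coquelicot Require Import Coquelicot.
From Stdlib Require Import Lra Lia Arith.
Open Scope R_scope.

(* With w = exp (2 i x) and z = ln (1 + w) = ln (2 cos x) + i x, the kernel sinh/(cosh - cos) is - Im cot (z/(2 alpha)),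
   and the one with + is obtained by a shift of pi alpha.  Expanding the cotangent in partial fractions reduces the
   integrals to J(c) = int x sin 2x/|z - c|^2 for the real poles c.  The means over the unit circle of w^m/(z - c) are
   found without contour integration: the mean of w/(z - c) satisfies f' = f in c away from ln 2, the mean of (1 + w)^s
   equal to 1 gives a linear relation between the means of 1/(z - c) and w/(z - c), and regularity at c = 0 (resp. decay
   at infinity) fixes the constant for c < ln 2 (resp. c > ln 2).  Summing J over the poles leaves elementary series and
   sums of csch^2 over n pi alpha or (n + 1/2) pi alpha.

   For these put a = pi alpha, b = (n + 1/2) a with n in Z, and s = sum csch (z + b), s~ = sum (-1)^n csch (z + b),
   t = sum (-1)^n coth (z + b), u = sum csch^2 (z + b).  Products of these series, expanded in partial fractions, give
   s' = - s~ t, s~' = - s t, t' = - s s~ and s^2 = u - u(0).  On each of the lines z = i y and z = x + i pi/2 the pair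
   of functions other than the positive one rotates, the angular speed being the positive function, whose integral is
   known termwise to be pi/2; hence a change of variable by the angle turns pi/2 and a/2 into K(k) and K(k') up to a
   common factor, so that k is the modulus of alpha by monotonicity of K'/K.  The integral of t^2 gives E, and the
   values of u at the half periods give the sums. *)

(** * Series and derivatives *)

(** Grouping the terms of b and - b makes every series a function of Y = - sinh^2 z. The two lines
    on which the system is studied become Y = sin^2 y and Y = cosh^2 x, so one family of real series
    on Y >= 0 serves both and no complex number appears. The obstacle is t: its terms do not tend to
    0, so products are formed on partial sums with an oscillating correction before passing to the
    limit.

    The curve z meets the real axis only at ln 2. This point separates the poles c that contribute
    exp c and a csch^2 from those that contribute 1/c^2 alone, and the lower bounds on alpha put
    every positive pole beyond it. The other poles then produce a geometric series (the coth or csch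
    of pi alpha) and a lattice sum; the terms 1/c^2 of all poles add up to Euler sums, which give
    the terms in 1/alpha. For the kernel with a minus sign c = 0 is itself a pole; there the two
    singular terms of J cancel and leave 13/12, the origin of the constant 13/48. *)

Lemma sum_n_Rle (f g : nat -> R) (N : nat) :
  (forall n, (n <= N)%nat -> f n <= g n) -> sum_n f N <= sum_n g N.
Proof.
  intros H. induction N as [|N IH].
  - rewrite !sum_O. apply H; lia.
  - rewrite !sum_Sn. apply Rplus_le_compat; [apply IH; intros; apply H; lia | apply H; lia].
Qed.

Lemma sum_n_Rabs (f : nat -> R) (N : nat) :
  Rabs (sum_n f N) <= sum_n (fun n => Rabs (f n)) N.
Proof.
  induction N as [|N IH].
  - rewrite !sum_O. lra.
  - rewrite !sum_Sn. eapply Rle_trans; [apply Rabs_triang|]. apply Rplus_le_compat; [apply IH|lra].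
Qed.

Lemma sum_n_Rminus (f g : nat -> R) (N : nat) :
  sum_n (fun n => f n - g n) N = sum_n f N - sum_n g N.
Proof.
  induction N as [|N IH]; [now rewrite !sum_O|].
  rewrite !sum_Sn, IH. unfold plus; simpl. ring.
Qed.

Lemma sum_n_Rpos (f : nat -> R) (N : nat) :
  (forall n, 0 <= f n) -> 0 <= sum_n f N.
Proof.
  intros H. induction N as [|N IH]; [rewrite sum_O; apply H|].
  rewrite sum_Sn. now apply Rplus_le_le_0_compat.
Qed.

Lemma is_lim_seq_sum_n (f : nat -> nat -> R) (g : nat -> R) (K : nat) :
  (forall n, is_lim_seq (fun N => f N n) (g n)) ->
  is_lim_seq (fun N => sum_n (f N) K) (sum_n g K).
Proof.
  intros H. induction K as [|K IH].
  - apply is_lim_seq_ext with (fun N => f N 0%nat).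
    + intros; now rewrite sum_O.
    + rewrite sum_O. apply H.
  - apply is_lim_seq_ext with (fun N => sum_n (f N) K + f N (S K)).
    + intros; now rewrite sum_Sn.
    + rewrite sum_Sn. now apply is_lim_seq_plus'.
Qed.

Lemma ex_series_Rabs_le (a b : nat -> R) :
  (forall n, Rabs (a n) <= b n) -> ex_series b -> ex_series a.
Proof. intros H Hb. now apply (ex_series_le a b). Qed.

Lemma ex_series_scal_R (c : R) (a : nat -> R) :
  ex_series a -> ex_series (fun n => c * a n).
Proof. intros H. now apply (ex_series_scal c a). Qed.

Lemma Series_is_lim (a : nat -> R) : ex_series a -> is_lim_seq (sum_n a) (Series a).
Proof. intros H. apply Series_correct in H. exact H. Qed.

(** Dominated convergence for a triangular array: a head of fixed length converges termwise, and the
    tail is at most twice a tail of [M]. It passes to the limit in products of partial sums, where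
    the summands depend on the number of terms. *)
Lemma tannery (f : nat -> nat -> R) (g M : nat -> R) :
  (forall N n, (n <= N)%nat -> Rabs (f N n) <= M n) ->
  ex_series M ->
  (forall n, is_lim_seq (fun N => f N n) (g n)) ->
  is_lim_seq (fun N => sum_n (f N) N) (Series g).
Proof.
  intros Hf HM Hg.
  assert (Hgb : forall n, Rabs (g n) <= M n).
  { intros n.
    apply (is_lim_seq_le_loc (fun N => Rabs (f N n)) (fun _ => M n) (Rabs (g n)) (M n)).
    - exists n. intros N HN. now apply Hf.
    - apply (is_lim_seq_abs _ (g n)), Hg.
    - apply is_lim_seq_const. }
  assert (Hgs : ex_series g) by now apply (ex_series_Rabs_le g M).
  (* Padding by 0 beyond the diagonal gives one bound [2 * M n] valid for all N and n. *)
  pose (D := fun N n => if le_dec n N then Rabs (f N n - g n) else 0).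
  assert (HD : forall N n, 0 <= D N n <= 2 * M n).
  { intros N n. unfold D. destruct (le_dec n N) as [h|h].
    - split; [apply Rabs_pos|]. unfold Rminus. eapply Rle_trans; [apply Rabs_triang|].
      rewrite Rabs_Ropp. specialize (Hf N n h). specialize (Hgb n). lra.
    - split; [lra|]. specialize (Hgb n). pose proof (Rabs_pos (g n)). lra. }
  assert (HDl : forall n, is_lim_seq (fun N => D N n) 0).
  { intros n. apply is_lim_seq_ext_loc with (fun N => Rabs (f N n - g n)).
    - exists n. intros N HN. unfold D. now destruct (le_dec n N).
    - apply (proj1 (is_lim_seq_abs_0 _)).
      replace (Finite 0) with (Finite (g n - g n)) by (f_equal; ring).
      apply is_lim_seq_minus'; [apply Hg|apply is_lim_seq_const]. }
  assert (HDs : is_lim_seq (fun N => sum_n (D N) N) 0).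
  { apply is_lim_seq_spec. intros eps.
    assert (He : 0 < eps / 4) by (destruct eps; simpl; lra).
    destruct (Cauchy_ex_series M HM (mkposreal _ He)) as [K HK].
    assert (HL := is_lim_seq_sum_n D (fun _ => 0) K HDl).
    apply is_lim_seq_spec in HL.
    assert (He2 : 0 < eps / 2) by (destruct eps; simpl; lra).
    destruct (HL (mkposreal _ He2)) as [N0 HN0].
    exists (N0 + S K)%nat. intros N HN.
    specialize (HN0 N ltac:(lia)).
    replace (sum_n (fun _ : nat => 0) K) with 0 in HN0
      by (rewrite sum_n_const; ring).
    rewrite Rminus_0_r in *.
    assert (Hsplit : sum_n (D N) N = sum_n (D N) K + sum_n_m (D N) (S K) N)
      by (unfold sum_n; rewrite (sum_n_m_Chasles _ 0 K N) by lia; reflexivity).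
    assert (Hp : 0 <= sum_n (D N) N).
    { apply sum_n_Rpos. intros; apply HD. }
    rewrite (Rabs_pos_eq _ Hp). rewrite Hsplit.
    assert (Ht : sum_n_m (D N) (S K) N <= 2 * sum_n_m M (S K) N).
    { rewrite <- (sum_n_m_mult_l 2 M). apply sum_n_m_le. intros; apply HD. }
    specialize (HK (S K) N ltac:(lia) ltac:(lia)).
    change (Rabs (sum_n_m M (S K) N) < eps / 4) in HK.
    apply Rabs_def2 in HK. apply Rabs_def2 in HN0. simpl in HN0. lra. }
  replace (Finite (Series g)) with (Finite (Series g + 0)) by (f_equal; ring).
  apply is_lim_seq_ext with (fun N => sum_n g N + (sum_n (f N) N - sum_n g N)).
  { intros; ring. }
  apply is_lim_seq_plus'.
  - now apply Series_is_lim.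
  - apply (proj2 (is_lim_seq_abs_0 _)).
    apply is_lim_seq_le_le with (fun _ => 0) (fun N => sum_n (D N) N);
      [|apply is_lim_seq_const|exact HDs].
    intros N. split; [apply Rabs_pos|].
    replace (sum_n (f N) N - sum_n g N) with (sum_n (fun n => f N n - g n) N).
    + eapply Rle_trans; [apply sum_n_Rabs|]. apply sum_n_Rle.
      intros n Hn. unfold D. destruct (le_dec n N); [lra|lia].
    + apply sum_n_Rminus.
Qed.

(** A second-order remainder is enough for differentiability. Summed or integrated termwise, the
    same estimate differentiates both the pole series and the integrals depending on a parameter. *)
Lemma is_derive_quadratic (F : R -> R) (x l K d : R) :
  0 < d ->
  (forall h, Rabs h < d -> Rabs (F (x + h) - F x - h * l) <= K * h ^ 2) ->
  is_derive F x l.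
Proof.
  intros Hd H. apply is_derive_Reals. intros eps Heps.
  pose (K' := Rabs K + 1).
  assert (HK' : 0 < K') by (unfold K'; pose proof (Rabs_pos K); lra).
  assert (Hm : 0 < Rmin d (eps / K')).
  { apply Rmin_pos; [lra|]. apply Rdiv_lt_0_compat; lra. }
  exists (mkposreal _ Hm). intros h Hh0 Hh. simpl in Hh.
  assert (H1 : Rabs h < d) by (eapply Rlt_le_trans; [apply Hh|apply Rmin_l]).
  assert (H2 : Rabs h < eps / K') by (eapply Rlt_le_trans; [apply Hh|apply Rmin_r]).
  specialize (H h H1).
  replace ((F (x + h) - F x) / h - l) with ((F (x + h) - F x - h * l) / h) by (field; auto).
  unfold Rdiv. rewrite Rabs_mult, Rabs_inv.
  assert (Hp : 0 < Rabs h) by now apply Rabs_pos_lt.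
  apply Rmult_lt_reg_r with (Rabs h); [exact Hp|].
  rewrite Rmult_assoc, Rinv_l, Rmult_1_r by lra.
  eapply Rle_lt_trans; [apply H|].
  replace (h ^ 2) with (Rabs h * Rabs h) by (rewrite <- Rabs_mult, Rabs_pos_eq; [ring|nra]).
  assert (K <= K') by (unfold K'; pose proof (Rle_abs K); lra).
  assert (Rabs h * K' < eps).
  { replace eps with (eps / K' * K') by (field; lra). now apply Rmult_lt_compat_r. }
  nra.
Qed.

Lemma is_derive_0_const (f : R -> R) (a b : R) :
  (forall t, a < t < b -> is_derive f t 0) ->
  (forall t, a <= t <= b -> continuous f t) ->
  forall x y, a <= x <= b -> a <= y <= b -> f x = f y.
Proof.
  intros Hd Hc.
  assert (W : forall x y, a <= x <= b -> a <= y <= b -> x < y -> f x = f y).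
  { intros x y Hx Hy Hxy.
    destruct (MVT_gen f x y (fun _ => 0)) as [c [_ Hc2]].
    - intros t. rewrite Rmin_left, Rmax_right by lra. intros; apply Hd; lra.
    - intros t. rewrite Rmin_left, Rmax_right by lra. intros.
      apply continuity_pt_filterlim. apply Hc; lra.
    - lra. }
  intros x y Hx Hy. destruct (Rtotal_order x y) as [h|[h|h]].
  - now apply W.
  - now subst.
  - symmetry; now apply W.
Qed.

(** * Products of simple pole expansions *)

Lemma sum_n_Rplus (f g : nat -> R) (N : nat) :
  sum_n (fun n => f n + g n) N = sum_n f N + sum_n g N.
Proof. apply (sum_n_plus f g). Qed.

Lemma sum_n_Rscal (c : R) (f : nat -> R) (N : nat) :
  sum_n (fun n => c * f n) N = c * sum_n f N.
Proof. apply (sum_n_mult_l c f). Qed.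

Lemma sum_n_Rext (f g : nat -> R) (N : nat) :
  (forall n, (n <= N)%nat -> f n = g n) -> sum_n f N = sum_n g N.
Proof. apply sum_n_ext_loc. Qed.

(** The truncated series with residues [B], deprived of its term n, evaluated at the pole Y = -
    [r n]. *)
Definition row_sum (r B : nat -> R) (N n : nat) : R :=
  sum_n (fun m => if Nat.eq_dec m n then 0 else B m / (r m - r n)) N.

Lemma sum_n_indicator (c : R) (N n : nat) :
  (n <= N)%nat -> sum_n (fun m => if Nat.eq_dec m n then c else 0) N = c.
Proof.
  assert (H0 : forall N, (N < n)%nat -> sum_n (fun m => if Nat.eq_dec m n then c else 0) N = 0).
  { induction N0 as [|k IH]; intros Hk.
    - rewrite sum_O. destruct (Nat.eq_dec 0 n); [lia|reflexivity].
    - rewrite sum_Sn, IH by lia. destruct (Nat.eq_dec (S k) n); [lia|]. unfold plus; simpl; ring. }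
  induction N as [|k IH]; intros Hk.
  - rewrite sum_O. destruct (Nat.eq_dec 0 n); [reflexivity|lia].
  - rewrite sum_Sn. destruct (Nat.eq_dec (S k) n) as [h|h].
    + rewrite H0 by lia. unfold plus; simpl; ring.
    + rewrite IH by lia. unfold plus; simpl; ring.
Qed.

(* Partial fractions, 1/((r+Y)(s+Y)) = (1/(r+Y) - 1/(s+Y))/(s-r), off the diagonal. *)
Lemma simple_pole_product (r A B : nat -> R) (Y : R) (N : nat) :
  (forall n, r n + Y <> 0) ->
  (forall n m, n <> m -> r n <> r m) ->
  sum_n (fun n => A n / (r n + Y)) N * sum_n (fun n => B n / (r n + Y)) N =
  sum_n (fun n => A n * B n / (r n + Y) ^ 2
                  + (A n * row_sum r B N n + B n * row_sum r A N n) / (r n + Y)) N.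
Proof.
  intros Hr Hd.
  (* [o] carries the pole at [r n] and [o'] the one at [r m]; the double sum of [o'] is transposed
     below, so that both are collected at n. *)
  pose (o := fun n m => if Nat.eq_dec m n then 0 else A n * B m / ((r m - r n) * (r n + Y))).
  pose (o' := fun n m => if Nat.eq_dec m n then 0 else A n * B m / ((r n - r m) * (r m + Y))).
  rewrite (Rmult_comm (sum_n _ _)), <- sum_n_Rscal.
  transitivity (sum_n (fun n => sum_n (fun m =>
     (if Nat.eq_dec m n then A n * B n / (r n + Y) ^ 2 else 0) + (o n m + o' n m)) N) N).
  - apply sum_n_Rext; intros n Hn. rewrite Rmult_comm, <- sum_n_Rscal.
    apply sum_n_Rext; intros m Hm. unfold o, o'.
    specialize (Hd m n). pose proof (Hr n). pose proof (Hr m).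
    destruct (Nat.eq_dec m n) as [->|h].
    + field. auto.
    + specialize (Hd h). field. repeat split; auto; lra.
  - transitivity (sum_n (fun n => sum_n (fun m => if Nat.eq_dec m n then A n * B n / (r n + Y) ^ 2 else 0) N) N
      + (sum_n (fun n => sum_n (o n) N) N + sum_n (fun n => sum_n (fun m => o' m n) N) N)).
    + rewrite (sum_n_switch (fun n m => o' m n)). rewrite <- sum_n_Rplus, <- sum_n_Rplus.
      apply sum_n_Rext; intros n Hn. now rewrite !sum_n_Rplus.
    + rewrite <- !sum_n_Rplus. apply sum_n_Rext; intros n Hn.
      rewrite sum_n_indicator by easy. f_equal.
      unfold row_sum.
      replace (sum_n (o n) N) with (A n / (r n + Y) *
        sum_n (fun m => if Nat.eq_dec m n then 0 else B m / (r m - r n)) N).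
      replace (sum_n (fun m => o' m n) N) with (B n / (r n + Y) *
        sum_n (fun m => if Nat.eq_dec m n then 0 else A m / (r m - r n)) N).
      { field. apply Hr. }
      all: rewrite <- sum_n_Rscal; apply sum_n_Rext; intros m Hm; unfold o, o';
        pose proof (Hr n); pose proof (Hr m).
      * specialize (Hd n m). destruct (Nat.eq_dec n m) as [->|h];
          destruct (Nat.eq_dec m _) as [h'|h']; try congruence; [ring|].
        specialize (Hd h). field. repeat split; auto; lra.
      * specialize (Hd m n). destruct (Nat.eq_dec m n) as [->|h]; [ring|].
        specialize (Hd h). field. repeat split; auto; lra.
Qed.

(* [g] stands for an odd function on Z known at positive arguments; the sum telescopes after reindexing by [m - n] and [m + n + 1]. *)
Lemma odd_row_sum (g : nat -> R) (n N : nat) :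
  g 0%nat = 0 -> (n <= N)%nat ->
  sum_n (fun m => if Nat.eq_dec m n then 0
                  else (if lt_dec m n then - g (n - m)%nat else g (m - n)%nat)
                       - g (m + n + 1)%nat) N
  = sum_n g (N - n) - sum_n g (N + n + 1) + g (2 * n + 1)%nat.
Proof.
  intros g0.
  set (t := fun m => if Nat.eq_dec m n then 0
                     else (if lt_dec m n then - g (n - m)%nat else g (m - n)%nat)
                          - g (m + n + 1)%nat).
  (* Below the diagonal the indices n - m and m + n + 1 together fill the interval from n - M to M +
     n + 1. *)
  assert (L : forall M, (M < n)%nat -> sum_n t M = sum_n g (n - M - 1) - sum_n g (M + n + 1)).
  { induction M as [|M IH]; intros HM.
    - rewrite sum_O. unfold t. destruct (Nat.eq_dec 0 n); [lia|]. destruct (lt_dec 0 n); [|lia].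
      replace (0 + n + 1)%nat with (S n) by lia.
      destruct n as [|k]; [lia|].
      replace (S k - 0 - 1)%nat with k by lia. replace (S k - 0)%nat with (S k) by lia.
      rewrite !sum_Sn. unfold plus; simpl; ring.
    - rewrite sum_Sn, IH by lia. unfold t at 1. destruct (Nat.eq_dec (S M) n); [lia|].
      destruct (lt_dec (S M) n); [|lia].
      replace (n - M - 1)%nat with (S (n - S M - 1)) by lia.
      replace (S M + n + 1)%nat with (S (M + n + 1)) by lia.
      rewrite !sum_Sn. replace (S (n - S M - 1)) with (n - S M)%nat by lia.
      unfold plus; simpl; ring. }
  assert (Lt : t n = 0) by (unfold t; destruct (Nat.eq_dec n n); congruence).
  (* The omitted term m = n would have contributed - g (2 n + 1) to the block; hence the
     correction. *)
  assert (L0 : sum_n t n = sum_n g 0 - sum_n g (2 * n + 1) + g (2 * n + 1)%nat).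
  { replace (2 * n + 1)%nat with (S (2 * n)) by lia.
    destruct (Nat.eq_dec n 0) as [e|e].
    - replace (sum_n t n) with (t n) by (now rewrite e, sum_O).
      rewrite Lt. rewrite e. change (S (2 * 0)) with 1%nat. rewrite (sum_Sn g 0), sum_O, g0. unfold plus; simpl; ring.
    - pose proof (sum_Sn t (n - 1)) as Hn. replace (S (n - 1)) with n in Hn by lia.
      rewrite Hn, Lt, L by lia.
      replace (n - (n - 1) - 1)%nat with 0%nat by lia.
      replace (n - 1 + n + 1)%nat with (2 * n)%nat by lia.
      rewrite sum_Sn. unfold plus; simpl; ring. }
  intros HN.
  change (sum_n t N = sum_n g (N - n) - sum_n g (N + n + 1) + g (2 * n + 1)%nat).
  replace N with (n + (N - n))%nat by lia. generalize (N - n)%nat as k. clear HN.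
  induction k as [|k IH].
  - rewrite Nat.add_0_r. rewrite L0. replace (n - n)%nat with 0%nat by lia.
    replace (n + n + 1)%nat with (2 * n + 1)%nat by lia. reflexivity.
  - rewrite Nat.add_succ_r, sum_Sn, IH. unfold t at 1. destruct (Nat.eq_dec (S (n + k)) n); [lia|].
    destruct (lt_dec (S (n + k)) n); [lia|].
    replace (S (n + k) - n)%nat with (S (n + k - n)) by lia.
    replace (S (n + k) + n + 1)%nat with (S (n + k + n + 1)) by lia.
    rewrite !sum_Sn. unfold plus; simpl; ring.
Qed.

(** * Hyperbolic functions at the points (n + 1/2) a *)

Lemma sinh_plus (x y : R) : sinh (x + y) = sinh x * cosh y + cosh x * sinh y.
Proof. unfold sinh, cosh. rewrite Ropp_plus_distr, !exp_plus. field. Qed.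

Lemma cosh_plus (x y : R) : cosh (x + y) = cosh x * cosh y + sinh x * sinh y.
Proof. unfold sinh, cosh. rewrite Ropp_plus_distr, !exp_plus. field. Qed.

Lemma cosh_0 : cosh 0 = 1.
Proof. unfold cosh. rewrite Ropp_0, exp_0. field. Qed.

Lemma sinh_opp (x : R) : sinh (- x) = - sinh x.
Proof. unfold sinh. rewrite Ropp_involutive. field. Qed.

Lemma cosh_opp (x : R) : cosh (- x) = cosh x.
Proof. unfold cosh. rewrite Ropp_involutive. field. Qed.

Lemma cosh_sqr (x : R) : cosh x ^ 2 = 1 + sinh x ^ 2.
Proof.
  unfold sinh, cosh. assert (exp x * exp (- x) = 1).
  { rewrite <- exp_plus, Rplus_opp_r. apply exp_0. } nra.
Qed.

Lemma cosh_gt_0 (x : R) : 0 < cosh x.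
Proof. unfold cosh. pose proof (exp_pos x). pose proof (exp_pos (- x)). lra. Qed.

Lemma sinh_gt_0 (x : R) : 0 < x -> 0 < sinh x.
Proof. intros H. rewrite <- sinh_0. now apply sinh_lt. Qed.

Lemma sinh_lt_cosh (x : R) : sinh x < cosh x.
Proof. unfold sinh, cosh. pose proof (exp_pos (- x)). lra. Qed.

Lemma cosh_le_1_sinh (x : R) : 0 <= x -> cosh x <= 1 + sinh x.
Proof.
  intros H. unfold sinh, cosh.
  assert (exp (- x) <= 1).
  { rewrite <- exp_0. destruct (Req_dec x 0) as [->|]; [rewrite Ropp_0; lra|].
    left. apply exp_increasing. lra. }
  lra.
Qed.

Lemma sinh_plus_exp (x y : R) : 0 <= y -> sinh x * exp y <= sinh (x + y).
Proof.
  intros H. unfold sinh.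
  assert (exp (- (x + y)) <= exp (- x) * exp y).
  { rewrite <- exp_plus. destruct (Req_dec y 0) as [->|]; [right; f_equal; ring|].
    left. apply exp_increasing. lra. }
  rewrite exp_plus. lra.
Qed.

Lemma sinh_double (x : R) : sinh (2 * x) = 2 * sinh x * cosh x.
Proof. replace (2 * x) with (x + x) by ring. rewrite sinh_plus. ring. Qed.

Lemma cosh_double (x : R) : cosh (2 * x) = 1 + 2 * sinh x ^ 2.
Proof.
  replace (2 * x) with (x + x) by ring. rewrite cosh_plus.
  pose proof (cosh_sqr x). nra.
Qed.

Lemma sinh_sqr_minus (x y : R) :
  sinh x ^ 2 - sinh y ^ 2 = sinh (x - y) * sinh (x + y).
Proof.
  unfold Rminus at 2. rewrite !sinh_plus, sinh_opp, cosh_opp.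
  pose proof (cosh_sqr x). pose proof (cosh_sqr y). nra.
Qed.

Lemma pow_m1_sqr (n : nat) : (-1) ^ n * (-1) ^ n = 1.
Proof. rewrite <- Rpow_mult_distr. replace (-1 * -1) with 1 by ring. apply pow1. Qed.

Lemma Rabs_pow_m1 (n : nat) : Rabs ((-1) ^ n) = 1.
Proof. apply pow_1_abs. Qed.

Lemma exp_INR_mult (x : R) (n : nat) : exp (INR n * x) = exp x ^ n.
Proof.
  induction n as [|n IH]; [simpl; rewrite Rmult_0_l; apply exp_0|].
  rewrite S_INR, Rmult_plus_distr_r, exp_plus, IH, Rmult_1_l. simpl. ring.
Qed.

Definition bpt (a : R) (n : nat) : R := (INR n + / 2) * a.
Definition lat_sinh (a : R) (n : nat) : R := sinh (bpt a n).
Definition lat_cosh (a : R) (n : nat) : R := cosh (bpt a n).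
(** In the variable Y = - sinh^2 z the points b and - b both become the pole Y = - [lat_sqr a n]. *)
Definition lat_sqr (a : R) (n : nat) : R := lat_sinh a n ^ 2.

Section Lattice.
Context (a : R) (Ha : 0 < a).

Lemma bpt_pos (n : nat) : 0 < bpt a n.
Proof. unfold bpt. pose proof (pos_INR n). apply Rmult_lt_0_compat; lra. Qed.

Lemma sh_pos (n : nat) : 0 < lat_sinh a n.
Proof. apply sinh_gt_0, bpt_pos. Qed.

Lemma ch_pos (n : nat) : 0 < lat_cosh a n.
Proof. apply cosh_gt_0. Qed.

Lemma ch_sqr (n : nat) : lat_cosh a n ^ 2 = 1 + lat_sinh a n ^ 2.
Proof. apply cosh_sqr. Qed.

Lemma sh_ge_exp (n : nat) : lat_sinh a 0 * exp a ^ n <= lat_sinh a n.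
Proof.
  unfold lat_sinh. replace (bpt a n) with (bpt a 0 + INR n * a) by (unfold bpt; simpl; ring).
  replace (exp a ^ n) with (exp (INR n * a)).
  - apply sinh_plus_exp. apply Rmult_le_pos; [apply pos_INR|lra].
  - apply exp_INR_mult.
Qed.

Lemma exp_ge_1 (n : nat) : 1 <= exp a ^ n.
Proof. apply pow_R1_Rle. pose proof (exp_ineq1 a). lra. Qed.

Lemma sh_ge_sh0 (n : nat) : lat_sinh a 0 <= lat_sinh a n.
Proof.
  pose proof (sh_ge_exp n). pose proof (exp_ge_1 n). pose proof (sh_pos 0). nra.
Qed.

Lemma ch_le_sh (n : nat) : lat_cosh a n <= (/ lat_sinh a 0 + 1) * lat_sinh a n.
Proof.
  pose proof (cosh_le_1_sinh (bpt a n) ltac:(pose proof (bpt_pos n); lra)) as H.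
  fold (lat_cosh a n) (lat_sinh a n) in H. pose proof (sh_ge_sh0 n). pose proof (sh_pos 0).
  assert (1 <= / lat_sinh a 0 * lat_sinh a n).
  { apply Rmult_le_reg_l with (lat_sinh a 0); [lra|]. rewrite <- Rmult_assoc, Rinv_r by lra. lra. }
  lra.
Qed.

Lemma ex_series_exp_geom : ex_series (fun n => / exp a ^ n).
Proof.
  apply ex_series_ext with (fun n => (/ exp a) ^ n).
  - intros n. now rewrite pow_inv.
  - apply ex_series_geom. rewrite Rabs_pos_eq.
    + rewrite <- Rinv_1. apply Rinv_lt_contravar; pose proof (exp_ineq1 a); lra.
    + left. apply Rinv_0_lt_compat, exp_pos.
Qed.

Lemma ex_series_inv_sh : ex_series (fun n => / lat_sinh a n).
Proof.
  apply ex_series_Rabs_le with (fun n => / lat_sinh a 0 * / exp a ^ n).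
  - intros n. pose proof (sh_pos n). pose proof (sh_pos 0). pose proof (sh_ge_exp n).
    pose proof (exp_ge_1 n).
    rewrite Rabs_pos_eq by (left; now apply Rinv_0_lt_compat).
    rewrite <- Rinv_mult. apply Rinv_le_contravar; [|easy]. apply Rmult_lt_0_compat; lra.
  - apply ex_series_scal_R, ex_series_exp_geom.
Qed.

(** The common majorant of the lattice series: all of them decay at least like [/ lat_sinh a n]. *)
Lemma ex_series_sh_bound (u : nat -> R) (K : R) :
  (forall n, Rabs (u n) <= K / lat_sinh a n) -> ex_series u.
Proof.
  intros H. apply ex_series_Rabs_le with (fun n => K * / lat_sinh a n); [exact H|].
  apply ex_series_scal_R, ex_series_inv_sh.
Qed.

Lemma rr_minus (n m : nat) :
  lat_sqr a m - lat_sqr a n = sinh (bpt a m - bpt a n) * sinh (bpt a m + bpt a n).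
Proof. apply sinh_sqr_minus. Qed.

Lemma rr_inj (n m : nat) : n <> m -> lat_sqr a n <> lat_sqr a m.
Proof.
  intros H E. assert (E2 : lat_sqr a m - lat_sqr a n = 0) by lra.
  rewrite rr_minus in E2. apply Rmult_integral in E2.
  destruct E2 as [E2|E2]; rewrite <- sinh_0 in E2.
  - assert (bpt a m - bpt a n = 0).
    { destruct (Rtotal_order (bpt a m - bpt a n) 0) as [h|[h|h]]; [|exact h|];
        apply sinh_lt in h; lra. }
    unfold bpt in *. apply H. apply INR_eq. nra.
  - pose proof (bpt_pos m). pose proof (bpt_pos n).
    assert (h : 0 < bpt a m + bpt a n) by lra. apply sinh_lt in h. lra.
Qed.

(** The functions to which [odd_row_sum] is applied, sums and differences of the points [bpt a n]
    being integer multiples of a. At j = 0 the convention / 0 = 0 supplies the value 0 that an odd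
    function must have. *)
Definition csch_j (j : nat) : R := / sinh (INR j * a).
Definition acsch_j (j : nat) : R := (-1) ^ j * / sinh (INR j * a).
Definition acoth_j (j : nat) : R := (-1) ^ j * (cosh (INR j * a) / sinh (INR j * a)).

Lemma bpt_minus (n m : nat) : (n <= m)%nat -> bpt a m - bpt a n = INR (m - n) * a.
Proof. intros H. unfold bpt. rewrite minus_INR by easy. ring. Qed.

Lemma bpt_plus (n m : nat) : bpt a m + bpt a n = INR (m + n + 1) * a.
Proof. unfold bpt. rewrite !plus_INR. simpl. field. Qed.

Lemma bpt_2 (n : nat) : INR (2 * n + 1) * a = 2 * bpt a n.
Proof. unfold bpt. rewrite plus_INR, mult_INR. simpl. field. Qed.

Lemma sinh_j_neq0 (j : nat) : (0 < j)%nat -> sinh (INR j * a) <> 0.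
Proof.
  intros H. apply Rgt_not_eq, sinh_gt_0, Rmult_lt_0_compat; [now apply lt_0_INR|easy].
Qed.

(** Division by the difference of squares splits into functions of x - y and x + y alone, which is
    what makes the row sums telescope. The next two lemmas do the same for the other two kinds of
    residues. *)
Lemma csch_diff (x y : R) : sinh y <> 0 -> sinh (x - y) <> 0 -> sinh (x + y) <> 0 ->
  cosh x / (sinh x ^ 2 - sinh y ^ 2) = / (2 * sinh y) * (/ sinh (x - y) - / sinh (x + y)).
Proof.
  intros h1 h2 h3. rewrite sinh_sqr_minus.
  replace (cosh x) with ((sinh (x + y) - sinh (x - y)) / (2 * sinh y)).
  - field. auto.
  - unfold Rminus at 2. rewrite !sinh_plus, sinh_opp, cosh_opp. field. auto.
Qed.

Lemma csch_sum (x y : R) : sinh (x - y) <> 0 -> sinh (x + y) <> 0 ->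
  sinh x / (sinh x ^ 2 - sinh y ^ 2) = / (2 * cosh y) * (/ sinh (x - y) + / sinh (x + y)).
Proof.
  intros h2 h3. rewrite sinh_sqr_minus. pose proof (cosh_gt_0 y).
  replace (sinh x) with ((sinh (x + y) + sinh (x - y)) / (2 * cosh y)).
  - field. repeat split; auto; lra.
  - unfold Rminus at 1. rewrite !sinh_plus, sinh_opp, cosh_opp. field. lra.
Qed.

Lemma coth_sum (x y : R) : sinh (x - y) <> 0 -> sinh (x + y) <> 0 ->
  sinh x * cosh x / (sinh x ^ 2 - sinh y ^ 2)
  = / 2 * (cosh (x - y) / sinh (x - y) + cosh (x + y) / sinh (x + y)).
Proof.
  intros h2 h3. rewrite sinh_sqr_minus.
  replace (sinh x * cosh x) with ((cosh (x - y) * sinh (x + y) + cosh (x + y) * sinh (x - y)) / 2).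
  - field. auto.
  - replace (sinh x * cosh x) with (/ 2 * sinh (2 * x)) by (rewrite sinh_double; field).
    replace (2 * x) with ((x + y) + (x - y)) by ring. rewrite (sinh_plus (x + y)). field.
Qed.

Lemma csch_j_0 : csch_j 0 = 0.
Proof. unfold csch_j. simpl INR. rewrite Rmult_0_l, sinh_0. apply Rinv_0. Qed.
Lemma acsch_j_0 : acsch_j 0 = 0.
Proof. unfold acsch_j. simpl INR. rewrite Rmult_0_l, sinh_0, Rinv_0. ring. Qed.
Lemma acoth_j_0 : acoth_j 0 = 0.
Proof. unfold acoth_j, Rdiv. simpl INR. rewrite Rmult_0_l, sinh_0, Rinv_0. ring. Qed.

(** Minus the sum of [g] over the window of indices from N - n + 1 to N + n + 1, hence negligible
    for large N when [g] is summable. *)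
Definition tele (g : nat -> R) (N n : nat) : R := sum_n g (N - n) - sum_n g (N + n + 1).

Lemma pow_m1_add (m n : nat) : (n <= m)%nat -> (-1) ^ m = (-1) ^ n * (-1) ^ (m - n).
Proof. intros H. rewrite <- pow_add. f_equal. lia. Qed.

(** m + n + 1 and m - n have opposite parities; this sign turns the plus of [csch_sum] and
    [coth_sum] into the minus that [odd_row_sum] expects. *)
Lemma pow_m1_add1 (m n : nat) : (-1) ^ m = - ((-1) ^ n * (-1) ^ (m + n + 1)).
Proof.
  rewrite !pow_add. pose proof (pow_m1_sqr n). simpl.
  replace (- ((-1) ^ n * ((-1) ^ m * (-1) ^ n * (-1 * 1)))) with ((-1) ^ m * ((-1) ^ n * (-1) ^ n)) by ring.
  rewrite H. ring.
Qed.

Ltac lattice_case m n :=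
  pose proof (sh_pos n); pose proof (ch_pos n);
  destruct (Nat.eq_dec m n) as [e|e]; [ring|];
  assert (h3 : sinh (bpt a m + bpt a n) <> 0)
    by (apply Rgt_not_eq, sinh_gt_0; pose proof (bpt_pos m); pose proof (bpt_pos n); lra);
  assert (h2 : sinh (bpt a m - bpt a n) <> 0)
    by (intros h; apply (rr_inj n m); [lia|]; pose proof (rr_minus n m) as h'; rewrite h in h'; lra).

(** [csch_diff] followed by telescoping. The term 1/sinh (2 b) comes from the index m = n skipped in
    the row; only [tele] depends on N. The two lemmas after it follow the same pattern, with a minus
    sign because 2 n + 1 is odd. *)
Lemma row_ch (N n : nat) : (n <= N)%nat ->
  row_sum (lat_sqr a) (lat_cosh a) N n = / (2 * lat_sinh a n) * (tele csch_j N n + / sinh (2 * bpt a n)).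
Proof.
  intros H. rewrite <- bpt_2. fold (csch_j (2 * n + 1)). unfold tele.
  rewrite <- (odd_row_sum csch_j n N csch_j_0 H), <- sum_n_Rscal.
  apply sum_n_Rext; intros m _. lattice_case m n.
  unfold lat_sqr, lat_cosh, lat_sinh in *. rewrite csch_diff by (auto; lra). f_equal.
  f_equal; [|unfold csch_j; now rewrite bpt_plus].
  unfold csch_j. destruct (lt_dec m n).
  - rewrite <- bpt_minus by lia. rewrite <- Rinv_opp, <- sinh_opp. do 2 f_equal. ring.
  - rewrite <- bpt_minus by lia. reflexivity.
Qed.

Lemma row_ash (N n : nat) : (n <= N)%nat ->
  row_sum (lat_sqr a) (fun m => (-1) ^ m * lat_sinh a m) N n
  = (-1) ^ n / (2 * lat_cosh a n) * (tele acsch_j N n - / sinh (2 * bpt a n)).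
Proof.
  intros H. rewrite <- bpt_2.
  replace (- / sinh (INR (2 * n + 1) * a)) with (acsch_j (2 * n + 1)).
  2:{ unfold acsch_j. rewrite pow_add, pow_mult. replace ((-1) ^ 2) with 1 by ring. rewrite pow1. ring. }
  unfold Rminus. replace (- / _) with (acsch_j (2 * n + 1)).
  2:{ unfold acsch_j. rewrite pow_add, pow_mult. replace ((-1) ^ 2) with 1 by ring. rewrite pow1. ring. }
  unfold tele.
  rewrite <- (odd_row_sum acsch_j n N acsch_j_0 H), <- sum_n_Rscal.
  apply sum_n_Rext; intros m _. lattice_case m n.
  replace ((-1) ^ m * lat_sinh a m / (lat_sqr a m - lat_sqr a n)) with ((-1) ^ m * (lat_sinh a m / (lat_sqr a m - lat_sqr a n))) by (unfold Rdiv; ring).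
  unfold lat_sqr, lat_cosh, lat_sinh in *. rewrite csch_sum by auto.
  rewrite Rmult_plus_distr_l, Rmult_plus_distr_l.
  unfold Rdiv. rewrite Rmult_assoc. unfold Rminus. rewrite Rmult_plus_distr_l, Rmult_plus_distr_l.
  f_equal.
  - unfold acsch_j. destruct (lt_dec m n).
    + rewrite <- bpt_minus by lia. rewrite (pow_m1_add n m) by lia.
      replace (bpt a m + - bpt a n) with (- (bpt a n - bpt a m)) by ring.
      rewrite sinh_opp, Rinv_opp. pose proof (pow_m1_sqr (n - m)) as E.
      transitivity ((-1) ^ m * (/ (2 * cosh (bpt a n)) * - / sinh (bpt a n - bpt a m)) * ((-1) ^ (n - m) * (-1) ^ (n - m))); [rewrite E; ring|ring].
    + rewrite <- bpt_minus by lia. rewrite (pow_m1_add m n) by lia. unfold Rminus. ring.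
  - rewrite bpt_plus. unfold acsch_j. rewrite (pow_m1_add1 m n) at 1. ring.
Qed.

Lemma row_ashch (N n : nat) : (n <= N)%nat ->
  row_sum (lat_sqr a) (fun m => (-1) ^ m * (lat_sinh a m * lat_cosh a m)) N n
  = (-1) ^ n / 2 * (tele acoth_j N n - cosh (2 * bpt a n) / sinh (2 * bpt a n)).
Proof.
  intros H. rewrite <- bpt_2.
  unfold Rminus. replace (- (_ / _)) with (acoth_j (2 * n + 1)).
  2:{ unfold acoth_j. rewrite pow_add, pow_mult. replace ((-1) ^ 2) with 1 by ring. rewrite pow1. ring. }
  unfold tele.
  rewrite <- (odd_row_sum acoth_j n N acoth_j_0 H), <- sum_n_Rscal.
  apply sum_n_Rext; intros m _. lattice_case m n.
  replace ((-1) ^ m * (lat_sinh a m * lat_cosh a m) / (lat_sqr a m - lat_sqr a n)) with ((-1) ^ m * (lat_sinh a m * lat_cosh a m / (lat_sqr a m - lat_sqr a n))) by (unfold Rdiv; ring).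
  unfold lat_sqr, lat_cosh, lat_sinh in *. rewrite coth_sum by auto.
  rewrite Rmult_plus_distr_l, Rmult_plus_distr_l.
  unfold Rminus. rewrite (Rmult_plus_distr_l ((-1) ^ n / 2)).
  f_equal.
  - unfold acoth_j. destruct (lt_dec m n).
    + rewrite <- bpt_minus by lia. rewrite (pow_m1_add n m) by lia.
      replace (bpt a m + - bpt a n) with (- (bpt a n - bpt a m)) by ring.
      rewrite sinh_opp, cosh_opp. unfold Rdiv. rewrite Rinv_opp. pose proof (pow_m1_sqr (n - m)) as E.
      transitivity ((-1) ^ m * (/ 2 * (cosh (bpt a n - bpt a m) * - / sinh (bpt a n - bpt a m))) * ((-1) ^ (n - m) * (-1) ^ (n - m))); [rewrite E; ring|ring].
    + rewrite <- bpt_minus by lia. rewrite (pow_m1_add m n) by lia. unfold Rminus, Rdiv. ring.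
  - rewrite bpt_plus. unfold acoth_j. rewrite (pow_m1_add1 m n) at 1. unfold Rdiv. ring.
Qed.

End Lattice.

(** * Pole expansions of the Jacobi functions *)

Lemma Series_Rabs_le (u M : nat -> R) :
  (forall n, Rabs (u n) <= M n) -> ex_series M -> Rabs (Series u) <= Series M.
Proof.
  intros H HM.
  assert (Hu : ex_series (fun n => Rabs (u n))).
  { apply ex_series_Rabs_le with M; [|easy]. intros n. now rewrite Rabs_Rabsolu. }
  eapply Rle_trans; [now apply Series_Rabs|].
  apply Series_le; [|easy]. intros n. split; [apply Rabs_pos|apply H].
Qed.

Section Lattice.
Context (a : R) (Ha : 0 < a).
Notation sh := (lat_sinh a).
Notation ch := (lat_cosh a).
Notation rr := (lat_sqr a).

(** Room to the left of Y = 0: this value is reached at y = 0 on the line z = i y, and a derivative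
    there needs a two-sided neighbourhood. The factors 2 in the next bounds are the price. *)
Lemma rr_lower (Y : R) (n : nat) : - rr 0%nat / 2 <= Y -> rr n / 2 <= rr n + Y.
Proof.
  intros H. pose proof (sh_ge_sh0 a Ha n). pose proof (sh_pos a Ha 0). unfold lat_sqr in *. nra.
Qed.

Lemma rr_pos (n : nat) : 0 < rr n.
Proof. unfold lat_sqr. apply pow_lt, sh_pos, Ha. Qed.

Lemma rr_plus_pos (Y : R) (n : nat) : - rr 0%nat / 2 <= Y -> 0 < rr n + Y.
Proof. intros H. pose proof (rr_lower Y n H). pose proof (rr_pos n). lra. Qed.

Lemma inv_rr_le (Y : R) (n : nat) : - rr 0%nat / 2 <= Y -> / (rr n + Y) <= 2 * / sh n ^ 2.
Proof.
  intros H. pose proof (rr_lower Y n H). pose proof (rr_pos n).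
  replace (2 * / sh n ^ 2) with (/ (rr n / 2)).
  - apply Rinv_le_contravar; lra.
  - unfold lat_sqr in *. pose proof (sh_pos a Ha n). field. lra.
Qed.

Lemma div_rr_bound (A : nat -> R) (K Y : R) (n : nat) : - rr 0%nat / 2 <= Y ->
  Rabs (A n) <= K * sh n -> Rabs (A n / (rr n + Y)) <= 2 * K / sh n.
Proof.
  intros H HA. pose proof (inv_rr_le Y n H) as H1. pose proof (rr_plus_pos Y n H) as H2.
  pose proof (sh_pos a Ha n). unfold Rdiv. rewrite Rabs_mult, Rabs_inv, (Rabs_pos_eq (rr n + Y)) by lra.
  apply Rle_trans with (K * sh n * (2 * / sh n ^ 2)).
  - apply Rmult_le_compat; auto using Rabs_pos. left; now apply Rinv_0_lt_compat.
  - right. field. lra.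
Qed.

Lemma div_rr2_bound (A : nat -> R) (K Y : R) (n : nat) : - rr 0%nat / 2 <= Y ->
  Rabs (A n) <= K * sh n ^ 3 -> Rabs (A n / (rr n + Y) ^ 2) <= 4 * K / sh n.
Proof.
  intros H HA. pose proof (inv_rr_le Y n H) as H1. pose proof (rr_plus_pos Y n H) as H2.
  pose proof (sh_pos a Ha n). unfold Rdiv.
  rewrite Rabs_mult, Rabs_inv, (Rabs_pos_eq ((rr n + Y) ^ 2)) by (apply pow_le; lra).
  apply Rle_trans with (K * sh n ^ 3 * (2 * / sh n ^ 2) ^ 2).
  - apply Rmult_le_compat; auto using Rabs_pos.
    + left. apply Rinv_0_lt_compat, pow_lt; lra.
    + rewrite <- pow_inv. apply pow_incr. split; [left; now apply Rinv_0_lt_compat|easy].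
  - right. field. lra.
Qed.

Lemma one_le_sh (n : nat) : 1 <= / sh 0%nat * sh n.
Proof.
  pose proof (sh_ge_sh0 a Ha n). pose proof (sh_pos a Ha 0).
  apply Rmult_le_reg_l with (sh 0%nat); [lra|]. rewrite <- Rmult_assoc, Rinv_r; lra.
Qed.

Lemma le_sh3 (x K : R) (n : nat) : 0 <= K -> x <= K * sh n -> x <= K * / sh 0%nat ^ 2 * sh n ^ 3.
Proof.
  intros HK H. pose proof (one_le_sh n) as H1. pose proof (sh_pos a Ha n). pose proof (sh_pos a Ha 0).
  assert (1 <= (/ sh 0%nat * sh n) ^ 2) by nra.
  eapply Rle_trans; [exact H|].
  replace (K * / sh 0%nat ^ 2 * sh n ^ 3) with (K * sh n * (/ sh 0%nat * sh n) ^ 2) by (field; lra).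
  assert (0 <= K * sh n) by nra. nra.
Qed.

Lemma ex_series_div_rr (A : nat -> R) (K Y : R) : - rr 0%nat / 2 <= Y ->
  (forall n, Rabs (A n) <= K * sh n) -> ex_series (fun n => A n / (rr n + Y)).
Proof.
  intros H HA. apply (ex_series_sh_bound a Ha _ (2 * K)). intros n. now apply div_rr_bound.
Qed.

Lemma ex_series_div_rr2 (A : nat -> R) (K Y : R) : - rr 0%nat / 2 <= Y ->
  (forall n, Rabs (A n) <= K * sh n ^ 3) -> ex_series (fun n => A n / (rr n + Y) ^ 2).
Proof.
  intros H HA. apply (ex_series_sh_bound a Ha _ (4 * K)). intros n. now apply div_rr2_bound.
Qed.

(* The constants [D n] only restore convergence when [A n / rr n] is not summable. *)
Lemma is_derive_pole_series (A D : nat -> R) (K Y : R) : - rr 0%nat / 2 < Y ->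
  (forall n, Rabs (A n) <= K * sh n ^ 3) ->
  (forall Y, - rr 0%nat / 2 <= Y -> ex_series (fun n => A n / (rr n + Y) - D n)) ->
  is_derive (fun Y => Series (fun n => A n / (rr n + Y) - D n)) Y
            (- Series (fun n => A n / (rr n + Y) ^ 2)).
Proof.
  intros HY HA Hex.
  assert (HK : 0 <= K).
  { specialize (HA 0%nat). pose proof (Rabs_pos (A 0%nat)). pose proof (pow_lt _ 3 (sh_pos a Ha 0)). nra. }
  pose proof (sh_pos a Ha 0) as Hs0.
  pose (M := fun n => 8 * K * / sh 0%nat ^ 2 * / sh n).
  apply (is_derive_quadratic _ _ _ (Series M) (Y + rr 0%nat / 2)); [lra|].
  intros h Hh. apply Rabs_def2 in Hh.
  assert (HYh : - rr 0%nat / 2 <= Y + h) by lra.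
  assert (HY' : - rr 0%nat / 2 <= Y) by lra.
  assert (E2 := ex_series_div_rr2 A K Y HY' HA).
  replace (h * - Series (fun n => A n / (rr n + Y) ^ 2)) with (- Series (fun n => h * (A n / (rr n + Y) ^ 2)))
    by (rewrite Series_scal_l; ring).
  (* The exact second-order remainder of a simple pole, bounded uniformly in h by h^2 times a
     multiple of [/ sh n]. *)
  replace (_ - _ - - _) with (Series (fun n => A n * h ^ 2 / ((rr n + Y) ^ 2 * (rr n + (Y + h))))).
  - rewrite Rmult_comm, <- Series_scal_l. apply Series_Rabs_le.
    + intros n. unfold M. pose proof (sh_pos a Ha n) as Hs.
      pose proof (inv_rr_le Y n HY') as H1. pose proof (rr_plus_pos Y n HY') as H2.
      pose proof (inv_rr_le _ n HYh) as H1'. pose proof (rr_plus_pos _ n HYh) as H2'.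
      unfold Rdiv. rewrite Rabs_mult, Rabs_mult, Rinv_mult, Rabs_mult, Rabs_inv, Rabs_inv.
      rewrite (Rabs_pos_eq (h ^ 2)) by nra.
      rewrite (Rabs_pos_eq ((rr n + Y) ^ 2)) by nra.
      rewrite (Rabs_pos_eq (rr n + (Y + h))) by lra.
      apply Rle_trans with (K * sh n ^ 3 * h ^ 2 * ((2 * / sh n ^ 2) ^ 2 * (2 * / sh n ^ 2))).
      * apply Rmult_le_compat.
        -- apply Rmult_le_pos; [apply Rabs_pos|nra].
        -- apply Rmult_le_pos; left; apply Rinv_0_lt_compat; [apply pow_lt|]; lra.
        -- apply Rmult_le_compat_r; [nra|apply HA].
        -- apply Rmult_le_compat; auto.
           ++ left; apply Rinv_0_lt_compat, pow_lt; lra.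
           ++ left; apply Rinv_0_lt_compat; lra.
           ++ rewrite <- pow_inv. apply pow_incr. split; [left; now apply Rinv_0_lt_compat|easy].
      * replace (K * sh n ^ 3 * h ^ 2 * ((2 * / sh n ^ 2) ^ 2 * (2 * / sh n ^ 2)))
          with (h ^ 2 * (8 * K * / sh n) * / sh n ^ 2) by (field; lra).
        replace (h ^ 2 * (8 * K * / sh 0%nat ^ 2 * / sh n)) with (h ^ 2 * (8 * K * / sh n) * / sh 0%nat ^ 2) by ring.
        apply Rmult_le_compat_l.
        -- apply Rmult_le_pos; [nra|]. apply Rmult_le_pos; [lra|]. left; now apply Rinv_0_lt_compat.
        -- apply Rinv_le_contravar; [apply pow_lt; lra|]. apply pow_incr. split; [lra|]. now apply sh_ge_sh0.
    + apply ex_series_scal_R. unfold M. apply ex_series_scal_R, ex_series_inv_sh, Ha.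
  - match goal with |- _ = ?x - ?y - - ?z => replace (x - y - - z) with (x - y + z) by ring end.
    rewrite <- Series_minus by (apply Hex; lra).
    rewrite <- Series_plus.
    + apply Series_ext. intros n.
      pose proof (rr_plus_pos Y n HY') as H2. pose proof (rr_plus_pos _ n HYh) as H2'. field. lra.
    + apply (ex_series_minus (V := R_NormedModule)); apply Hex; lra.
    + now apply ex_series_scal_R.
Qed.

(* [w] compensates the oscillation of the partial sums of [B n / (rr n + Y)]. *)
Lemma pole_product_limit (A B w c : nat -> R) (K K' Y : R) : 0 <= Y ->
  (forall n, Rabs (A n * B n) <= K' * sh n ^ 3) ->
  (forall N n, (n <= N)%nat ->
     Rabs (A n * (row_sum rr B N n + w N) + B n * row_sum rr A N n) <= K * sh n) ->
  (forall n, is_lim_seq (fun N => A n * (row_sum rr B N n + w N) + B n * row_sum rr A N n) (c n)) ->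
  is_lim_seq (fun N => sum_n (fun n => A n / (rr n + Y)) N
                       * (sum_n (fun n => B n / (rr n + Y)) N + w N))
    (Series (fun n => A n * B n / (rr n + Y) ^ 2 + c n / (rr n + Y))).
Proof.
  intros HY HAB Hb Hl.
  assert (HY' : - rr 0%nat / 2 <= Y) by (pose proof (rr_pos 0); lra).
  apply is_lim_seq_ext with (fun N => sum_n (fun n => A n * B n / (rr n + Y) ^ 2 +
     (A n * (row_sum rr B N n + w N) + B n * row_sum rr A N n) / (rr n + Y)) N).
  - intros N. rewrite Rmult_plus_distr_l, simple_pole_product.
    + rewrite (Rmult_comm _ (w N)), <- sum_n_Rscal, <- sum_n_Rplus.
      apply sum_n_Rext; intros n _. unfold Rdiv. ring.
    + intros n. apply Rgt_not_eq. now apply rr_plus_pos.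
    + now apply rr_inj.
  - apply (tannery _ _ (fun n => (4 * K' + 2 * K) / sh n)).
    + intros N n Hn. eapply Rle_trans; [apply Rabs_triang|].
      unfold Rdiv at 3. rewrite Rmult_plus_distr_r. apply Rplus_le_compat.
      * apply (div_rr2_bound (fun n => A n * B n)); auto.
      * apply (div_rr_bound (fun n => A n * (row_sum rr B N n + w N) + B n * row_sum rr A N n)); auto.
    + apply ex_series_scal_R, ex_series_inv_sh, Ha.
    + intros n. apply is_lim_seq_plus'; [apply is_lim_seq_const|].
      apply (is_lim_seq_scal_r _ (/ (rr n + Y)) (c n)), Hl.
Qed.

End Lattice.

Lemma tele_lim (g : nat -> R) (n : nat) :
  ex_series g -> is_lim_seq (fun N => tele g N n) 0.
Proof.
  intros H. apply Series_is_lim in H. apply (is_lim_seq_incr_n _ n).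
  replace (Finite 0) with (Finite (Series g - Series g)) by (f_equal; ring).
  apply is_lim_seq_minus'.
  - apply is_lim_seq_ext with (sum_n g); [|easy]. intros N. f_equal. lia.
  - apply is_lim_seq_ext with (fun N => sum_n g (N + (2 * n + 1))).
    + intros N. f_equal. lia.
    + now apply (is_lim_seq_incr_n (sum_n g)).
Qed.

Lemma sum_n_le_Series (u : nat -> R) (N : nat) :
  (forall n, 0 <= u n) -> ex_series u -> sum_n u N <= Series u.
Proof.
  intros Hu H. apply Series_is_lim in H.
  apply (is_lim_seq_le_loc (fun _ => sum_n u N) (sum_n u) (sum_n u N) (Series u)); [|apply is_lim_seq_const|easy].
  exists N. intros M HM. replace M with (N + (M - N))%nat by lia. generalize (M - N)%nat.
  induction n as [|k IH]; [rewrite Nat.add_0_r; lra|].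
  rewrite Nat.add_succ_r, sum_Sn. specialize (Hu (S (N + k))). unfold plus; simpl. lra.
Qed.

Lemma tele_bound (g : nat -> R) (N n : nat) :
  ex_series (fun j => Rabs (g j)) -> Rabs (tele g N n) <= 2 * Series (fun j => Rabs (g j)).
Proof.
  intros H. unfold tele, Rminus. eapply Rle_trans; [apply Rabs_triang|]. rewrite Rabs_Ropp.
  assert (B : forall M, Rabs (sum_n g M) <= Series (fun j => Rabs (g j))).
  { intros M. eapply Rle_trans; [apply sum_n_Rabs|]. apply (sum_n_le_Series (fun j => Rabs (g j))); [|easy].
    intros; apply Rabs_pos. }
  pose proof (B (N - n)%nat). pose proof (B (N + n + 1)%nat). lra.
Qed.

Lemma row_sum_scal (r B : nat -> R) (c : R) (N n : nat) :
  row_sum r (fun m => c * B m) N n = c * row_sum r B N n.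
Proof.
  unfold row_sum. rewrite <- sum_n_Rscal. apply sum_n_Rext. intros m _.
  destruct (Nat.eq_dec m n); [ring|]. unfold Rdiv. ring.
Qed.

Lemma sum_n_pow_m1 (N : nat) : sum_n (fun n => (-1) ^ n) N = (1 + (-1) ^ N) / 2.
Proof.
  induction N as [|N IH]; [rewrite sum_O; simpl; field|].
  rewrite sum_Sn, IH. unfold plus; simpl. field.
Qed.

Section Lattice.
Context (a : R) (Ha : 0 < a).
Notation sh := (lat_sinh a).
Notation ch := (lat_cosh a).
Notation rr := (lat_sqr a).

(** From coth x = 1 + exp (- x)/sinh x: the summable part of [acoth_j], whose own partial sums keep
    oscillating. *)
Definition hcoth_j (j : nat) : R := (-1) ^ j * (exp (- (INR j * a)) * / sinh (INR j * a)).

Lemma sinh_j_ge (j : nat) : sinh a * exp a ^ j <= sinh (INR (S j) * a).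
Proof.
  rewrite S_INR. replace ((INR j + 1) * a) with (a + INR j * a) by ring.
  rewrite <- exp_INR_mult. apply sinh_plus_exp. apply Rmult_le_pos; [apply pos_INR|lra].
Qed.

Lemma inv_sinh_j_le (j : nat) : 0 < / sinh (INR (S j) * a) <= / sinh a * / exp a ^ j.
Proof.
  pose proof (sinh_j_ge j). pose proof (sinh_gt_0 a Ha). pose proof (exp_ge_1 a Ha j).
  assert (0 < sinh a * exp a ^ j) by (apply Rmult_lt_0_compat; lra).
  split; [apply Rinv_0_lt_compat; lra|]. rewrite <- Rinv_mult. apply Rinv_le_contravar; lra.
Qed.

Lemma ex_series_j (g : nat -> R) :
  (forall j, Rabs (g (S j)) <= / sinh (INR (S j) * a)) -> ex_series (fun j => Rabs (g j)).
Proof.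
  intros H. apply (ex_series_incr_1 (fun j => Rabs (g j))).
  apply ex_series_Rabs_le with (fun j => / sinh a * / exp a ^ j).
  - intros j. rewrite Rabs_Rabsolu. eapply Rle_trans; [apply H|apply inv_sinh_j_le].
  - apply ex_series_scal_R, ex_series_exp_geom, Ha.
Qed.

Lemma ex_csch_j : ex_series (fun j => Rabs (csch_j a j)).
Proof.
  apply ex_series_j. intros j. unfold csch_j. pose proof (inv_sinh_j_le j). rewrite Rabs_pos_eq; lra.
Qed.

Lemma ex_acsch_j : ex_series (fun j => Rabs (acsch_j a j)).
Proof.
  apply ex_series_j. intros j. unfold acsch_j. pose proof (inv_sinh_j_le j).
  rewrite Rabs_mult, Rabs_pow_m1, Rabs_pos_eq; lra.
Qed.

Lemma ex_hcoth_j : ex_series (fun j => Rabs (hcoth_j j)).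
Proof.
  apply ex_series_j. intros j. unfold hcoth_j. pose proof (inv_sinh_j_le j).
  assert (0 < exp (- (INR (S j) * a)) <= 1).
  { split; [apply exp_pos|]. rewrite <- exp_0. left; apply exp_increasing.
    pose proof (lt_0_INR (S j) ltac:(lia)). nra. }
  rewrite Rabs_mult, Rabs_pow_m1, Rabs_pos_eq by nra. nra.
Qed.

Lemma sum_n_acoth (N : nat) : sum_n (acoth_j a) N = sum_n hcoth_j N + ((-1) ^ N - 1) / 2.
Proof.
  induction N as [|N IH].
  - rewrite !sum_O, acoth_j_0. unfold hcoth_j. simpl INR. rewrite Rmult_0_l, sinh_0, Rinv_0. simpl. field.
  - rewrite !sum_Sn, IH. pose proof (sinh_j_neq0 a Ha (S N) ltac:(lia)).
    replace (acoth_j a (S N)) with (hcoth_j (S N) + (-1) ^ S N).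
    + unfold plus; simpl. field.
    + unfold acoth_j, hcoth_j.
      replace (cosh (INR (S N) * a)) with (exp (- (INR (S N) * a)) + sinh (INR (S N) * a))
        by (unfold sinh, cosh; field).
      field. auto.
Qed.

(** The summand 1 of coth leaves the oscillation (-1)^n (-1)^N, which does not tend to 0. In
    [coef_PT] and [coef_QT] it is cancelled by the compensator - (-1)^N attached to the series of
    t. *)
Lemma tele_acoth (N n : nat) : (n <= N)%nat ->
  tele (acoth_j a) N n = tele hcoth_j N n + (-1) ^ n * (-1) ^ N.
Proof.
  intros H. unfold tele. rewrite !sum_n_acoth.
  replace ((-1) ^ (N - n)) with ((-1) ^ N * (-1) ^ n).
  - rewrite !pow_add. simpl. field.
  - rewrite (pow_m1_add N n H). pose proof (pow_m1_sqr n) as E.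
    transitivity ((-1) ^ (N - n) * ((-1) ^ n * (-1) ^ n)); [ring|]. rewrite E. ring.
Qed.

(* Residues in the variable Y = - sinh^2 z, the terms of b and - b being grouped: with b running over (n + 1/2) a,
   s = sum csch (z + b), s~ = sum (-1)^n csch (z + b), t = sum (-1)^n coth (z + b), one has
   s = - sinh z * [serP], s~ = cosh z * [serQ], t = [serT]. *)
Definition resP (n : nat) : R := 2 * ch n.
Definition resQ (n : nat) : R := 2 * ((-1) ^ n * sh n).
Definition resT (n : nat) : R := 2 * ((-1) ^ n * (sh n * ch n)).

Definition serP (Y : R) : R := Series (fun n => resP n / (rr n + Y)).
Definition serQ (Y : R) : R := Series (fun n => resQ n / (rr n + Y)).
(** The terms [resT n / (rr n + Y)] approach 2 (-1)^n. This divergent part is removed and replaced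
    by 1, its Cesaro sum. *)
Definition serT (Y : R) : R := 1 + Series (fun n => resT n / (rr n + Y) - 2 * (-1) ^ n).
Definition serP2 (Y : R) : R := Series (fun n => resP n / (rr n + Y) ^ 2).
Definition serQ2 (Y : R) : R := Series (fun n => resQ n / (rr n + Y) ^ 2).
Definition serT2 (Y : R) : R := Series (fun n => resT n / (rr n + Y) ^ 2).

Let kap := / sh 0%nat + 1.
Let X := 2 * (Series (fun j => Rabs (csch_j a j)) + Series (fun j => Rabs (acsch_j a j))
              + Series (fun j => Rabs (hcoth_j j))).

Lemma tele_bounds (N n : nat) :
  Rabs (tele (csch_j a) N n + tele (acsch_j a) N n) <= X /\
  Rabs (tele hcoth_j N n + tele (csch_j a) N n) <= X /\
  Rabs (tele hcoth_j N n + tele (acsch_j a) N n) <= X /\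
  Rabs (tele (csch_j a) N n) <= X.
Proof.
  unfold X.
  pose proof (tele_bound _ N n ex_csch_j) as h1.
  pose proof (tele_bound _ N n ex_acsch_j) as h2.
  pose proof (tele_bound _ N n ex_hcoth_j) as h3.
  pose proof (Rabs_pos (tele (csch_j a) N n)) as p1.
  pose proof (Rabs_pos (tele (acsch_j a) N n)) as p2.
  pose proof (Rabs_pos (tele hcoth_j N n)) as p3.
  split; [|split; [|split; [|lra]]]; (eapply Rle_trans; [apply Rabs_triang|]; lra).
Qed.

Lemma kap_pos : 0 < kap.
Proof. unfold kap. pose proof (Rinv_0_lt_compat _ (sh_pos a Ha 0)). lra. Qed.

Lemma X_pos : 0 <= X.
Proof. destruct (tele_bounds 0 0) as (_ & _ & _ & H). pose proof (Rabs_pos (tele (csch_j a) 0 0)). lra. Qed.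

Lemma Pc_bound (n : nat) : Rabs (resP n) <= 2 * kap * sh n.
Proof.
  unfold resP. pose proof (ch_pos a n). pose proof (ch_le_sh a Ha n) as Hk. fold kap in Hk.
  rewrite Rabs_pos_eq by lra. lra.
Qed.

Lemma Qc_bound (n : nat) : Rabs (resQ n) <= 2 * sh n.
Proof.
  unfold resQ. pose proof (sh_pos a Ha n).
  rewrite !Rabs_mult, Rabs_pow_m1, (Rabs_pos_eq 2), (Rabs_pos_eq (sh n)) by lra. lra.
Qed.

Lemma Tc_bound (n : nat) : Rabs (resT n) <= 2 * kap * sh n ^ 2.
Proof.
  unfold resT. pose proof (sh_pos a Ha n). pose proof (ch_pos a n). pose proof (ch_le_sh a Ha n) as Hk. fold kap in Hk.
  rewrite !Rabs_mult, Rabs_pow_m1, (Rabs_pos_eq 2), (Rabs_pos_eq (sh n)), (Rabs_pos_eq (ch n)) by lra. nra.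
Qed.

Lemma sh_pow_le (x K : R) (n : nat) : 0 <= K -> x <= K * sh n ^ 2 -> x <= K * / sh 0%nat * sh n ^ 3.
Proof.
  intros HK H. pose proof (one_le_sh a Ha n). pose proof (sh_pos a Ha n).
  assert (0 <= K * sh n ^ 2) by nra.
  replace (K * / sh 0%nat * sh n ^ 3) with (K * sh n ^ 2 * (/ sh 0%nat * sh n)) by ring. nra.
Qed.

Lemma Tf_term_bound (Y : R) (n : nat) : - rr 0%nat / 2 <= Y ->
  Rabs (resT n / (rr n + Y) - 2 * (-1) ^ n) <= 2 * (2 * (1 + Rabs Y) * / sh 0%nat) / sh n.
Proof.
  intros HY. pose proof (rr_plus_pos a Ha Y n HY) as Hp.
  replace (resT n / (rr n + Y) - 2 * (-1) ^ n)
    with (2 * (-1) ^ n * (sh n * (ch n - sh n) - Y) / (rr n + Y)).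
  2:{ unfold resT, lat_sqr in *. field. lra. }
  apply (div_rr_bound a Ha (fun n => 2 * (-1) ^ n * (sh n * (ch n - sh n) - Y))); [easy|].
  rewrite !Rabs_mult, Rabs_pow_m1, (Rabs_pos_eq 2) by lra.
  pose proof (one_le_sh a Ha n). pose proof (Rabs_pos Y).
  (* sh (ch - sh) is at most 1 because (ch - sh)(ch + sh) = 1. *)
  assert (Rabs (sh n * (ch n - sh n) - Y) <= 1 + Rabs Y).
  { eapply Rle_trans; [apply Rabs_triang|]. rewrite Rabs_Ropp. apply Rplus_le_compat_r.
    pose proof (sh_pos a Ha n). pose proof (ch_sqr a n). pose proof (ch_pos a n).
    assert (0 < ch n - sh n) by (unfold lat_sinh, lat_cosh; pose proof (sinh_lt_cosh (bpt a n)); lra).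
    rewrite Rabs_pos_eq by nra. nra. }
  replace (2 * (1 + Rabs Y) * / sh 0%nat * sh n) with (2 * (1 + Rabs Y) * (/ sh 0%nat * sh n)) by ring.
  nra.
Qed.

Lemma ex_Tf (Y : R) : - rr 0%nat / 2 <= Y -> ex_series (fun n => resT n / (rr n + Y) - 2 * (-1) ^ n).
Proof. intros HY. eapply (ex_series_sh_bound a Ha). intros n. now apply Tf_term_bound. Qed.

Lemma ex_Pf (Y : R) : - rr 0%nat / 2 <= Y -> ex_series (fun n => resP n / (rr n + Y)).
Proof. intros HY. eapply (ex_series_div_rr a Ha); [easy|apply Pc_bound]. Qed.

Lemma ex_Qf (Y : R) : - rr 0%nat / 2 <= Y -> ex_series (fun n => resQ n / (rr n + Y)).
Proof. intros HY. eapply (ex_series_div_rr a Ha); [easy|apply Qc_bound]. Qed.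

Lemma Pc_bound3 (n : nat) : Rabs (resP n) <= 2 * kap * / sh 0%nat ^ 2 * sh n ^ 3.
Proof. apply (le_sh3 a Ha); [pose proof kap_pos; lra|apply Pc_bound]. Qed.

Lemma Qc_bound3 (n : nat) : Rabs (resQ n) <= 2 * / sh 0%nat ^ 2 * sh n ^ 3.
Proof. apply (le_sh3 a Ha); [lra|apply Qc_bound]. Qed.

Lemma Tc_bound3 (n : nat) : Rabs (resT n) <= 2 * kap * / sh 0%nat * sh n ^ 3.
Proof. apply sh_pow_le; [pose proof kap_pos; lra|apply Tc_bound]. Qed.

Lemma Pf_derive (Y : R) : - rr 0%nat / 2 < Y -> is_derive serP Y (- serP2 Y).
Proof.
  intros HY. apply is_derive_ext with (fun Y => Series (fun n => resP n / (rr n + Y) - 0)).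
  - intros t. apply Series_ext. intros n. ring.
  - eapply (is_derive_pole_series a Ha resP (fun _ => 0)); [easy|apply Pc_bound3|].
    intros Z HZ. apply ex_series_ext with (fun n => resP n / (rr n + Z)); [intros n; symmetry; apply Rminus_0_r|now apply ex_Pf].
Qed.

Lemma Qf_derive (Y : R) : - rr 0%nat / 2 < Y -> is_derive serQ Y (- serQ2 Y).
Proof.
  intros HY. apply is_derive_ext with (fun Y => Series (fun n => resQ n / (rr n + Y) - 0)).
  - intros t. apply Series_ext. intros n. ring.
  - eapply (is_derive_pole_series a Ha resQ (fun _ => 0)); [easy|apply Qc_bound3|].
    intros Z HZ. apply ex_series_ext with (fun n => resQ n / (rr n + Z)); [intros n; symmetry; apply Rminus_0_r|now apply ex_Qf].
Qed.

Lemma Tf_derive (Y : R) : - rr 0%nat / 2 < Y -> is_derive serT Y (- serT2 Y).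
Proof.
  intros HY. unfold serT.
  replace (- serT2 Y) with (0 + - serT2 Y) by ring.
  apply (is_derive_plus (V := R_NormedModule)); [apply @is_derive_const|].
  eapply (is_derive_pole_series a Ha resT (fun n => 2 * (-1) ^ n)); [easy|apply Tc_bound3|apply ex_Tf].
Qed.

(** The partial sums of 2 (-1)^n are 1 + (-1)^N, so that the correction - (-1)^N leaves exactly the
    constant 1 of [serT]. This makes it the right weight for the products with [serT]. *)
Lemma Tf_lim (Y : R) : - rr 0%nat / 2 <= Y ->
  is_lim_seq (fun N => sum_n (fun n => resT n / (rr n + Y)) N + - (-1) ^ N) (serT Y).
Proof.
  intros HY. apply is_lim_seq_ext with (fun N => 1 + sum_n (fun n => resT n / (rr n + Y) - 2 * (-1) ^ n) N).
  - intros N. rewrite sum_n_Rminus, sum_n_Rscal, sum_n_pow_m1. field.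
  - apply is_lim_seq_plus'; [apply is_lim_seq_const|]. now apply Series_is_lim, ex_Tf.
Qed.

Lemma pole_limit_unique (A B w c : nat -> R) (LA LB K K' Y : R) : 0 <= Y ->
  (forall n, Rabs (A n * B n) <= K' * sh n ^ 3) ->
  (forall N n, (n <= N)%nat ->
     Rabs (A n * (row_sum rr B N n + w N) + B n * row_sum rr A N n) <= K * sh n) ->
  (forall n, is_lim_seq (fun N => A n * (row_sum rr B N n + w N) + B n * row_sum rr A N n) (c n)) ->
  is_lim_seq (sum_n (fun n => A n / (rr n + Y))) LA ->
  is_lim_seq (fun N => sum_n (fun n => B n / (rr n + Y)) N + w N) LB ->
  LA * LB = Series (fun n => A n * B n / (rr n + Y) ^ 2 + c n / (rr n + Y)).
Proof.
  intros HY H1 H2 H3 HA HB.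
  pose proof (pole_product_limit a Ha A B w c K K' Y HY H1 H2 H3) as HL.
  pose proof (is_lim_seq_mult' _ _ _ _ HA HB) as HM.
  apply is_lim_seq_unique in HL. apply is_lim_seq_unique in HM. congruence.
Qed.

(** This is the coefficient of the simple pole at Y = - [rr n] in the truncated product. The terms
    1/sinh (2 b) of the two row sums cancel, so nothing survives in the limit; in the three lemmas
    that follow an elementary term remains. *)
Lemma coef_PQ (N n : nat) : (n <= N)%nat ->
  resP n * (row_sum rr resQ N n + 0) + resQ n * row_sum rr resP N n
  = 2 * (-1) ^ n * (tele (csch_j a) N n + tele (acsch_j a) N n).
Proof.
  intros H. unfold resP, resQ. rewrite !row_sum_scal, (row_ch a Ha), (row_ash a Ha), sinh_double by easy.
  fold (sh n) (ch n). pose proof (sh_pos a Ha n). pose proof (ch_pos a n). field. lra.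
Qed.

Lemma coef_PP (N n : nat) : (n <= N)%nat ->
  resP n * (row_sum rr resP N n + 0) + resP n * row_sum rr resP N n
  = 4 * (ch n / sh n) * tele (csch_j a) N n + 2 / sh n ^ 2.
Proof.
  intros H. unfold resP. rewrite !row_sum_scal, (row_ch a Ha), sinh_double by easy.
  fold (sh n) (ch n). pose proof (sh_pos a Ha n). pose proof (ch_pos a n). field. lra.
Qed.

Lemma coef_PT (N n : nat) : (n <= N)%nat ->
  resP n * (row_sum rr resT N n + - (-1) ^ N) + resT n * row_sum rr resP N n
  = 2 * (-1) ^ n * ch n * (tele hcoth_j N n + tele (csch_j a) N n) - 2 * (-1) ^ n * sh n.
Proof.
  intros H. unfold resP, resT. rewrite !row_sum_scal, (row_ch a Ha), (row_ashch a Ha), tele_acoth, cosh_double, sinh_double by easy.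
  fold (sh n) (ch n). pose proof (sh_pos a Ha n). pose proof (ch_pos a n). pose proof (pow_m1_sqr n) as E.
  apply Rminus_diag_uniq.
  transitivity (2 * ch n * (-1) ^ N * ((-1) ^ n * (-1) ^ n - 1)); [field; lra|rewrite E; ring].
Qed.

Lemma coef_QT (N n : nat) : (n <= N)%nat ->
  resQ n * (row_sum rr resT N n + - (-1) ^ N) + resT n * row_sum rr resQ N n
  = 2 * sh n * (tele hcoth_j N n + tele (acsch_j a) N n) - 2 * ch n.
Proof.
  intros H. unfold resQ, resT. rewrite !row_sum_scal, (row_ash a Ha), (row_ashch a Ha), tele_acoth, cosh_double, sinh_double by easy.
  fold (sh n) (ch n). pose proof (sh_pos a Ha n). pose proof (ch_pos a n). pose proof (pow_m1_sqr n) as E.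
  transitivity (((-1) ^ n * (-1) ^ n) * (2 * sh n * (tele hcoth_j N n + tele (acsch_j a) N n) - (2 + 2 * sh n ^ 2) / ch n)
     + 2 * (-1) ^ n * sh n * (-1) ^ N * ((-1) ^ n * (-1) ^ n - 1)); [field; lra|].
  rewrite E. replace (2 + 2 * sh n ^ 2) with (2 * ch n ^ 2) by (rewrite ch_sqr; ring). field. lra.
Qed.

End Lattice.

Lemma is_lim_seq_affine (u : nat -> R) (p q : R) :
  is_lim_seq u 0 -> is_lim_seq (fun N => p * u N + q) q.
Proof.
  intros H. replace (Finite q) with (Finite (p * 0 + q)) by (f_equal; ring).
  apply is_lim_seq_plus'; [|apply is_lim_seq_const].
  apply (is_lim_seq_scal_l u p 0), H.
Qed.

Lemma is_lim_seq_plus0 (u v : nat -> R) :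
  is_lim_seq u 0 -> is_lim_seq v 0 -> is_lim_seq (fun N => u N + v N) 0.
Proof.
  intros Hu Hv. replace (Finite 0) with (Finite (0 + 0)) by (f_equal; ring).
  now apply is_lim_seq_plus'.
Qed.

Section Lattice.
Context (a : R) (Ha : 0 < a).
Notation sh := (lat_sinh a).
Notation ch := (lat_cosh a).
Notation rr := (lat_sqr a).
Notation Pc := (resP a).
Notation Qc := (resQ a).
Notation Tc := (resT a).
Notation kap := (/ sh 0%nat + 1).
Let X := 2 * (Series (fun j => Rabs (csch_j a j)) + Series (fun j => Rabs (acsch_j a j))
              + Series (fun j => Rabs (hcoth_j a j))).

Lemma lim_csch (n : nat) : is_lim_seq (fun N => tele (csch_j a) N n) 0.
Proof. apply tele_lim, ex_series_Rabs, ex_csch_j, Ha. Qed.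
Lemma lim_acsch (n : nat) : is_lim_seq (fun N => tele (acsch_j a) N n) 0.
Proof. apply tele_lim, ex_series_Rabs, ex_acsch_j, Ha. Qed.
Lemma lim_hcoth (n : nat) : is_lim_seq (fun N => tele (hcoth_j a) N n) 0.
Proof. apply tele_lim, ex_series_Rabs, ex_hcoth_j, Ha. Qed.

Lemma le_sh (x : R) (n : nat) : 0 <= x -> x <= x * / sh 0%nat * sh n.
Proof.
  intros H. pose proof (one_le_sh a Ha n).
  replace (x * / sh 0%nat * sh n) with (x * (/ sh 0%nat * sh n)) by ring. nra.
Qed.

Lemma Pf_lim (Y : R) : 0 <= Y -> is_lim_seq (sum_n (fun n => Pc n / (rr n + Y))) (serP a Y).
Proof. intros H. apply Series_is_lim, ex_Pf; [easy|]. pose proof (rr_pos a Ha 0). lra. Qed.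

Lemma Qf_lim (Y : R) : 0 <= Y -> is_lim_seq (sum_n (fun n => Qc n / (rr n + Y))) (serQ a Y).
Proof. intros H. apply Series_is_lim, ex_Qf; [easy|]. pose proof (rr_pos a Ha 0). lra. Qed.

Lemma lim_plus_0 (u : nat -> R) (l : R) : is_lim_seq u l -> is_lim_seq (fun N => u N + 0) l.
Proof. apply is_lim_seq_ext. intros; ring. Qed.

Lemma Rabs_mult_le (x y p q : R) : Rabs x <= p -> Rabs y <= q -> Rabs (x * y) <= p * q.
Proof. intros. rewrite Rabs_mult. apply Rmult_le_compat; auto using Rabs_pos. Qed.

Lemma Rabs_minus_le (x y p q : R) : Rabs x <= p -> Rabs y <= q -> Rabs (x - y) <= p + q.
Proof. intros. unfold Rminus. eapply Rle_trans; [apply Rabs_triang|]. rewrite Rabs_Ropp. lra. Qed.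

Lemma Rabs_ch (n : nat) : Rabs (ch n) <= kap * sh n.
Proof. pose proof (ch_pos a n). pose proof (ch_le_sh a Ha n). rewrite Rabs_pos_eq; lra. Qed.

Lemma Rabs_sh (n : nat) : Rabs (sh n) <= 1 * sh n.
Proof. pose proof (sh_pos a Ha n). rewrite Rabs_pos_eq; lra. Qed.

Lemma Rabs_2pow (n : nat) : Rabs (2 * (-1) ^ n) <= 2.
Proof. rewrite Rabs_mult, Rabs_pow_m1, Rabs_pos_eq; lra. Qed.

Lemma prod_bound3 (A B : nat -> R) (K L : R) (n : nat) :
  0 <= K -> 0 <= L ->
  Rabs (A n) <= K * sh n -> Rabs (B n) <= L * sh n ->
  Rabs (A n * B n) <= K * L * / sh 0%nat * sh n ^ 3.
Proof.
  intros HK HL HA HB. apply (sh_pow_le a Ha); [nra|].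
  eapply Rle_trans; [apply Rabs_mult_le; eassumption|]. right; ring.
Qed.

(** Only double poles survive the limit, and [resP] times [resQ] is twice [resT]. In the variable Y
    this is t' = - s s~. *)
Lemma PQ_prod (Y : R) : 0 <= Y -> serP a Y * serQ a Y = 2 * serT2 a Y.
Proof.
  intros HY. unfold serT2. rewrite <- Series_scal_l.
  transitivity (Series (fun n => Pc n * Qc n / (rr n + Y) ^ 2 + 0 / (rr n + Y))).
  2:{ apply Series_ext; intros n. unfold resP, resQ, resT, Rdiv. ring. }
  pose proof (kap_pos a Ha) as Hk. pose proof (X_pos a Ha) as HX. fold X in HX.
  eapply (pole_limit_unique a Ha Pc Qc (fun _ => 0) (fun _ => 0) _ _ (2 * X * / sh 0%nat)
           (2 * kap * 2 * / sh 0%nat)); [easy| | | |now apply Pf_lim|now apply lim_plus_0, Qf_lim].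
  - intros n. apply (prod_bound3 Pc Qc); [lra|lra|apply (Pc_bound a Ha)|apply (Qc_bound a Ha)].
  - intros N n H. rewrite (coef_PQ a Ha) by easy.
    apply Rle_trans with (2 * X); [|apply le_sh; lra].
    apply Rabs_mult_le; [apply Rabs_2pow|apply (tele_bounds a Ha N n)].
  - intros n. apply is_lim_seq_ext_loc with
      (fun N => 2 * (-1) ^ n * (tele (csch_j a) N n + tele (acsch_j a) N n) + 0).
    + exists n. intros N HN. now rewrite (coef_PQ a Ha), Rplus_0_r.
    + apply is_lim_seq_affine, is_lim_seq_plus0; [apply lim_csch|apply lim_acsch].
Qed.

Lemma PT_prod (Y : R) : 0 <= Y -> serP a Y * serT a Y = - serQ a Y + Series (fun n => ch n ^ 2 * (2 * Qc n) / (rr n + Y) ^ 2).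
Proof.
  intros HY. pose proof (rr_pos a Ha 0) as Hr0. assert (HY' : - rr 0%nat / 2 <= Y) by lra.
  pose proof (kap_pos a Ha) as Hk. pose proof (X_pos a Ha) as HX. fold X in HX.
  transitivity (Series (fun n => Pc n * Tc n / (rr n + Y) ^ 2 + (- (2 * (-1) ^ n * sh n)) / (rr n + Y))).
  - eapply (pole_limit_unique a Ha Pc Tc (fun N => - (-1) ^ N) _ _ _ (2 * kap * X + 2)
           (2 * kap * (2 * kap))); [easy| | | |now apply Pf_lim|now apply (Tf_lim a Ha)].
    + intros n. eapply Rle_trans; [apply Rabs_mult_le; [apply (Pc_bound a Ha)|apply (Tc_bound a Ha)]|].
      right; ring.
    + intros N n H. rewrite (coef_PT a Ha) by easy.
      apply Rle_trans with (2 * (kap * sh n) * X + 2 * (1 * sh n)); [|right; ring].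
      apply Rabs_minus_le; apply Rabs_mult_le; auto using Rabs_sh, Rabs_2pow.
      * apply Rabs_mult_le; auto using Rabs_ch, Rabs_2pow.
      * apply (tele_bounds a Ha N n).
    + intros n. apply is_lim_seq_ext_loc with
        (fun N => 2 * (-1) ^ n * ch n * (tele (hcoth_j a) N n + tele (csch_j a) N n) + - (2 * (-1) ^ n * sh n)).
      * exists n. intros N HN. now rewrite (coef_PT a Ha).
      * apply is_lim_seq_affine, is_lim_seq_plus0; [apply lim_hcoth|apply lim_csch].
  - unfold serQ. rewrite <- Series_opp.
    rewrite <- Series_plus.
    + apply Series_ext; intros n. unfold resP, resQ, resT, Rdiv. ring.
    + apply (ex_series_opp (V := R_NormedModule)). now apply ex_Qf.
    + apply (ex_series_div_rr2 a Ha (fun n => ch n ^ 2 * (2 * Qc n)) (kap ^ 2 * (2 * 2))); [easy|].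
      intros n. apply Rle_trans with ((kap * sh n) ^ 2 * (2 * (2 * sh n))); [|right; ring].
      apply Rabs_mult_le.
      * rewrite <- RPow_abs. apply pow_incr. split; [apply Rabs_pos|apply Rabs_ch].
      * apply Rabs_mult_le; [rewrite Rabs_pos_eq; lra|apply (Qc_bound a Ha)].
Qed.

Lemma QT_prod (Y : R) : 0 <= Y -> serQ a Y * serT a Y = - serP a Y + Series (fun n => sh n ^ 2 * (2 * Pc n) / (rr n + Y) ^ 2).
Proof.
  intros HY. pose proof (rr_pos a Ha 0) as Hr0. assert (HY' : - rr 0%nat / 2 <= Y) by lra.
  pose proof (kap_pos a Ha) as Hk. pose proof (X_pos a Ha) as HX. fold X in HX.
  transitivity (Series (fun n => Qc n * Tc n / (rr n + Y) ^ 2 + (- (2 * ch n)) / (rr n + Y))).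
  - eapply (pole_limit_unique a Ha Qc Tc (fun N => - (-1) ^ N) _ _ _ (2 * X + 2 * kap)
           (2 * (2 * kap))); [easy| | | |now apply Qf_lim|now apply (Tf_lim a Ha)].
    + intros n. eapply Rle_trans; [apply Rabs_mult_le; [apply (Qc_bound a Ha)|apply (Tc_bound a Ha)]|].
      right; ring.
    + intros N n H. rewrite (coef_QT a Ha) by easy.
      apply Rle_trans with (2 * (1 * sh n) * X + 2 * (kap * sh n)); [|right; ring].
      apply Rabs_minus_le; apply Rabs_mult_le; auto using Rabs_ch.
      * apply Rabs_mult_le; auto using Rabs_sh. rewrite Rabs_pos_eq; lra.
      * apply (tele_bounds a Ha N n).
      * rewrite Rabs_pos_eq; lra.
    + intros n. apply is_lim_seq_ext_loc with
        (fun N => 2 * sh n * (tele (hcoth_j a) N n + tele (acsch_j a) N n) + - (2 * ch n)).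
      * exists n. intros N HN. now rewrite (coef_QT a Ha).
      * apply is_lim_seq_affine, is_lim_seq_plus0; [apply lim_hcoth|apply lim_acsch].
  - unfold serP. rewrite <- Series_opp.
    rewrite <- Series_plus.
    + apply Series_ext; intros n. unfold resP, resQ, resT, Rdiv. pose proof (pow_m1_sqr n) as E.
      transitivity (((-1) ^ n * (-1) ^ n) * (sh n ^ 2 * (2 * (2 * ch n))) * / (rr n + Y) ^ 2 + - (2 * ch n) * / (rr n + Y)); [ring|].
      rewrite E. ring.
    + apply (ex_series_opp (V := R_NormedModule)). now apply ex_Pf.
    + apply (ex_series_div_rr2 a Ha (fun n => sh n ^ 2 * (2 * Pc n)) (2 * (2 * kap))); [easy|].
      intros n. apply Rle_trans with ((1 * sh n) ^ 2 * (2 * (2 * kap * sh n))); [|right; ring].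
      apply Rabs_mult_le.
      * rewrite <- RPow_abs. apply pow_incr. split; [apply Rabs_pos|apply Rabs_sh].
      * apply Rabs_mult_le; [rewrite Rabs_pos_eq; lra|apply (Pc_bound a Ha)].
Qed.

(** Here the terms 1/sinh (2 b) add up instead of cancelling; the simple poles that they leave are
    the source of the constant u(0) in s^2 = u - u(0). *)
Lemma PP_prod (Y : R) : 0 <= Y ->
  serP a Y ^ 2 = Series (fun n => Pc n * Pc n / (rr n + Y) ^ 2 + 2 / sh n ^ 2 / (rr n + Y)).
Proof.
  intros HY. replace (serP a Y ^ 2) with (serP a Y * serP a Y) by ring.
  pose proof (kap_pos a Ha) as Hk. pose proof (X_pos a Ha) as HX. fold X in HX.
  pose proof (sh_pos a Ha 0) as Hs0. pose proof (Rinv_0_lt_compat _ Hs0) as Hi0.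
  eapply (pole_limit_unique a Ha Pc Pc (fun _ => 0) _ _ _ (4 * kap * X * / sh 0%nat + 2 * / sh 0%nat ^ 2 * / sh 0%nat)
           (2 * kap * (2 * kap) * / sh 0%nat)); [easy| | | |now apply Pf_lim|now apply lim_plus_0, Pf_lim].
  - intros n. apply (prod_bound3 Pc Pc); [lra|lra|apply (Pc_bound a Ha)|apply (Pc_bound a Ha)].
  - intros N n H. rewrite (coef_PP a Ha) by easy. pose proof (sh_pos a Ha n) as Hs.
    pose proof (sh_ge_sh0 a Ha n) as Hsg.
    rewrite Rmult_plus_distr_r. eapply Rle_trans; [apply Rabs_triang|]. apply Rplus_le_compat.
    + apply Rle_trans with (4 * kap * X); [|apply le_sh; nra].
      apply Rabs_mult_le; [|apply (tele_bounds a Ha N n)].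
      apply Rabs_mult_le; [rewrite Rabs_pos_eq; lra|].
      unfold Rdiv. rewrite Rabs_mult, Rabs_inv, (Rabs_pos_eq (sh n)) by lra.
      apply Rmult_le_reg_r with (sh n); [lra|]. rewrite Rmult_assoc, Rinv_l, Rmult_1_r by lra.
      apply Rabs_ch.
    + apply Rle_trans with (2 * / sh 0%nat ^ 2).
      * rewrite Rabs_pos_eq; [|apply Rlt_le, Rdiv_lt_0_compat; [lra|apply pow_lt; lra]].
        apply Rmult_le_compat_l; [lra|]. apply Rinv_le_contravar; [apply pow_lt; lra|].
        apply pow_incr. lra.
      * apply le_sh. pose proof (Rinv_0_lt_compat _ (pow_lt _ 2 Hs0)). lra.
  - intros n. apply is_lim_seq_ext_loc with
      (fun N => 4 * (ch n / sh n) * tele (csch_j a) N n + 2 / sh n ^ 2).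
    + exists n. intros N HN. now rewrite (coef_PP a Ha).
    + apply is_lim_seq_affine, lim_csch.
Qed.

(* [Uf] is the Weierstrass function sum csch^2 (z + b) over the points b = (n + 1/2) a, n in Z, in the variable Y = - sinh^2 z;
   the terms of b and - b are grouped. *)
Definition Uc (Y : R) (n : nat) : R := 2 * (sh n ^ 2 - Y * (1 + 2 * sh n ^ 2)) / (rr n + Y) ^ 2.
Definition Uf (Y : R) : R := Series (Uc Y).

Lemma Uc_bound (Y : R) (n : nat) : 0 <= Y ->
  Rabs (Uc Y n) <= 4 * (2 * (1 + Y * (/ sh 0%nat ^ 2 + 2)) * / sh 0%nat) / sh n.
Proof.
  intros HY. pose proof (rr_pos a Ha 0) as Hr0.
  pose proof (sh_pos a Ha 0) as Hs0. pose proof (sh_pos a Ha n) as Hs. pose proof (one_le_sh a Ha n) as H1.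
  assert (1 <= / sh 0%nat ^ 2 * sh n ^ 2).
  { rewrite <- pow_inv, <- Rpow_mult_distr. nra. }
  pose proof (Rinv_0_lt_compat _ (pow_lt _ 2 Hs0)) as Hi0.
  apply (div_rr2_bound a Ha (fun n => 2 * (sh n ^ 2 - Y * (1 + 2 * sh n ^ 2)))); [lra|].
  apply (sh_pow_le a Ha); [nra|].
  rewrite Rmult_assoc. apply Rabs_mult_le; [rewrite Rabs_pos_eq; lra|].
  rewrite Rmult_plus_distr_r. apply Rabs_minus_le; [rewrite Rabs_pos_eq; nra|].
  rewrite Rmult_assoc. apply Rabs_mult_le; [rewrite Rabs_pos_eq; lra|].
  rewrite Rabs_pos_eq by nra. lra.
Qed.

Lemma ex_Uf (Y : R) : 0 <= Y -> ex_series (Uc Y).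
Proof. intros HY. eapply (ex_series_sh_bound a Ha). intros n. now apply Uc_bound. Qed.

(** The relation s^2 = u - u(0), since s^2 = - Y [serP a Y]^2. *)
Lemma Uf_P (Y : R) : 0 <= Y -> Y * serP a Y ^ 2 = Uf 0 - Uf Y.
Proof.
  intros HY. rewrite PP_prod by easy. unfold Uf. rewrite <- Series_scal_l.
  rewrite <- Series_minus; [|apply ex_Uf; lra|now apply ex_Uf].
  apply Series_ext; intros n. unfold Uc, resP, lat_sqr in *.
  pose proof (sh_pos a Ha n) as Hs. pose proof (ch_sqr a n) as Hc.
  assert (0 < sh n ^ 2) by (apply pow_lt; lra).
  replace (2 * ch n * (2 * ch n)) with (4 * (1 + sh n ^ 2)) by (rewrite <- Hc; ring).
  field. lra.
Qed.

End Lattice.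

(** * The differential system on two lines *)

Ltac toR := match goal with |- @eq _ ?x ?y => change (@eq R x y) end.

Lemma ex_RInt_cont (f : R -> R) (a b : R) :
  a <= b -> (forall x, a <= x <= b -> continuous f x) -> ex_RInt f a b.
Proof.
  intros Hab H. apply (ex_RInt_continuous f a b).
  intros z. rewrite Rmin_left, Rmax_right by easy. apply H.
Qed.

Lemma is_RInt_FTC (F f : R -> R) (a b l : R) : a <= b ->
  (forall x, a <= x <= b -> is_derive F x (f x)) ->
  (forall x, a <= x <= b -> continuous f x) ->
  F b - F a = l -> is_RInt f a b l.
Proof.
  intros Hab HF Hf <-. apply (is_RInt_derive F f a b);
  intros x; rewrite Rmin_left, Rmax_right by easy; auto.
Qed.

(** The bound is asked only inside the interval, because at PI / 2 the integrands take an arbitrary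
    value through [ln 0]. Where the bound fails the function is replaced by 0, which does not change
    the integral. *)
Lemma Rabs_RInt_le (f : R -> R) (a b M : R) : a <= b -> ex_RInt f a b ->
  (forall x, a < x < b -> Rabs (f x) <= M) -> Rabs (RInt f a b) <= (b - a) * M.
Proof.
  intros Hab Hex HM.
  destruct (Req_dec a b) as [e|e].
  { subst. rewrite RInt_point. change (zero : R) with 0. rewrite Rabs_R0, Rminus_diag. lra. }
  assert (0 <= M).
  { eapply Rle_trans; [apply Rabs_pos|apply (HM ((a + b) / 2)); lra]. }
  pose (g := fun x => if Rle_dec (Rabs (f x)) M then f x else 0).
  assert (E : RInt f a b = RInt g a b).
  { apply RInt_ext. intros x. rewrite Rmin_left, Rmax_right by easy. intros Hx.
    unfold g. destruct (Rle_dec (Rabs (f x)) M) as [h|h]; [easy|]. elim h. now apply HM. }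
  rewrite E. apply abs_RInt_le_const; [easy| |].
  - apply ex_RInt_ext with f; [|easy]. intros x. rewrite Rmin_left, Rmax_right by easy. intros Hx.
    unfold g. destruct (Rle_dec (Rabs (f x)) M) as [h|h]; [easy|]. elim h. now apply HM.
  - intros x Hx. unfold g. destruct (Rle_dec (Rabs (f x)) M); [easy|]. rewrite Rabs_R0. lra.
Qed.

Lemma Series_minus_partial (u M : nat -> R) (N : nat) :
  (forall n, Rabs (u n) <= M n) -> ex_series M ->
  Rabs (Series u - sum_n u N) <= Series M - sum_n M N.
Proof.
  intros H HM.
  assert (Hu : ex_series u) by now apply (ex_series_Rabs_le u M).
  pose proof (Series_is_lim _ Hu) as L1. pose proof (Series_is_lim _ HM) as L2.
  apply (is_lim_seq_le_loc (fun K => Rabs (sum_n u K - sum_n u N)) (fun K => sum_n M K - sum_n M N)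
    (Rabs (Series u - sum_n u N)) (Series M - sum_n M N)).
  - exists N. intros K HK. replace K with (N + (K - N))%nat by lia. generalize (K - N)%nat.
    induction n as [|k IH].
    + rewrite Nat.add_0_r, !Rminus_diag, Rabs_R0. lra.
    + rewrite Nat.add_succ_r, !sum_Sn. specialize (H (S (N + k))). unfold plus; simpl.
      replace (sum_n u (N + k) + u (S (N + k)) - sum_n u N) with ((sum_n u (N + k) - sum_n u N) + u (S (N + k))) by ring.
      eapply Rle_trans; [apply Rabs_triang|]. lra.
  - apply (is_lim_seq_abs _ (Series u - sum_n u N)). apply is_lim_seq_minus'; [easy|apply is_lim_seq_const].
  - apply is_lim_seq_minus'; [easy|apply is_lim_seq_const].
Qed.

Lemma is_RInt_sum_n (u : nat -> R -> R) (I : nat -> R) (a b : R) (N : nat) :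
  (forall n, is_RInt (u n) a b (I n)) ->
  is_RInt (fun x => sum_n (fun n => u n x) N) a b (sum_n I N).
Proof.
  intros H. induction N as [|N IH].
  - rewrite sum_O. apply is_RInt_ext with (u 0%nat); [|apply H]. intros; now rewrite sum_O.
  - rewrite sum_Sn. apply is_RInt_ext with (fun x => plus (sum_n (fun n => u n x) N) (u (S N) x)).
    + intros; now rewrite sum_Sn.
    + apply (is_RInt_plus (V := R_NormedModule)); auto.
Qed.

(** Weierstrass test for termwise integration: the error is at most the length of the interval times
    a tail of [M]. *)
Lemma RInt_Series (u : nat -> R -> R) (M I : nat -> R) (a b : R) : a <= b ->
  (forall n x, a < x < b -> Rabs (u n x) <= M n) -> ex_series M ->
  (forall n, is_RInt (u n) a b (I n)) ->
  ex_RInt (fun x => Series (fun n => u n x)) a b ->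
  is_lim_seq (sum_n I) (RInt (fun x => Series (fun n => u n x)) a b).
Proof.
  intros Hab HM HMs HI Hex.
  set (J := RInt _ a b).
  apply is_lim_seq_ext with (fun N => J + (sum_n I N - J)); [intros; ring|].
  replace (Finite J) with (Finite (J + 0)) by (f_equal; ring).
  apply is_lim_seq_plus'; [apply is_lim_seq_const|].
  apply (proj2 (is_lim_seq_abs_0 _)).
  apply is_lim_seq_le_le with (fun _ => 0) (fun N => (b - a) * (Series M - sum_n M N)).
  - intros N. split; [apply Rabs_pos|].
    rewrite Rabs_minus_sym.
    pose proof (is_RInt_sum_n u I a b N HI) as HS.
    assert (E : J - sum_n I N = RInt (fun x => Series (fun n => u n x) - sum_n (fun n => u n x) N) a b).
    { symmetry. apply is_RInt_unique. apply (is_RInt_minus (V := R_NormedModule)); [|easy].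
      now apply (RInt_correct (V := R_CompleteNormedModule)). }
    rewrite E. apply Rabs_RInt_le; [easy| |].
    + apply (ex_RInt_minus (V := R_NormedModule)); [easy|]. now exists (sum_n I N).
    + intros x Hx. apply Series_minus_partial; [|easy]. intros n. now apply HM.
  - apply is_lim_seq_const.
  - replace (Finite 0) with (Finite ((b - a) * (Series M - Series M))) by (f_equal; ring).
    apply (is_lim_seq_scal_l (fun N => Series M - sum_n M N) (b - a) (Series M - Series M)).
    apply is_lim_seq_minus'; [apply is_lim_seq_const|now apply Series_is_lim].
Qed.

Section Lattice.
Context (a : R) (Ha : 0 < a).
Notation sh := (lat_sinh a).
Notation ch := (lat_cosh a).
Notation rr := (lat_sqr a).
Notation Pf := (serP a).
Notation Qf := (serQ a).
Notation Tf := (serT a).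

(** Writing ch^2 = (rr + Y) + (1 - Y) splits the double poles of [PT_prod] into [serQ] and its
    derivative. As 1 - Y = cosh^2 z, the result is s~' = - s t; the lemma after it is s' = - s~ t in
    the same way. *)
Lemma PT_Qf2 (Y : R) : 0 <= Y -> Pf Y * Tf Y = Qf Y + 2 * (1 - Y) * serQ2 a Y.
Proof.
  intros HY. assert (HY' : - rr 0%nat / 2 <= Y) by (pose proof (rr_pos a Ha 0); lra).
  rewrite PT_prod by easy.
  replace (Series (fun n => ch n ^ 2 * (2 * resQ a n) / (rr n + Y) ^ 2)) with (2 * Qf Y + 2 * (1 - Y) * serQ2 a Y); [ring|].
  unfold serQ, serQ2. rewrite <- !Series_scal_l. rewrite <- Series_plus.
  - apply Series_ext; intros n. pose proof (rr_plus_pos a Ha Y n HY'). rewrite ch_sqr. unfold lat_sqr in *. field. lra.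
  - now apply ex_series_scal_R, ex_Qf.
  - apply ex_series_scal_R. eapply (ex_series_div_rr2 a Ha); [easy|apply (Qc_bound3 a Ha)].
Qed.

Lemma QT_Pf2 (Y : R) : 0 <= Y -> Qf Y * Tf Y = Pf Y - 2 * Y * serP2 a Y.
Proof.
  intros HY. assert (HY' : - rr 0%nat / 2 <= Y) by (pose proof (rr_pos a Ha 0); lra).
  rewrite QT_prod by easy.
  replace (Series (fun n => sh n ^ 2 * (2 * resP a n) / (rr n + Y) ^ 2)) with (2 * Pf Y - 2 * Y * serP2 a Y); [ring|].
  unfold serP, serP2. rewrite <- !Series_scal_l. rewrite <- Series_minus.
  - apply Series_ext; intros n. pose proof (rr_plus_pos a Ha Y n HY'). unfold lat_sqr in *. field. lra.
  - now apply ex_series_scal_R, ex_Pf.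
  - apply ex_series_scal_R. eapply (ex_series_div_rr2 a Ha); [easy|apply (Pc_bound3 a Ha)].
Qed.

Lemma nonneg_dom (Y : R) : 0 <= Y -> - rr 0%nat / 2 < Y.
Proof. pose proof (rr_pos a Ha 0). lra. Qed.

(* Up to factors +-1, +-i, the functions s, s~, t of the header: [jacS], [jacC], [jacD] on the line z = i y, and
   [jacA], [jacB], [jacT] on the line z = x + i PI/2. *)
Definition jacS (y : R) : R := sin y * Pf (sin y ^ 2).
Definition jacC (y : R) : R := cos y * Qf (sin y ^ 2).
Definition jacD (y : R) : R := Tf (sin y ^ 2).
Definition jacA (x : R) : R := cosh x * Pf (cosh x ^ 2).
Definition jacB (x : R) : R := - (sinh x * Qf (cosh x ^ 2)).
Definition jacT (x : R) : R := Tf (cosh x ^ 2).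

Lemma is_derive_sinh (x : R) : is_derive sinh x (cosh x).
Proof. apply is_derive_Reals, derivable_pt_lim_sinh. Qed.
Lemma is_derive_cosh (x : R) : is_derive cosh x (sinh x).
Proof. apply is_derive_Reals, derivable_pt_lim_cosh. Qed.

Lemma is_derive_sin2 (y : R) : is_derive (fun y => sin y ^ 2) y (2 * sin y * cos y).
Proof. auto_derive; [easy|]. ring. Qed.
Lemma is_derive_cosh2 (y : R) : is_derive (fun y => cosh y ^ 2) y (2 * cosh y * sinh y).
Proof.
  apply is_derive_ext with (fun y => cosh y * cosh y); [intros t; simpl; symmetry; f_equal; apply Rmult_1_r|].
  replace (2 * cosh y * sinh y) with (sinh y * cosh y + cosh y * sinh y) by ring.
  apply (is_derive_mult cosh cosh); [apply is_derive_cosh|apply is_derive_cosh|apply Rmult_comm].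
Qed.

Lemma is_derive_comp_R (f g : R -> R) (x l m : R) :
  is_derive f (g x) l -> is_derive g x m -> is_derive (fun x => f (g x)) x (m * l).
Proof. intros H1 H2. now apply (is_derive_comp f g). Qed.

Lemma is_derive_mult_R (f g : R -> R) (x l m : R) :
  is_derive f x l -> is_derive g x m -> is_derive (fun x => f x * g x) x (l * g x + f x * m).
Proof. intros H1 H2. apply (is_derive_mult f g); auto. apply Rmult_comm. Qed.

Lemma jS_derive (y : R) : is_derive jacS y (jacC y * jacD y).
Proof.
  pose proof (pow2_ge_0 (sin y)) as H0.
  unfold jacC, jacD. rewrite Rmult_assoc, QT_Pf2 by easy.
  replace (cos y * _) with (cos y * Pf (sin y ^ 2) + sin y * ((2 * sin y * cos y) * (- serP2 a (sin y ^ 2)))) by ring.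
  apply (is_derive_mult_R sin (fun y => Pf (sin y ^ 2))).
  - apply is_derive_Reals, derivable_pt_lim_sin.
  - apply (is_derive_comp_R Pf (fun y => sin y ^ 2)); [apply (Pf_derive a Ha), nonneg_dom, H0|apply is_derive_sin2].
Qed.

Lemma jC_derive (y : R) : is_derive jacC y (- (jacS y * jacD y)).
Proof.
  pose proof (pow2_ge_0 (sin y)) as H0.
  unfold jacS, jacD. rewrite Rmult_assoc, PT_Qf2 by easy.
  replace (- _) with (- sin y * Qf (sin y ^ 2) + cos y * ((2 * sin y * cos y) * (- serQ2 a (sin y ^ 2)))).
  2:{ replace (1 - sin y ^ 2) with (cos y ^ 2); [ring|]. pose proof (sin2_cos2 y). unfold Rsqr in *. nra. }
  apply (is_derive_mult_R cos (fun y => Qf (sin y ^ 2))).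
  - apply is_derive_Reals, derivable_pt_lim_cos.
  - apply (is_derive_comp_R Qf (fun y => sin y ^ 2)); [apply (Qf_derive a Ha), nonneg_dom, H0|apply is_derive_sin2].
Qed.

Lemma jD_derive (y : R) : is_derive jacD y (- (jacS y * jacC y)).
Proof.
  pose proof (pow2_ge_0 (sin y)) as H0.
  replace (- (jacS y * jacC y)) with ((2 * sin y * cos y) * (- serT2 a (sin y ^ 2))).
  - apply (is_derive_comp_R Tf (fun y => sin y ^ 2)); [apply (Tf_derive a Ha), nonneg_dom, H0|apply is_derive_sin2].
  - unfold jacS, jacC.
    transitivity (- (sin y * cos y * (Pf (sin y ^ 2) * Qf (sin y ^ 2)))); [rewrite PQ_prod by easy; ring|ring].
Qed.

Lemma jA_derive (x : R) : is_derive jacA x (- (jacB x * jacT x)).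
Proof.
  pose proof (pow2_ge_0 (cosh x)) as H0.
  unfold jacB, jacT. replace (- (- _ * _)) with (sinh x * (Qf (cosh x ^ 2) * Tf (cosh x ^ 2))) by ring.
  rewrite QT_Pf2 by easy.
  replace (sinh x * _) with (sinh x * Pf (cosh x ^ 2) + cosh x * ((2 * cosh x * sinh x) * (- serP2 a (cosh x ^ 2)))) by ring.
  apply (is_derive_mult_R cosh (fun y => Pf (cosh y ^ 2))); [apply is_derive_cosh|].
  apply (is_derive_comp_R Pf (fun y => cosh y ^ 2)); [apply (Pf_derive a Ha), nonneg_dom, H0|apply is_derive_cosh2].
Qed.

Lemma jB_derive (x : R) : is_derive jacB x (- (jacA x * jacT x)).
Proof.
  pose proof (pow2_ge_0 (cosh x)) as H0.
  unfold jacA, jacT. rewrite Rmult_assoc, PT_Qf2 by easy.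
  replace (- _) with (- (cosh x * Qf (cosh x ^ 2) + sinh x * ((2 * cosh x * sinh x) * (- serQ2 a (cosh x ^ 2))))).
  2:{ replace (1 - cosh x ^ 2) with (- sinh x ^ 2); [ring|]. rewrite cosh_sqr. ring. }
  apply (is_derive_opp (V := R_NormedModule)).
  apply (is_derive_mult_R sinh (fun y => Qf (cosh y ^ 2))); [apply is_derive_sinh|].
  apply (is_derive_comp_R Qf (fun y => cosh y ^ 2)); [apply (Qf_derive a Ha), nonneg_dom, H0|apply is_derive_cosh2].
Qed.

Lemma jT_derive (x : R) : is_derive jacT x (jacA x * jacB x).
Proof.
  pose proof (pow2_ge_0 (cosh x)) as H0.
  replace (jacA x * jacB x) with ((2 * cosh x * sinh x) * (- serT2 a (cosh x ^ 2))).
  - apply (is_derive_comp_R Tf (fun y => cosh y ^ 2)); [apply (Tf_derive a Ha), nonneg_dom, H0|apply is_derive_cosh2].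
  - unfold jacA, jacB.
    transitivity (- (cosh x * sinh x * (Pf (cosh x ^ 2) * Qf (cosh x ^ 2)))); [rewrite PQ_prod by easy; ring|ring].
Qed.

Lemma continuous_derive (f : R -> R) (x l : R) : is_derive f x l -> continuous f x.
Proof. intros H. apply (ex_derive_continuous (V := R_NormedModule)). now exists l. Qed.

(** Only the constant 1 of [serT] contributes: each compensated term has integral 0 over the quarter
    period. *)
Lemma RInt_jD : RInt jacD 0 (PI / 2) = PI / 2.
Proof.
  pose proof PI_RGT_0 as Hpi.
  pose (u := fun n y => resT a n / (rr n + sin y ^ 2) - 2 * (-1) ^ n).
  assert (Hr0 := rr_pos a Ha 0). assert (Hs0 := sh_pos a Ha 0).
  assert (Hc : forall y, continuous (fun y => Series (fun n => u n y)) y).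
  { intros y. apply continuous_ext with (fun y => jacD y - 1).
    - intros z. unfold jacD, serT, u. toR; ring.
    - apply (continuous_minus (V := R_NormedModule)); [apply (continuous_derive _ _ _ (jD_derive y))|apply continuous_const]. }
  assert (L : is_lim_seq (sum_n (fun _ => 0)) (RInt (fun y => Series (fun n => u n y)) 0 (PI / 2))).
  { apply RInt_Series with (M := fun n => 2 * (2 * (1 + 1) * / sh 0%nat) / sh n); [lra| | | |].
    - intros n y _. eapply Rle_trans; [apply (Tf_term_bound a Ha)|].
      + pose proof (pow2_ge_0 (sin y)). lra.
      + pose proof (pow2_ge_0 (sin y)). pose proof (sh_pos a Ha n).
        assert (Rabs (sin y ^ 2) <= 1).
        { rewrite Rabs_pos_eq by easy. pose proof (sin2_cos2 y). unfold Rsqr in *. nra. }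
        apply Rmult_le_compat_r; [left; now apply Rinv_0_lt_compat|].
        apply Rmult_le_compat_l; [lra|]. apply Rmult_le_compat_r; [left; now apply Rinv_0_lt_compat|]. lra.
    - apply ex_series_scal_R, ex_series_inv_sh, Ha.
    - intros n. pose proof (sh_pos a Ha n) as Hs. pose proof (ch_pos a n) as Hch.
      (* Apart from its coefficient this is atan ((ch/sh) tan y) - y, contracted by the addition
         formula so that it stays smooth at PI / 2. *)
      pose (psi := fun y => 2 * (-1) ^ n * atan ((ch n - sh n) * sin y * cos y / (sh n * cos y ^ 2 + ch n * sin y ^ 2))).
      assert (Hden : forall y, 0 < sh n * cos y ^ 2 + ch n * sin y ^ 2).
      { intros y. pose proof (sin2_cos2 y). pose proof (pow2_ge_0 (sin y)). pose proof (pow2_ge_0 (cos y)).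
        assert (sh n < ch n) by apply sinh_lt_cosh. unfold Rsqr in *. nra. }
      apply (is_RInt_FTC psi); [lra| | |].
      3:{ unfold psi. rewrite sin_0, cos_PI2.
          rewrite !Rmult_0_r, !Rmult_0_l. unfold Rdiv. rewrite !Rmult_0_l, atan_0. ring. }
      + intros y _. unfold psi, u.
        pose proof (Hden y) as Hd. pose proof (sin2_cos2 y) as E. unfold Rsqr in E.
        assert (Hp : 0 < rr n + sin y ^ 2) by (apply (rr_plus_pos a Ha); pose proof (pow2_ge_0 (sin y)); lra).
        auto_derive; [repeat split; lra|].
        apply Rminus_diag_uniq.
        set (s := sin y) in *. set (c := cos y) in *. unfold resT, lat_sqr in *.
        pose proof (ch_sqr a n) as Ec.
        assert (E2 : c ^ 2 = 1 - s ^ 2) by lra.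
        assert (E3 : (sh n * c ^ 2 + ch n * s ^ 2) ^ 2 + ((ch n - sh n) * s * c) ^ 2 = sh n ^ 2 + s ^ 2).
        { replace (((ch n - sh n) * s * c) ^ 2) with ((ch n - sh n) ^ 2 * s ^ 2 * c ^ 2) by ring.
          rewrite E2.
          replace (sh n ^ 2 + s ^ 2) with (sh n ^ 2 * (1 - s ^ 2) + (1 + sh n ^ 2) * s ^ 2) by ring. rewrite <- Ec. ring. }
        set (p := sh n) in *. set (q := ch n) in *.
        assert (EN : (q - p) * (c ^ 2 - s ^ 2) * (p * c ^ 2 + q * s ^ 2)
                     - (q - p) * s * c * (2 * (q - p) * s * c) = p * q - p ^ 2 - s ^ 2).
        { replace ((q - p) * s * c * (2 * (q - p) * s * c)) with (2 * (q - p) ^ 2 * s ^ 2 * c ^ 2) by ring.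
          rewrite E2.
          transitivity (p * q - p ^ 2 - s ^ 2 * (q ^ 2 - p ^ 2)); [ring|]. rewrite Ec. ring. }
        set (D := p * c ^ 2 + q * s ^ 2) in *.
        replace (p * (c * (c * 1)) + q * (s * (s * 1))) with D by (unfold D; ring).
        transitivity (2 * (-1) ^ n * (((q - p) * (c ^ 2 - s ^ 2) * D - (q - p) * s * c * (2 * (q - p) * s * c))
            / (D ^ 2 + ((q - p) * s * c) ^ 2)) - (2 * ((-1) ^ n * (p * q)) / (p ^ 2 + s ^ 2) - 2 * (-1) ^ n)).
        { f_equal. f_equal. field. split; [|lra].
          match goal with |- ?e <> 0 => replace e with (D ^ 2 + ((q - p) * s * c) ^ 2) by ring end. lra. }
        rewrite EN, E3. field. lra.
      + intros y _. unfold u. apply (continuous_minus (V := R_NormedModule)); [|apply continuous_const].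
        apply (ex_derive_continuous (V := R_NormedModule)). auto_derive.
        pose proof (pow2_ge_0 (sin y)). pose proof (rr_pos a Ha n). lra.
    - apply ex_RInt_cont; [lra|]. intros; apply Hc. }
  assert (Z : RInt (fun y => Series (fun n => u n y)) 0 (PI / 2) = 0).
  { apply is_lim_seq_unique in L. rewrite (Lim_seq_ext (sum_n (fun _ => 0)) (fun _ => 0)) in L.
    - rewrite Lim_seq_const in L. now injection L.
    - intros n. rewrite sum_n_const. ring. }
  transitivity (RInt (fun y => plus 1 (Series (fun n => u n y))) 0 (PI / 2)); [reflexivity|].
  rewrite (RInt_plus (V := R_CompleteNormedModule)).
  - rewrite Z, RInt_const. unfold plus, scal; simpl. unfold mult; simpl. ring.
  - apply ex_RInt_const.
  - apply ex_RInt_cont; [lra|]. intros; apply Hc.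
Qed.

Lemma Uf_derive_cont (y : R) : continuous (fun y => Uf a (sin y ^ 2)) y.
Proof.
  apply continuous_ext with (fun y => Uf a 0 - jacS y * jacS y).
  - intros z. pose proof (Uf_P a Ha (sin z ^ 2) (pow2_ge_0 _)) as H. unfold jacS.
    transitivity (Uf a 0 - sin z ^ 2 * Pf (sin z ^ 2) ^ 2); [toR; ring|]. rewrite H. toR; ring.
  - apply (continuous_minus (V := R_NormedModule)); [apply continuous_const|].
    apply (continuous_mult (K := R_AbsRing)); apply (continuous_derive _ _ _ (jS_derive y)).
Qed.

Lemma is_lim_seq_const_eq (c l : R) : is_lim_seq (fun _ => c) l -> l = c.
Proof.
  intros H. apply is_lim_seq_unique in H. rewrite Lim_seq_const in H. now injection H.
Qed.

(** u is the derivative of a sum of coth, and each pair of these vanishes at both ends of the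
    quarter period. *)
Lemma RInt_Uf : RInt (fun y => Uf a (sin y ^ 2)) 0 (PI / 2) = 0.
Proof.
  pose proof PI_RGT_0 as Hpi.
  assert (Hr0 := rr_pos a Ha 0). assert (Hs0 := sh_pos a Ha 0).
  assert (Hi0 := Rinv_0_lt_compat _ Hs0).
  apply (is_lim_seq_const_eq 0).
  apply is_lim_seq_ext with (sum_n (fun _ => 0)); [intros n; rewrite sum_n_const; ring|].
  unfold Uf. apply RInt_Series with (M := fun n => 4 * (2 * (1 + 1 * (/ sh 0%nat ^ 2 + 2)) * / sh 0%nat) / sh n); [lra| | | |].
  - intros n y _. pose proof (pow2_ge_0 (sin y)) as H0.
    eapply Rle_trans; [now apply (Uc_bound a Ha)|].
    pose proof (sh_pos a Ha n).
    assert (sin y ^ 2 <= 1) by (pose proof (sin2_cos2 y); unfold Rsqr in *; nra).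
    pose proof (Rinv_0_lt_compat _ (pow_lt _ 2 Hs0)).
    apply Rmult_le_compat_r; [left; now apply Rinv_0_lt_compat|].
    apply Rmult_le_compat_l; [lra|]. apply Rmult_le_compat_r; [lra|].
    apply Rmult_le_compat_l; [lra|]. apply Rplus_le_compat_l. apply Rmult_le_compat_r; lra.
  - apply ex_series_scal_R, ex_series_inv_sh, Ha.
  - intros n. pose proof (rr_pos a Ha n) as Hr.
    (* Up to a factor i, this is minus the sum of coth (z + b) and coth (z - b) at z = i y. *)
    apply (is_RInt_FTC (fun y => 2 * sin y * cos y / (rr n + sin y ^ 2))); [lra| | |].
    + intros y _. pose proof (pow2_ge_0 (sin y)) as H0. pose proof (sin2_cos2 y) as E. unfold Rsqr in E.
      auto_derive; [lra|]. unfold Uc, lat_sqr in *.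
      set (s := sin y) in *. set (c := cos y) in *. set (p := sh n) in *.
      replace (2 * s * c * _) with (- (4 * s ^ 2 * c ^ 2) * / ((p ^ 2 + s * (s * 1)) * (p ^ 2 + s * (s * 1)))) by ring.
      replace (c ^ 2) with (1 - s ^ 2) by lra.
      replace (2 * (1 * c) * c + 2 * s * (1 * - s)) with (2 * (1 - s ^ 2) - 2 * s ^ 2) by (replace (1 - s ^ 2) with (c ^ 2) by lra; ring).
      field. lra.
    + intros y _. apply (ex_derive_continuous (V := R_NormedModule)). unfold Uc. auto_derive.
      pose proof (pow2_ge_0 (sin y)). apply Rgt_not_eq.
      match goal with |- ?e > 0 => replace e with ((rr n + sin y ^ 2) ^ 2) by ring end. apply pow_lt. lra.
    + rewrite sin_0, cos_PI2. unfold Rdiv. ring.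
  - apply ex_RInt_cont; [lra|]. intros; apply Uf_derive_cont.
Qed.

(** atan (sinh x) is the Gudermannian function, a primitive of 1/cosh. On the line z = x + i PI/2
    the two csch of a pair become 1/cosh (b + x) and 1/cosh (b - x), up to constant factors. *)
Lemma gd_derive (x b : R) :
  is_derive (fun x => atan (sinh (b + x)) - atan (sinh (b - x))) x
    (cosh x * (2 * cosh b) / (sinh b ^ 2 + cosh x ^ 2)).
Proof.
  auto_derive; [easy|].
  pose proof (cosh_gt_0 (b + x)) as H1. pose proof (cosh_gt_0 (b + - x)) as H2.
  assert (E : sinh b ^ 2 + cosh x ^ 2 = cosh (b + x) * cosh (b + - x)).
  { rewrite !cosh_plus, cosh_opp, sinh_opp.
    pose proof (cosh_sqr b). pose proof (cosh_sqr x). nra. }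
  rewrite E.
  replace (cosh x * (2 * cosh b)) with (cosh (b + x) + cosh (b + - x))
    by (rewrite !cosh_plus, cosh_opp, sinh_opp; ring).
  replace (1 + sinh (b + x) * (sinh (b + x) * 1)) with (cosh (b + x) ^ 2) by (rewrite cosh_sqr; ring).
  replace (1 + sinh (b + - x) * (sinh (b + - x) * 1)) with (cosh (b + - x) ^ 2) by (rewrite cosh_sqr; ring).
  field. lra.
Qed.

Lemma atan_sinh_lim : is_lim_seq (fun N => atan (sinh (INR (S N) * a))) (PI / 2).
Proof.
  apply is_lim_seq_ext with (fun N => PI / 2 - atan (csch_j a (S N))).
  - intros N. unfold csch_j. rewrite atan_inv; [ring|].
    apply sinh_gt_0, Rmult_lt_0_compat; [apply lt_0_INR; lia|easy].
  - replace (Finite (PI / 2)) with (Finite (PI / 2 - atan 0)) by (rewrite atan_0; f_equal; ring).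
    apply is_lim_seq_minus'; [apply is_lim_seq_const|].
    apply is_lim_seq_continuous; [apply derivable_continuous_pt, derivable_pt_atan|].
    apply (is_lim_seq_incr_1 (csch_j a)). apply (ex_series_lim_0 (csch_j a)).
    apply ex_series_Rabs, ex_csch_j, Ha.
Qed.

(** The intervals from b - a/2 to b + a/2 tile the positive half line, so that the termwise
    integrals telescope to that of 1/cosh over all of it. *)
Lemma RInt_jA : RInt jacA 0 (a / 2) = PI / 2.
Proof.
  assert (Hr0 := rr_pos a Ha 0). assert (Hs0 := sh_pos a Ha 0).
  pose proof (kap_pos a Ha) as Hk.
  pose (u := fun n x => cosh x * (2 * ch n) / (rr n + cosh x ^ 2)).
  assert (E : forall x, jacA x = Series (fun n => u n x)).
  { intros x. unfold jacA, serP. rewrite <- Series_scal_l. apply Series_ext; intros n.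
    unfold u, resP. unfold Rdiv. ring. }
  assert (L : is_lim_seq (sum_n (fun n => atan (sinh (INR (S n) * a)) - atan (sinh (INR n * a))))
      (RInt (fun x => Series (fun n => u n x)) 0 (a / 2))).
  { apply RInt_Series with (M := fun n => cosh (a / 2) * (2 * (2 * (/ sh 0%nat + 1))) / sh n); [lra| | | |].
    - intros n x Hx. unfold u. pose proof (pow2_ge_0 (cosh x)) as H0. pose proof (sh_pos a Ha n).
      replace (cosh x * (2 * ch n) / (rr n + cosh x ^ 2)) with (cosh x * (2 * ch n / (rr n + cosh x ^ 2))) by (unfold Rdiv; ring).
      replace (cosh (a / 2) * (2 * (2 * (/ sh 0%nat + 1))) / sh n) with (cosh (a / 2) * (2 * (2 * (/ sh 0%nat + 1)) / sh n)) by (unfold Rdiv; ring).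
      apply Rabs_mult_le.
      + rewrite Rabs_pos_eq by (left; apply cosh_gt_0).
        apply Rsqr_incr_0_var; [|left; apply cosh_gt_0]. unfold Rsqr.
        pose proof (cosh_sqr x). pose proof (cosh_sqr (a / 2)).
        pose proof (sinh_gt_0 x ltac:(lra)). pose proof (sinh_lt x (a / 2) ltac:(lra)). nra.
      + apply (div_rr_bound a Ha (fun n => 2 * ch n)); [lra|apply (Pc_bound a Ha)].
    - apply ex_series_scal_R, ex_series_inv_sh, Ha.
    - intros n. pose proof (rr_pos a Ha n) as Hr.
      apply (is_RInt_FTC (fun x => atan (sinh (bpt a n + x)) - atan (sinh (bpt a n - x)))); [lra| | |].
      + intros x _. apply gd_derive.
      + intros x _. unfold u. apply (ex_derive_continuous (V := R_NormedModule)). auto_derive.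
        pose proof (pow2_ge_0 (cosh x)). lra.
      + rewrite Rplus_0_r, Rminus_0_r, S_INR.
        replace (bpt a n + a / 2) with ((INR n + 1) * a) by (unfold bpt; field).
        replace (bpt a n - a / 2) with (INR n * a) by (unfold bpt; field). ring.
    - apply ex_RInt_ext with jacA; [intros; apply E|]. apply ex_RInt_cont; [lra|].
      intros x _. apply (continuous_derive _ _ _ (jA_derive x)). }
  transitivity (RInt (fun x => Series (fun n => u n x)) 0 (a / 2)).
  { apply RInt_ext. intros; apply E. }
  apply is_lim_seq_unique in L. rewrite (Lim_seq_ext _ (fun N => atan (sinh (INR (S N) * a)))) in L.
  - pose proof (is_lim_seq_unique _ _ atan_sinh_lim) as L2. rewrite L2 in L. now injection L.
  - intros N. induction N as [|N IH].
    + rewrite sum_O. simpl INR. rewrite Rmult_0_l, sinh_0, atan_0. ring.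
    + rewrite sum_Sn, IH. unfold plus; simpl. ring.
Qed.

End Lattice.

(** * Rotation angle of the system and the modulus it defines *)

Lemma is_derive_RInt_0_cont (f : R -> R) (x : R) :
  (forall y, continuous f y) -> is_derive (fun y => RInt f 0 y) x (f x).
Proof.
  intros Hf. apply (is_derive_RInt f (fun y => RInt f 0 y) 0 x); [|apply Hf].
  exists (mkposreal 1 Rlt_0_1). intros y _. apply (RInt_correct (V := R_CompleteNormedModule)).
  apply (ex_RInt_continuous (V := R_CompleteNormedModule)). auto.
Qed.

Lemma const_of_derive_0 (f : R -> R) (x y : R) : (forall t, is_derive f t 0) -> f x = f y.
Proof.
  intros H.
  apply (is_derive_0_const f (Rmin x y) (Rmax x y)).
  - intros; apply H.
  - intros t _. apply (continuous_derive _ _ _ (H t)).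
  - split; [apply Rmin_l|apply Rmax_l].
  - split; [apply Rmin_r|apply Rmax_r].
Qed.

Lemma is_derive_eq (f : R -> R) (x l m : R) : is_derive f x l -> l = m -> is_derive f x m.
Proof. now intros H <-. Qed.

(** In the frame turned by the angle [RInt w 0 t] the pair (u, v) has derivative 0. *)
Lemma rotation_ode (u v w : R -> R) :
  (forall t, is_derive u t (v t * w t)) ->
  (forall t, is_derive v t (- (u t * w t))) ->
  (forall t, continuous w t) ->
  u 0 = 0 ->
  forall t, u t = v 0 * sin (RInt w 0 t) /\ v t = v 0 * cos (RInt w 0 t).
Proof.
  intros Hu Hv Hw H0 t.
  pose (th := fun y => RInt w 0 y).
  assert (Hth : forall y, is_derive th y (w y)) by (intros y; now apply is_derive_RInt_0_cont).
  assert (Hs : forall y, is_derive (fun y => sin (th y)) y (w y * cos (th y))).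
  { intros y. apply (is_derive_comp_R sin th); [apply is_derive_Reals, derivable_pt_lim_sin|apply Hth]. }
  assert (Hc : forall y, is_derive (fun y => cos (th y)) y (w y * - sin (th y))).
  { intros y. apply (is_derive_comp_R cos th); [apply is_derive_Reals, derivable_pt_lim_cos|apply Hth]. }
  assert (T0 : th 0 = 0) by (unfold th; apply (RInt_point (V := R_CompleteNormedModule))).
  assert (E1 : u t * cos (th t) - v t * sin (th t) = 0).
  { rewrite (const_of_derive_0 (fun y => u y * cos (th y) - v y * sin (th y)) t 0).
    - rewrite T0, H0, sin_0. ring.
    - intros y. eapply is_derive_eq.
      + apply (is_derive_minus (V := R_NormedModule)).
        * apply (is_derive_mult_R u (fun y => cos (th y))); [apply Hu|apply Hc].
        * apply (is_derive_mult_R v (fun y => sin (th y))); [apply Hv|apply Hs].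
      + unfold minus, plus, opp; simpl. ring. }
  assert (E2 : u t * sin (th t) + v t * cos (th t) = v 0).
  { rewrite (const_of_derive_0 (fun y => u y * sin (th y) + v y * cos (th y)) t 0).
    - rewrite T0, H0, cos_0. ring.
    - intros y. eapply is_derive_eq.
      + apply (is_derive_plus (V := R_NormedModule)).
        * apply (is_derive_mult_R u (fun y => sin (th y))); [apply Hu|apply Hs].
        * apply (is_derive_mult_R v (fun y => cos (th y))); [apply Hv|apply Hc].
      + unfold plus; simpl. ring. }
  fold (th t). pose proof (sin2_cos2 (th t)) as E. unfold Rsqr in E.
  set (s := sin (th t)) in *. set (c := cos (th t)) in *. rewrite <- E2. split.
  - transitivity (u t * (s * s + c * c) - c * (u t * c - v t * s)); [rewrite E, E1; ring|ring].
  - transitivity (v t * (s * s + c * c) + s * (u t * c - v t * s)); [rewrite E, E1; ring|ring].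
Qed.

Section Lattice.
Context (a : R) (Ha : 0 < a).
Notation Pf := (serP a).
Notation Qf := (serQ a).
Notation Tf := (serT a).
Notation jS := (jacS a).
Notation jC := (jacC a).
Notation jD := (jacD a).
Notation jA := (jacA a).
Notation jB := (jacB a).
Notation jT := (jacT a).

Lemma jS_cont (y : R) : continuous jS y.
Proof. apply (continuous_derive _ _ _ (jS_derive a Ha y)). Qed.
Lemma jD_cont (y : R) : continuous jD y.
Proof. apply (continuous_derive _ _ _ (jD_derive a Ha y)). Qed.
Lemma jA_cont (y : R) : continuous jA y.
Proof. apply (continuous_derive _ _ _ (jA_derive a Ha y)). Qed.

Lemma Pf_pos (Y : R) : 0 <= Y -> 0 < Pf Y.
Proof.
  intros HY. assert (HY' : - lat_sqr a 0 / 2 <= Y) by (pose proof (rr_pos a Ha 0); lra).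
  assert (Hp : forall n, 0 < resP a n / (lat_sqr a n + Y)).
  { intros n. apply Rdiv_lt_0_compat; [|now apply rr_plus_pos]. unfold resP. pose proof (ch_pos a n). lra. }
  eapply Rlt_le_trans; [apply (Hp 0%nat)|].
  unfold serP. rewrite <- (sum_O (fun n => resP a n / (lat_sqr a n + Y))) at 1.
  apply sum_n_le_Series; [intros; left; apply Hp|now apply ex_Pf].
Qed.

Notation c0 := (jC 0).
Notation d0 := (jD 0).
Notation r0 := (Tf 1).

Lemma jS_0 : jS 0 = 0.
Proof. unfold jacS. rewrite sin_0. ring. Qed.

(** The angle [RInt jD 0 y] is the Jacobi amplitude, up to the scale of y, and [jS], [jC], [jD] are
    multiples of sn, cn, dn. *)
Lemma jSC_phi (y : R) : jS y = c0 * sin (RInt jD 0 y) /\ jC y = c0 * cos (RInt jD 0 y).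
Proof.
  apply (rotation_ode jS jC jD); auto using jS_derive, jC_derive, jD_cont, jS_0.
Qed.

Lemma jS_PI2 : jS (PI / 2) = Pf 1.
Proof. unfold jacS. rewrite sin_PI2. replace (1 ^ 2) with 1 by ring. ring. Qed.

Lemma jD_PI2 : jD (PI / 2) = r0.
Proof. unfold jacD. rewrite sin_PI2. f_equal. ring. Qed.

Lemma jC_PI2 : jC (PI / 2) = 0.
Proof. unfold jacC. rewrite cos_PI2. ring. Qed.

(** Two different series agree because the angle over the quarter period is exactly PI / 2. *)
Lemma c0_eq : c0 = Pf 1.
Proof.
  rewrite <- jS_PI2. destruct (jSC_phi (PI / 2)) as [H _].
  rewrite H, RInt_jD, sin_PI2 by easy. ring.
Qed.

Lemma c0_pos : 0 < c0.
Proof. rewrite c0_eq. apply Pf_pos. lra. Qed.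

Lemma jDS (y : R) : jD y ^ 2 + jS y ^ 2 = d0 ^ 2.
Proof.
  transitivity (jD 0 * jD 0 + jS 0 * jS 0); [|rewrite jS_0; ring].
  rewrite (const_of_derive_0 (fun y => jD y * jD y + jS y * jS y) 0 y); [ring|].
  intros t. eapply is_derive_eq.
  - apply (is_derive_plus (V := R_NormedModule)); apply is_derive_mult_R; auto using jD_derive, jS_derive.
  - unfold plus; simpl. ring.
Qed.

Lemma r0_sqr : r0 ^ 2 = d0 ^ 2 - c0 ^ 2.
Proof. pose proof (jDS (PI / 2)) as H. rewrite jD_PI2, jS_PI2, <- c0_eq in H. lra. Qed.

Lemma jD_ge (y : R) : r0 ^ 2 <= jD y ^ 2.
Proof.
  rewrite r0_sqr. pose proof (jDS y) as H. destruct (jSC_phi y) as [E _].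
  set (s := sin (RInt jD 0 y)) in *. assert (s ^ 2 <= 1).
  { pose proof (sin2_cos2 (RInt jD 0 y)) as E2. fold s in E2. unfold Rsqr in E2. nra. }
  rewrite E in H. pose proof (pow2_ge_0 c0). rewrite Rpow_mult_distr in H. nra.
Qed.

(* If [r0] vanished, the linear system for [(jC, jD)] would have zero data at PI/2. *)
Lemma r0_neq0 : r0 <> 0.
Proof.
  intros Hr.
  pose (h := fun y => RInt jS 0 y).
  assert (Hh : forall y, is_derive h y (jS y)) by (intros y; apply is_derive_RInt_0_cont, jS_cont).
  assert (He : forall y, is_derive (fun y => exp (h y)) y (jS y * exp (h y))).
  { intros y. apply (is_derive_comp_R exp h); [apply is_derive_exp|apply Hh]. }
  assert (He' : forall y, is_derive (fun y => exp (- h y)) y (- jS y * exp (- h y))).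
  { intros y. apply (is_derive_comp_R exp (fun y => - h y)); [apply is_derive_exp|].
    apply (is_derive_opp (V := R_NormedModule)), Hh. }
  (* The sum and the difference of [jD] and [jC] diagonalise the system; the exponentials of [h] and
     - [h] are the integrating factors. *)
  assert (P : forall y, (jD y + jC y) * exp (h y) = 0).
  { intros y. rewrite (const_of_derive_0 (fun y => (jD y + jC y) * exp (h y)) y (PI / 2)).
    - rewrite jD_PI2, jC_PI2, Hr. ring.
    - intros t. eapply is_derive_eq.
      + apply (is_derive_mult_R (fun y => jD y + jC y)); [|apply He].
        apply (is_derive_plus (V := R_NormedModule)); auto using jD_derive, jC_derive.
      + unfold plus; simpl. ring. }
  assert (M : forall y, (jD y - jC y) * exp (- h y) = 0).
  { intros y. rewrite (const_of_derive_0 (fun y => (jD y - jC y) * exp (- h y)) y (PI / 2)).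
    - rewrite jD_PI2, jC_PI2, Hr. ring.
    - intros t. eapply is_derive_eq.
      + apply (is_derive_mult_R (fun y => jD y - jC y)); [|apply He'].
        apply (is_derive_minus (V := R_NormedModule)); auto using jD_derive, jC_derive.
      + unfold minus, plus, opp; simpl. ring. }
  assert (Z : forall y, jD y = 0).
  { intros y. pose proof (P y) as Py. pose proof (M y) as My.
    pose proof (exp_pos (h y)). pose proof (exp_pos (- h y)).
    apply Rmult_integral in Py. apply Rmult_integral in My. lra. }
  pose proof (RInt_jD a Ha) as HI.
  rewrite (RInt_ext jD (fun _ => 0)), RInt_const in HI by (intros; apply Z).
  unfold scal in HI; simpl in HI. unfold mult in HI; simpl in HI. pose proof PI_RGT_0. lra.
Qed.

Lemma jD_neq0 (y : R) : jD y <> 0.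
Proof.
  pose proof (jD_ge y). pose proof r0_neq0. intros E. rewrite E in *. apply H0.
  pose proof (pow2_ge_0 r0). nra.
Qed.

Lemma jD_same_sign (x y : R) : 0 < jD x -> 0 < jD y.
Proof.
  intros Hx. destruct (Rlt_or_le 0 (jD y)) as [h|h]; [easy|exfalso].
  pose proof (jD_neq0 y) as Hn.
  assert (Hc : continuity jD) by (intros t; apply continuity_pt_filterlim, jD_cont).
  destruct (Rle_dec x y) as [l|l].
  - destruct (IVT_cor jD x y Hc l ltac:(nra)) as [z [_ Hz]]. now apply (jD_neq0 z).
  - destruct (IVT_cor jD y x Hc ltac:(lra) ltac:(nra)) as [z [_ Hz]]. now apply (jD_neq0 z).
Qed.

(* No zero, and mean value 1. *)
Lemma jD_pos (y : R) : 0 < jD y.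
Proof.
  destruct (Rlt_or_le 0 (jD y)) as [h|h]; [easy|exfalso].
  assert (L : forall x, jD x <= 0).
  { intros x. destruct (Rlt_or_le 0 (jD x)) as [h'|h']; [|easy]. pose proof (jD_same_sign x y h'). lra. }
  pose proof PI_RGT_0 as Hpi. pose proof (RInt_jD a Ha) as HI.
  assert (RInt jD 0 (PI / 2) <= RInt (fun _ => 0) 0 (PI / 2)).
  { apply RInt_le; [lra| | |intros; apply L].
    - apply ex_RInt_cont; [lra|]. intros; apply jD_cont.
    - apply ex_RInt_const. }
  rewrite RInt_const in H. unfold scal in H; simpl in H. unfold mult in H; simpl in H. lra.
Qed.

Lemma r0_pos : 0 < r0.
Proof. rewrite <- jD_PI2. apply jD_pos. Qed.

Lemma c0_lt_d0 : c0 < d0.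
Proof. pose proof r0_sqr. pose proof r0_pos. pose proof c0_pos. pose proof (jD_pos 0). nra. Qed.

(** With [jS] = c0 sin phi the first integral [jDS] reads [jD]^2 = d0^2 (1 - (c0/d0)^2 sin^2 phi),
    which dictates this modulus. It is thus obtained from a explicitly, without inverting K'/K. *)
Definition kmod : R := c0 / d0.

Lemma kmod_bounds : 0 < kmod < 1.
Proof.
  pose proof c0_pos. pose proof c0_lt_d0. unfold kmod. split.
  - apply Rdiv_lt_0_compat; lra.
  - apply Rmult_lt_reg_r with d0; [lra|]. unfold Rdiv. rewrite Rmult_assoc, Rinv_l; lra.
Qed.

Lemma compl_kmod : compl_modulus kmod = r0 / d0.
Proof.
  unfold compl_modulus, kmod. pose proof (jD_pos 0). pose proof r0_pos.
  replace (1 - (c0 / d0) ^ 2) with ((r0 / d0) ^ 2).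
  - rewrite sqrt_pow2; [easy|]. left. now apply Rdiv_lt_0_compat.
  - unfold Rdiv. rewrite Rpow_mult_distr, r0_sqr. field. lra.
Qed.

End Lattice.

(** * Dependence of K and K'/K on the modulus *)

Lemma elliptic_arg_pos (k x : R) : 0 <= k < 1 -> 0 < 1 - k ^ 2 * sin x ^ 2.
Proof.
  intros Hk. assert (sin x ^ 2 <= 1) by (pose proof (sin2_cos2 x); unfold Rsqr in *; nra).
  pose proof (pow2_ge_0 (sin x)). nra.
Qed.

Lemma continuous_K_integrand (k x : R) : 0 <= k < 1 ->
  continuous (fun phi => 1 / sqrt (1 - k ^ 2 * sin phi ^ 2)) x.
Proof.
  intros Hk. pose proof (elliptic_arg_pos k x Hk) as H.
  apply (ex_derive_continuous (V := R_NormedModule)). auto_derive.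
  replace (1 - k * (k * 1) * (sin x * (sin x * 1))) with (1 - k ^ 2 * sin x ^ 2) by ring.
  split; [easy|]. split; [|easy]. apply Rgt_not_eq, sqrt_lt_R0. easy.
Qed.

Lemma continuous_E_integrand (k x : R) : 0 <= k < 1 ->
  continuous (fun phi => sqrt (1 - k ^ 2 * sin phi ^ 2)) x.
Proof.
  intros Hk. pose proof (elliptic_arg_pos k x Hk) as H.
  apply (ex_derive_continuous (V := R_NormedModule)). auto_derive.
  replace (1 - k * (k * 1) * (sin x * (sin x * 1))) with (1 - k ^ 2 * sin x ^ 2) by ring. easy.
Qed.

Lemma ellipticK_lt (k1 k2 : R) : 0 <= k1 -> k1 < k2 -> k2 < 1 -> ellipticK k1 < ellipticK k2.
Proof.
  intros H1 H2 H3. pose proof PI_RGT_0. apply RInt_lt; [lra| | |].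
  - intros; apply continuous_K_integrand; lra.
  - intros; apply continuous_K_integrand; lra.
  - intros x Hx. pose proof (elliptic_arg_pos k1 x ltac:(lra)). pose proof (elliptic_arg_pos k2 x ltac:(lra)).
    unfold Rdiv. rewrite !Rmult_1_l. apply Rinv_lt_contravar.
    + apply Rmult_lt_0_compat; now apply sqrt_lt_R0.
    + apply sqrt_lt_1; [lra|lra|].
      pose proof (sin_gt_0 x ltac:(lra) ltac:(lra)). assert (0 < sin x ^ 2) by (apply pow_lt; lra).
      assert (k1 ^ 2 < k2 ^ 2) by (clear -H1 H2; nra).
      pose proof (Rmult_lt_compat_r (sin x ^ 2) (k1 ^ 2) (k2 ^ 2)). lra.
Qed.

Lemma ellipticK_pos (k : R) : 0 <= k < 1 -> 0 < ellipticK k.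
Proof.
  intros Hk. pose proof PI_RGT_0. apply RInt_gt_0; [lra| |].
  - intros x _. pose proof (elliptic_arg_pos k x Hk). apply Rdiv_lt_0_compat; [lra|now apply sqrt_lt_R0].
  - intros; now apply continuous_K_integrand.
Qed.

Lemma compl_modulus_bounds (k : R) : 0 < k < 1 -> 0 < compl_modulus k < 1.
Proof.
  intros Hk. unfold compl_modulus. split; [apply sqrt_lt_R0; nra|].
  rewrite <- sqrt_1 at 2. apply sqrt_lt_1; nra.
Qed.

(** K increases with the modulus while the complementary modulus decreases, so that the ratio is
    strictly decreasing. This identifies a given k with [kmod a]. *)
Lemma modulus_unique (k1 k2 : R) : 0 < k1 < 1 -> 0 < k2 < 1 ->
  ellipticK (compl_modulus k1) / ellipticK k1 = ellipticK (compl_modulus k2) / ellipticK k2 -> k1 = k2.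
Proof.
  assert (W : forall k1 k2, 0 < k1 -> k1 < k2 -> k2 < 1 ->
    ellipticK (compl_modulus k2) / ellipticK k2 < ellipticK (compl_modulus k1) / ellipticK k1).
  { intros p q H1 H2 H3. pose proof (ellipticK_lt p q ltac:(lra) H2 H3).
    pose proof (ellipticK_pos p ltac:(lra)). pose proof (ellipticK_pos q ltac:(lra)).
    pose proof (compl_modulus_bounds p ltac:(lra)). pose proof (compl_modulus_bounds q ltac:(lra)).
    assert (compl_modulus q < compl_modulus p).
    { assert (p ^ 2 < q ^ 2) by (clear -H1 H2; nra). assert (q ^ 2 < 1) by (clear -H1 H2 H3; nra).
      unfold compl_modulus. apply sqrt_lt_1; lra. }
    pose proof (ellipticK_lt (compl_modulus q) (compl_modulus p) ltac:(lra) ltac:(lra) ltac:(lra)).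
    pose proof (ellipticK_pos (compl_modulus q) ltac:(lra)).
    unfold Rdiv. pose proof (Rinv_0_lt_compat _ H4). apply Rmult_le_0_lt_compat; [lra|lra|easy|].
    apply Rinv_lt_contravar; [now apply Rmult_lt_0_compat|easy]. }
  intros H1 H2 E. destruct (Rtotal_order k1 k2) as [h|[h|h]]; [exfalso|easy|exfalso].
  - pose proof (W k1 k2 ltac:(lra) h ltac:(lra)). lra.
  - pose proof (W k2 k1 ltac:(lra) h ltac:(lra)). lra.
Qed.

(** * Complete elliptic integrals as periods, and lattice sums *)

Lemma RInt_subst (f g dg : R -> R) (b l : R) : 0 <= b ->
  (forall x, continuous f x) ->
  (forall x, is_derive g x (dg x)) -> (forall x, continuous dg x) ->
  g 0 = 0 -> g b = l ->
  RInt f 0 l = RInt (fun x => dg x * f (g x)) 0 b.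
Proof.
  intros Hb Hf Hg Hdg H0 Hl.
  rewrite <- Hl. rewrite <- H0 at 1. symmetry.
  apply (RInt_comp (V := R_CompleteNormedModule) f g dg); intros; auto.
Qed.

Lemma RInt_const_R (c a b : R) : RInt (fun _ => c) a b = (b - a) * c.
Proof. rewrite RInt_const. reflexivity. Qed.

Lemma sum_n_even_odd (u : nat -> R) (N : nat) :
  sum_n u (2 * N + 1) = sum_n (fun n => u (2 * n)%nat + u (2 * n + 1)%nat) N.
Proof.
  induction N as [|N IH].
  - change (2 * 0 + 1)%nat with 1%nat. rewrite (sum_Sn u 0), !sum_O. reflexivity.
  - rewrite (sum_Sn _ N), <- IH. replace (2 * S N + 1)%nat with (S (S (2 * N + 1))) by lia.
    rewrite !sum_Sn. replace (2 * S N)%nat with (S (2 * N + 1)) by lia. unfold plus; simpl. ring.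
Qed.

Lemma Series_even_odd (u : nat -> R) : ex_series u ->
  Series u = Series (fun n => u (2 * n)%nat + u (2 * n + 1)%nat).
Proof.
  intros H. symmetry. apply is_series_unique.
  apply Series_is_lim in H.
  assert (L : is_lim_seq (fun N => sum_n u (2 * N + 1)) (Series u)).
  { apply (is_lim_seq_subseq (sum_n u) (Series u) (fun N => (2 * N + 1)%nat)); [|easy].
    apply eventually_subseq. intros n; lia. }
  apply (is_lim_seq_ext _ (sum_n (fun n => u (2 * n)%nat + u (2 * n + 1)%nat)) (Series u)) in L.
  - exact L.
  - intros N. apply sum_n_even_odd.
Qed.

Section Lattice.
Context (a : R) (Ha : 0 < a).
Notation Tf := (serT a).
Notation Pf := (serP a).
Notation jS := (jacS a).
Notation jC := (jacC a).
Notation jD := (jacD a).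
Notation jA := (jacA a).
Notation jB := (jacB a).
Notation jT := (jacT a).
Notation c0 := (jC 0).
Notation d0 := (jD 0).
Notation r0 := (Tf 1).

Lemma sqrt_phi (y : R) : sqrt (1 - kmod a ^ 2 * sin (RInt jD 0 y) ^ 2) = jD y / d0.
Proof.
  pose proof (jD_pos a Ha 0). pose proof (jD_pos a Ha y).
  replace (1 - _) with ((jD y / d0) ^ 2).
  - rewrite sqrt_pow2; [easy|]. left. now apply Rdiv_lt_0_compat.
  - pose proof (jDS a Ha y) as E. destruct (jSC_phi a Ha y) as [E2 _]. rewrite E2 in E.
    unfold kmod, Rdiv. rewrite !Rpow_mult_distr.
    replace (jD y ^ 2) with (d0 ^ 2 - (c0 * sin (RInt jD 0 y)) ^ 2) by lra. field. lra.
Qed.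

(** Substituting the amplitude, d phi = [jD] dy while the square root is [jD]/d0: the integrand
    becomes the constant d0. *)
Lemma ellipticK_kmod : ellipticK (kmod a) = d0 * (PI / 2).
Proof.
  pose proof PI_RGT_0. pose proof (kmod_bounds a Ha). pose proof (jD_pos a Ha 0).
  unfold ellipticK.
  rewrite (RInt_subst _ (fun y => RInt jD 0 y) jD (PI / 2)).
  - rewrite (RInt_ext _ (fun _ => d0)).
    + rewrite RInt_const_R. ring.
    + intros y _. rewrite sqrt_phi. pose proof (jD_pos a Ha y). toR. field. lra.
  - lra.
  - intros; apply continuous_K_integrand; lra.
  - intros; apply is_derive_RInt_0_cont, jD_cont, Ha.
  - apply jD_cont, Ha.
  - apply (RInt_point (V := R_CompleteNormedModule)).
  - apply RInt_jD, Ha.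
Qed.

(** The same substitution gives the integrand [jD]^2/d0. Since [jD]^2 differs from u by a constant
    and u has mean 0 by [RInt_Uf], only this constant is left. *)
Lemma ellipticE_kmod : d0 * ellipticE (kmod a) = (d0 ^ 2 - Uf a 0) * (PI / 2).
Proof.
  pose proof PI_RGT_0. pose proof (kmod_bounds a Ha). pose proof (jD_pos a Ha 0) as Hd0.
  assert (EU : forall y, jD y ^ 2 = (d0 ^ 2 - Uf a 0) + Uf a (sin y ^ 2)).
  { intros y. pose proof (jDS a Ha y) as E. pose proof (Uf_P a Ha (sin y ^ 2) (pow2_ge_0 _)) as E2.
    unfold jacS in E. rewrite Rpow_mult_distr in E. lra. }
  unfold ellipticE.
  rewrite (RInt_subst _ (fun y => RInt jD 0 y) jD (PI / 2)).
  - rewrite (RInt_ext _ (fun y => scal (/ d0) (plus (d0 ^ 2 - Uf a 0) (Uf a (sin y ^ 2))))).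
    + assert (X1 : ex_RInt (fun y => Uf a (sin y ^ 2)) 0 (PI / 2))
        by (apply ex_RInt_cont; [lra|]; intros; now apply Uf_derive_cont).
      rewrite (RInt_scal (V := R_CompleteNormedModule)).
      * rewrite (RInt_plus (V := R_CompleteNormedModule)) by (try apply ex_RInt_const; exact X1).
        rewrite RInt_const_R, RInt_Uf by easy.
        toR. unfold scal, plus; simpl. unfold mult; simpl. field. lra.
      * apply (ex_RInt_plus (V := R_CompleteNormedModule)); [apply ex_RInt_const|exact X1].
    + intros y _. rewrite sqrt_phi. unfold scal, plus; simpl. unfold mult; simpl.
      change (sin y * (sin y * 1)) with (sin y ^ 2). specialize (EU y).
      toR. transitivity (/ d0 * jD y ^ 2); [field; lra|]. rewrite EU. reflexivity.
  - lra.
  - intros; apply continuous_E_integrand; lra.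
  - intros; apply is_derive_RInt_0_cont, jD_cont, Ha.
  - apply jD_cont, Ha.
  - apply (RInt_point (V := R_CompleteNormedModule)).
  - apply RInt_jD, Ha.
Qed.

Lemma jA_0 : jA 0 = c0.
Proof. rewrite c0_eq by easy. unfold jacA. rewrite cosh_0. replace (1 ^ 2) with 1 by ring. ring. Qed.

Lemma jT_0 : jT 0 = r0.
Proof. unfold jacT. rewrite cosh_0. f_equal. ring. Qed.

Lemma jA_pos (x : R) : 0 < jA x.
Proof. apply Rmult_lt_0_compat; [apply cosh_gt_0|]. apply Pf_pos; [easy|apply pow2_ge_0]. Qed.

Lemma jT_psi (x : R) : jT x = r0 * cos (RInt jA 0 x).
Proof.
  rewrite <- jT_0.
  apply (rotation_ode (fun x => - jB x) jT jA).
  - intros t. eapply is_derive_eq; [apply (is_derive_opp (V := R_NormedModule)), jB_derive, Ha|].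
    unfold opp; simpl. ring.
  - intros t. eapply is_derive_eq; [apply jT_derive, Ha|]. ring.
  - apply jA_cont, Ha.
  - unfold jacB. rewrite sinh_0. ring.
Qed.

Lemma jAT (x : R) : jA x ^ 2 + jT x ^ 2 = d0 ^ 2.
Proof.
  transitivity (jA 0 * jA 0 + jT 0 * jT 0).
  - rewrite (const_of_derive_0 (fun y => jA y * jA y + jT y * jT y) 0 x); [ring|].
    intros t. eapply is_derive_eq.
    + apply (is_derive_plus (V := R_NormedModule)); apply is_derive_mult_R; auto using jA_derive, jT_derive.
    + unfold plus; simpl. ring.
  - rewrite jA_0, jT_0. pose proof (r0_sqr a Ha). lra.
Qed.

Lemma sqrt_psi (x : R) : sqrt (1 - compl_modulus (kmod a) ^ 2 * cos (RInt jA 0 x) ^ 2) = jA x / d0.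
Proof.
  pose proof (jD_pos a Ha 0). pose proof (jA_pos x). rewrite compl_kmod by easy.
  replace (1 - _) with ((jA x / d0) ^ 2).
  - rewrite sqrt_pow2; [easy|]. left. now apply Rdiv_lt_0_compat.
  - pose proof (jAT x) as E. rewrite jT_psi in E.
    unfold Rdiv. rewrite !Rpow_mult_distr.
    replace (jA x ^ 2) with (d0 ^ 2 - (r0 * cos (RInt jA 0 x)) ^ 2) by lra. field. lra.
Qed.

(** The argument of [ellipticK_kmod] on the other line, where the angle PI / 2 is reached after the
    length a / 2. The quotient of the two results is a / PI. *)
Lemma ellipticK_compl : ellipticK (compl_modulus (kmod a)) = d0 * (a / 2).
Proof.
  pose proof PI_RGT_0. pose proof (kmod_bounds a Ha) as Hk. pose proof (jD_pos a Ha 0).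
  pose proof (compl_modulus_bounds _ Hk) as Hk'.
  set (k' := compl_modulus (kmod a)) in *.
  assert (Hc : forall x, continuous (fun phi => 1 / sqrt (1 - k' ^ 2 * cos phi ^ 2)) x).
  { intros x. apply continuous_ext with (fun phi => 1 / sqrt (1 - k' ^ 2 * sin (PI / 2 - phi) ^ 2)).
    - intros t. now rewrite sin_shift.
    - apply (continuous_comp (fun phi => PI / 2 - phi) (fun phi => 1 / sqrt (1 - k' ^ 2 * sin phi ^ 2))).
      + apply (ex_derive_continuous (V := R_NormedModule)). now auto_derive.
      + apply continuous_K_integrand; lra. }
  (* [sqrt_psi] involves the cosine of the angle, hence the preliminary reflection phi -> PI / 2 -
     phi. *)
  transitivity (RInt (fun phi => 1 / sqrt (1 - k' ^ 2 * cos phi ^ 2)) 0 (PI / 2)).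
  - unfold ellipticK.
    pose proof (RInt_comp_lin (V := R_CompleteNormedModule) (fun phi => 1 / sqrt (1 - k' ^ 2 * sin phi ^ 2)) (-1) (PI / 2) (PI / 2) 0) as E.
    replace (-1 * (PI / 2) + PI / 2) with 0 in E by ring.
    replace (-1 * 0 + PI / 2) with (PI / 2) in E by ring.
    rewrite <- E by (apply ex_RInt_cont; [lra|]; intros; apply continuous_K_integrand; lra).
    assert (Hex : ex_RInt (fun phi => 1 / sqrt (1 - k' ^ 2 * cos phi ^ 2)) 0 (PI / 2))
      by (apply ex_RInt_cont; [lra|auto]).
    rewrite <- (opp_RInt_swap (V := R_CompleteNormedModule)).
    + rewrite <- (RInt_opp (V := R_CompleteNormedModule)).
      * apply RInt_ext. intros x _. unfold scal, opp; simpl. unfold mult; simpl.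
        replace (-1 * x + PI / 2) with (PI / 2 - x) by ring. rewrite sin_shift. toR. ring.
      * apply (ex_RInt_ext (V := R_CompleteNormedModule) (fun x => scal (-1) (1 / sqrt (1 - k' ^ 2 * cos x ^ 2)))).
        -- intros x _. replace (-1 * x + PI / 2) with (PI / 2 - x) by ring. now rewrite sin_shift.
        -- now apply (ex_RInt_scal (V := R_CompleteNormedModule)).
    + apply (ex_RInt_ext (V := R_CompleteNormedModule) (fun x => scal (-1) (1 / sqrt (1 - k' ^ 2 * cos x ^ 2)))).
      * intros x _. replace (-1 * x + PI / 2) with (PI / 2 - x) by ring. now rewrite sin_shift.
      * now apply (ex_RInt_scal (V := R_CompleteNormedModule)).
  - rewrite (RInt_subst _ (fun y => RInt jA 0 y) jA (a / 2)).
    + rewrite (RInt_ext _ (fun _ => d0)).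
      * rewrite RInt_const_R. ring.
      * intros y _. unfold k'. rewrite sqrt_psi. pose proof (jA_pos y). toR. field. lra.
    + lra.
    + exact Hc.
    + intros; apply is_derive_RInt_0_cont, jA_cont, Ha.
    + apply jA_cont, Ha.
    + apply (RInt_point (V := R_CompleteNormedModule)).
    + apply RInt_jA, Ha.
Qed.

(** Y = 0, 1 and cosh^2 (a/2) correspond to z = 0, i PI/2 and a/2 + i PI/2, the three half periods
    of u counted from its pole at a/2. *)
Lemma Uf_1 : Uf a 1 = Uf a 0 - c0 ^ 2.
Proof. pose proof (Uf_P a Ha 1 ltac:(lra)) as H. rewrite c0_eq by easy. lra. Qed.

Lemma Uf_half : Uf a (cosh (a / 2) ^ 2) = Uf a 0 - d0 ^ 2.
Proof.
  pose proof (Uf_P a Ha (cosh (a / 2) ^ 2) (pow2_ge_0 _)) as H.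
  pose proof (jAT (a / 2)) as E. rewrite jT_psi, RInt_jA, cos_PI2 in E by easy.
  unfold jacA in E. rewrite Rpow_mult_distr in E. rewrite H in E. lra.
Qed.

Definition csch2 (j : nat) : R := / sinh (INR j * a) ^ 2.

Lemma csch2_bound (j : nat) : 0 < csch2 (S j) <= / sinh a ^ 2 * / exp a ^ j.
Proof.
  pose proof (inv_sinh_j_le a Ha j) as [H1 H2]. unfold csch2. rewrite <- (pow_inv (sinh (INR (S j) * a))), <- (pow_inv (sinh a)).
  assert (H3 : / exp a ^ j <= 1) by (rewrite <- Rinv_1; apply Rinv_le_contravar; [lra|]; now apply exp_ge_1).
  pose proof (Rinv_0_lt_compat _ (pow_lt _ j (exp_pos a))) as H4.
  pose proof (Rinv_0_lt_compat _ (sinh_gt_0 a Ha)) as H5.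
  split; [now apply pow_lt|].
  apply Rle_trans with ((/ sinh a * / exp a ^ j) ^ 2); [apply pow_incr; lra|].
  set (q := / exp a ^ j) in *. rewrite Rpow_mult_distr.
  apply Rmult_le_compat_l; [left; now apply pow_lt|]. nra.
Qed.

Lemma ex_csch2 (f : nat -> nat) : (forall n, (n <= f n)%nat) -> ex_series (fun n => csch2 (S (f n))).
Proof.
  intros Hf. apply ex_series_Rabs_le with (fun n => / sinh a ^ 2 * / exp a ^ n).
  - intros n. pose proof (csch2_bound (f n)) as [H1 H2]. rewrite Rabs_pos_eq by lra.
    eapply Rle_trans; [exact H2|]. apply Rmult_le_compat_l; [left; apply Rinv_0_lt_compat, pow_lt, sinh_gt_0, Ha|].
    apply Rinv_le_contravar; [apply pow_lt, exp_pos|]. apply Rle_pow; [|apply Hf].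
    pose proof (exp_ineq1 a). lra.
  - apply ex_series_scal_R, ex_series_exp_geom, Ha.
Qed.

Lemma Uf_0_series : Uf a 0 = 2 * Series (fun n => / lat_sinh a n ^ 2).
Proof.
  unfold Uf. rewrite <- Series_scal_l. apply Series_ext; intros n. unfold Uc, lat_sqr.
  pose proof (sh_pos a Ha n). field. lra.
Qed.

(** csch^2 b - 1/cosh^2 b = 4 csch^2 (2 b), and 2 b is an odd multiple of a. *)
Lemma Uf_01_series : Uf a 0 + Uf a 1 = 8 * Series (fun n => csch2 (S (2 * n))).
Proof.
  unfold Uf. rewrite <- Series_plus by (apply ex_Uf; lra). rewrite <- Series_scal_l.
  apply Series_ext; intros n. unfold Uc, lat_sqr, csch2.
  replace (INR (S (2 * n)) * a) with (2 * bpt a n) by (rewrite <- bpt_2; do 2 f_equal; lia).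
  rewrite sinh_double. fold (lat_sinh a n) (lat_cosh a n).
  pose proof (sh_pos a Ha n). pose proof (ch_pos a n). pose proof (ch_sqr a n) as E.
  rewrite Rplus_0_r.
  replace (lat_sinh a n ^ 2 + 1) with (lat_cosh a n ^ 2) by lra.
  replace (lat_sinh a n ^ 2 - 1 * (1 + 2 * lat_sinh a n ^ 2)) with (- lat_cosh a n ^ 2) by lra.
  apply Rminus_diag_uniq.
  transitivity (2 * (lat_cosh a n ^ 2 - lat_sinh a n ^ 2 - 1) / (lat_sinh a n ^ 2 * lat_cosh a n ^ 2)); [field; lra|].
  rewrite E. unfold Rdiv. ring.
Qed.

(** At z = a/2 + i PI/2 a pair becomes - 1/cosh^2 (n a) - 1/cosh^2 ((n + 1) a). Then 1/cosh^2 x =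
    csch^2 x - 4 csch^2 (2 x) applies, except at n = 0, whose value 1 gives the constant - 1. *)
Lemma Uf_half_series :
  Uf a (cosh (a / 2) ^ 2) = - 1 - 2 * Series (fun n => csch2 (S n)) + 8 * Series (fun n => csch2 (S (2 * n + 1))).
Proof.
  pose (t := fun j => / cosh (INR j * a) ^ 2).
  assert (Et : forall j, t (S j) = csch2 (S j) - 4 * csch2 (S (2 * j + 1))).
  { intros j. unfold t, csch2. replace (INR (S (2 * j + 1)) * a) with (2 * (INR (S j) * a)).
    2:{ replace (S (2 * j + 1)) with (2 * S j)%nat by lia. rewrite mult_INR. simpl (INR 2). ring. }
    rewrite sinh_double. pose proof (sinh_j_neq0 a Ha (S j) ltac:(lia)).
    pose proof (cosh_gt_0 (INR (S j) * a)). pose proof (cosh_sqr (INR (S j) * a)) as E.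
    set (s := sinh (INR (S j) * a)) in *. set (c := cosh (INR (S j) * a)) in *.
    apply Rminus_diag_uniq. transitivity ((1 + s ^ 2 - c ^ 2) / (s ^ 2 * c ^ 2)); [field; lra|].
    rewrite E. unfold Rdiv. ring. }
  assert (X1 : ex_series (fun n => csch2 (S n))) by (apply (ex_csch2 (fun n => n)); lia).
  assert (X2 : ex_series (fun n => csch2 (S (2 * n + 1)))) by (apply (ex_csch2 (fun n => 2 * n + 1)%nat); lia).
  assert (X3 : ex_series (fun n => t (S n))).
  { apply ex_series_ext with (fun n => minus (csch2 (S n)) (4 * csch2 (S (2 * n + 1)))).
    - intros n. symmetry. apply Et.
    - apply (ex_series_minus (V := R_NormedModule)); [easy|now apply ex_series_scal_R]. }
  assert (X4 : ex_series t) by now apply (ex_series_incr_1 t).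
  assert (S3 : Series (fun n => t (S n)) = Series (fun n => csch2 (S n)) - 4 * Series (fun n => csch2 (S (2 * n + 1)))).
  { rewrite <- Series_scal_l, <- Series_minus by (auto using ex_series_scal_R). apply Series_ext, Et. }
  assert (S4 : Series t = 1 + Series (fun n => t (S n))).
  { rewrite Series_incr_1 by easy. f_equal. unfold t. simpl INR. rewrite Rmult_0_l, cosh_0. field. }
  transitivity (- (Series (fun n => t (S n)) + Series t)); [|rewrite S4, S3; ring].
  unfold Uf. rewrite <- Series_plus by easy. rewrite <- Series_opp. apply Series_ext; intros n.
  unfold Uc, lat_sqr, t.
  replace (INR (S n) * a) with (bpt a n + a / 2) by (rewrite S_INR; unfold bpt; field).
  replace (INR n * a) with (bpt a n + - (a / 2)) by (unfold bpt; field).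
  unfold lat_sinh. set (b := bpt a n). set (x := a / 2).
  pose proof (cosh_gt_0 (b + x)) as H1. pose proof (cosh_gt_0 (b + - x)) as H2.
  assert (E : sinh b ^ 2 + cosh x ^ 2 = cosh (b + x) * cosh (b + - x)).
  { rewrite !cosh_plus, cosh_opp, sinh_opp. pose proof (cosh_sqr b). pose proof (cosh_sqr x). nra. }
  rewrite E.
  replace (2 * (sinh b ^ 2 - cosh x ^ 2 * (1 + 2 * sinh b ^ 2))) with (- (cosh (b + x) ^ 2 + cosh (b + - x) ^ 2)).
  - field. lra.
  - rewrite !cosh_plus, cosh_opp, sinh_opp.
    replace (- _) with (- (2 * (cosh b ^ 2 * cosh x ^ 2 + sinh b ^ 2 * sinh x ^ 2))) by ring.
    rewrite (cosh_sqr b). replace (sinh x ^ 2) with (cosh x ^ 2 - 1) by (rewrite cosh_sqr; ring). ring.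
Qed.

(** The odd multiples from [Uf_01_series] and the even ones from [Uf_half_series] carry the same
    weight 8 and recombine into the full sum, of which 8 - 2 = 6 copies remain. *)
Lemma Uf_sum : Uf a 0 + Uf a 1 + Uf a (cosh (a / 2) ^ 2) = 6 * Series (fun n => csch2 (S n)) - 1.
Proof.
  rewrite Uf_01_series, Uf_half_series.
  assert (X1 : ex_series (fun n => csch2 (S n))) by (apply (ex_csch2 (fun n => n)); lia).
  pose proof (Series_even_odd _ X1) as E. cbv beta in E. rewrite Series_plus in E.
  - lra.
  - apply (ex_csch2 (fun n => 2 * n)%nat); lia.
  - apply (ex_csch2 (fun n => 2 * n + 1)%nat); lia.
Qed.

End Lattice.

Lemma lattice_sums (alpha k : R) : 0 < alpha -> 0 < k < 1 ->
  ellipticK (compl_modulus k) / ellipticK k = alpha ->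
  Series (fun n => / sinh ((INR n + / 2) * (PI * alpha)) ^ 2)
    = 2 / PI ^ 2 * (ellipticK k - ellipticE k) * ellipticK k /\
  Series (fun n => / sinh (INR (S n) * (PI * alpha)) ^ 2)
    = / 6 - 2 / PI ^ 2 * (ellipticE k - (2 - k ^ 2) / 3 * ellipticK k) * ellipticK k.
Proof.
  intros Hal Hk Hm. pose proof PI_RGT_0 as Hpi.
  assert (Ha : 0 < PI * alpha) by now apply Rmult_lt_0_compat.
  set (a := PI * alpha) in *.
  pose proof (jD_pos a Ha 0) as Hd.
  (* The quotient of [ellipticK_compl] by [ellipticK_kmod] is a / PI = alpha, and the quotient
     determines the modulus. *)
  assert (Ek : k = kmod a).
  { apply modulus_unique; [easy|now apply kmod_bounds|]. rewrite Hm.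
    rewrite ellipticK_kmod, ellipticK_compl by easy. unfold a. field. fold a. lra. }
  pose proof (ellipticK_kmod a Ha) as EK. pose proof (ellipticE_kmod a Ha) as EE.
  rewrite <- Ek in EK, EE.
  assert (Ec : jacC a 0 = k * jacD a 0) by (rewrite Ek; unfold kmod; field; lra).
  assert (Ed : jacD a 0 = 2 * ellipticK k / PI) by (rewrite EK; field; lra).
  assert (E0 : Uf a 0 = 4 / PI ^ 2 * (ellipticK k - ellipticE k) * ellipticK k).
  { apply (Rmult_eq_reg_r (PI / 2)); [|lra].
    transitivity (jacD a 0 ^ 2 * (PI / 2) - jacD a 0 * ellipticE k); [lra|]. rewrite Ed. field. lra. }
  split.
  - pose proof (Uf_0_series a Ha) as E. rewrite E0 in E. unfold lat_sinh, bpt in E. lra.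
  (* The three values add up to 3 u(0) - (1 + k^2) d0^2, whence the combination E - (2 - k^2)/3
     K. *)
  - pose proof (Uf_sum a Ha) as E. rewrite Uf_1, Uf_half, Ec, Ed, E0 in E by easy. unfold csch2 in E.
    match goal with |- ?s = _ => replace s with ((6 * s - 1 + 1) / 6) by field end.
    rewrite <- E. field. lra.
Qed.

(** * Integrals with a limit at the right endpoint *)

Definition tends_left (f : R -> R) (b l : R) : Prop :=
  forall eps, 0 < eps -> exists d, 0 < d /\ forall x, b - d < x < b -> Rabs (f x - l) < eps.

(** Replaces whatever value f has at the endpoint by the limit and continues it as a constant, so
    that theorems on continuous functions apply. *)
Definition ext_left (f : R -> R) (b l x : R) : R := if Rlt_dec x b then f x else l.

Lemma ext_left_lt (f : R -> R) (b l x : R) : x < b -> ext_left f b l x = f x.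
Proof. intros H. unfold ext_left. now destruct (Rlt_dec x b). Qed.

Lemma ext_left_b (f : R -> R) (b l : R) : ext_left f b l b = l.
Proof. unfold ext_left. destruct (Rlt_dec b b); [lra|easy]. Qed.

Lemma locally_lt (x b : R) : x < b -> locally x (fun y => y < b).
Proof.
  intros H. assert (h : 0 < b - x) by lra. exists (mkposreal _ h). intros y Hy.
  apply Rabs_def2 in Hy. simpl in Hy. unfold minus, plus, opp in Hy; simpl in Hy. lra.
Qed.

Lemma ext_left_continuous (f : R -> R) (b l x : R) :
  tends_left f b l -> (x < b -> continuous f x) -> x <= b -> continuous (ext_left f b l) x.
Proof.
  intros Hl Hc Hx. destruct (Rlt_dec x b) as [h|h].
  - apply (continuous_ext_loc _ f); [|now apply Hc].
    apply filter_imp with (fun y => y < b); [|now apply locally_lt].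
    intros y Hy. now rewrite ext_left_lt.
  - assert (x = b) by lra. subst x. apply filterlim_locally. intros eps.
    destruct (Hl eps (cond_pos eps)) as [d [Hd H]]. exists (mkposreal d Hd). intros y Hy.
    rewrite ext_left_b. unfold ext_left. destruct (Rlt_dec y b) as [hy|hy].
    + apply H. apply Rabs_def2 in Hy. simpl in Hy. unfold minus, plus, opp in Hy; simpl in Hy. lra.
    + apply ball_center.
Qed.

Lemma ex_RInt_tends (f : R -> R) (b l : R) : 0 < b ->
  (forall x, 0 <= x < b -> continuous f x) -> tends_left f b l -> ex_RInt f 0 b.
Proof.
  intros Hb Hc Hl. apply ex_RInt_ext with (ext_left f b l).
  - intros x. rewrite Rmin_left, Rmax_right by lra. intros Hx. apply ext_left_lt; lra.
  - apply ex_RInt_cont; [lra|]. intros x Hx. apply ext_left_continuous; [easy| |lra].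
    intros. apply Hc. lra.
Qed.

Lemma is_RInt_tends (F f : R -> R) (b l L : R) : 0 < b ->
  (forall x, 0 <= x < b -> continuous f x) -> tends_left f b l ->
  (forall x, 0 <= x < b -> is_derive F x (f x)) -> tends_left F b L ->
  is_RInt f 0 b (L - F 0).
Proof.
  intros Hb Hc Hl HF HL.
  (* f is frozen at its value at 0 to the left and, in [ge], at its limit beyond b; the result is
     continuous on the whole line, as [is_derive_RInt_0_cont] demands. *)
  pose (g := fun x => if Rlt_dec x 0 then f 0 else ext_left f b l x).
  assert (Hg : forall x, x <= b -> continuous g x).
  { intros x Hx. destruct (Rtotal_order x 0) as [h|[h|h]].
    - apply (continuous_ext_loc _ (fun _ => f 0)); [|apply continuous_const].
      apply filter_imp with (fun y => y < 0); [|now apply locally_lt].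
      intros y Hy. unfold g. now destruct (Rlt_dec y 0).
    - subst x. assert (C := ext_left_continuous f b l 0 Hl (fun _ => Hc 0 ltac:(lra)) Hx).
      apply filterlim_locally. intros eps.
      apply filterlim_locally with (eps := eps) in C.
      revert C. apply filter_imp. intros y Hy. unfold g.
      rewrite (ext_left_lt f b l 0) in Hy by easy.
      destruct (Rlt_dec 0 0); [lra|]. rewrite (ext_left_lt f b l 0) by easy.
      destruct (Rlt_dec y 0); [apply ball_center|easy].
    - apply (continuous_ext_loc _ (ext_left f b l)).
      + assert (hx : 0 < x) by easy. exists (mkposreal x hx). intros y Hy.
        apply Rabs_def2 in Hy. simpl in Hy. unfold minus, plus, opp in Hy; simpl in Hy.
        unfold g. destruct (Rlt_dec y 0); [lra|easy].
      + apply ext_left_continuous; [easy| |easy]. intros; apply Hc; lra. }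
  assert (Hgg : forall x, x <= b -> ex_RInt g 0 x).
  { intros x Hx. apply (ex_RInt_continuous (V := R_CompleteNormedModule)). intros z Hz. apply Hg.
    eapply Rle_trans; [apply Hz|]. apply Rmax_lub; lra. }
  pose (ge := ext_left g b l).
  assert (Eg : forall x, x <= b -> ge x = g x).
  { intros x Hx. unfold ge. destruct (Rlt_dec x b); [now apply ext_left_lt|].
    assert (x = b) by lra. subst. rewrite ext_left_b. unfold g. destruct (Rlt_dec b 0); [lra|].
    now rewrite ext_left_b. }
  assert (Hge : forall x, continuous ge x).
  { intros x. destruct (Rle_dec x b) as [h|h].
    - apply ext_left_continuous; [|intros; apply Hg; lra|easy].
      intros eps He. destruct (Hl eps He) as [d [Hd H]]. exists (Rmin d b).
      split; [now apply Rmin_pos|]. intros y Hy.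
      pose proof (Rmin_l d b). pose proof (Rmin_r d b).
      unfold g. destruct (Rlt_dec y 0); [lra|]. rewrite ext_left_lt by lra. apply H. lra.
    - apply (continuous_ext_loc _ (fun _ => l)); [|apply continuous_const].
      assert (hx : 0 < x - b) by lra. exists (mkposreal _ hx). intros y Hy.
      apply Rabs_def2 in Hy. simpl in Hy. unfold minus, plus, opp in Hy; simpl in Hy.
      unfold ge, ext_left. destruct (Rlt_dec y b); [lra|easy]. }
  assert (E : ext_left F b L b - RInt ge 0 b = ext_left F b L 0 - RInt ge 0 0).
  { apply (is_derive_0_const (fun x => ext_left F b L x - RInt ge 0 x) 0 b); try lra.
    - intros t Ht. eapply is_derive_eq.
      + apply (is_derive_minus (V := R_NormedModule)).
        * apply (is_derive_ext_loc F); [|apply HF; lra].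
          apply filter_imp with (fun y => y < b); [|now apply locally_lt].
          intros y Hy. now rewrite ext_left_lt.
        * apply is_derive_RInt_0_cont, Hge.
      + rewrite Eg by lra. unfold g. destruct (Rlt_dec t 0); [lra|]. rewrite ext_left_lt by lra.
        unfold minus, plus, opp; simpl. ring.
    - intros t Ht. apply (continuous_minus (V := R_NormedModule)).
      + apply ext_left_continuous; [easy| |lra]. intros. eapply continuous_derive, HF. lra.
      + eapply continuous_derive, is_derive_RInt_0_cont, Hge. }
  rewrite ext_left_b, ext_left_lt, (RInt_point (V := R_CompleteNormedModule)) in E by easy.
  change (zero : R) with 0 in E.
  replace (L - F 0) with (RInt ge 0 b) by lra.
  apply is_RInt_ext with ge.
  - intros x. rewrite Rmin_left, Rmax_right by lra. intros Hx. rewrite Eg by lra. unfold g.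
    destruct (Rlt_dec x 0); [lra|]. apply ext_left_lt; lra.
  - apply (RInt_correct (V := R_CompleteNormedModule)). apply ex_RInt_cont; [lra|auto].
Qed.

(** Two applications of the mean value theorem bound the remainder pointwise by M h^2, the form
    required by [is_derive_quadratic]. *)
Lemma RInt_param_derive (f f1 f2 : R -> R -> R) (s0 d M a b : R) : a <= b -> 0 < d ->
  (forall s x, Rabs (s - s0) < d -> a < x < b -> is_derive (fun s => f s x) s (f1 s x)) ->
  (forall s x, Rabs (s - s0) < d -> a < x < b -> is_derive (fun s => f1 s x) s (f2 s x)) ->
  (forall s x, Rabs (s - s0) < d -> a < x < b -> Rabs (f2 s x) <= M) ->
  (forall s, Rabs (s - s0) < d -> ex_RInt (f s) a b) ->
  ex_RInt (f1 s0) a b ->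
  is_derive (fun s => RInt (f s) a b) s0 (RInt (f1 s0) a b).
Proof.
  intros Hab Hd H1 H2 HM Hex Hex1.
  assert (D0 : Rabs (s0 - s0) < d) by (rewrite Rminus_diag, Rabs_R0; easy).
  apply (is_derive_quadratic _ _ _ ((b - a) * M) d Hd).
  intros h Hh.
  assert (Dh : Rabs (s0 + h - s0) < d) by (replace (s0 + h - s0) with h by ring; easy).
  replace (RInt (f (s0 + h)) a b - RInt (f s0) a b - h * RInt (f1 s0) a b)
    with (RInt (fun x => f (s0 + h) x - f s0 x - h * f1 s0 x) a b).
  - rewrite Rmult_assoc. apply Rabs_RInt_le; [easy| |].
    + apply (ex_RInt_minus (V := R_NormedModule)).
      * apply (ex_RInt_minus (V := R_NormedModule)); auto.
      * now apply (ex_RInt_scal (V := R_NormedModule)).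
    + intros x Hx.
      assert (Hin : forall t, Rmin s0 (s0 + h) <= t <= Rmax s0 (s0 + h) -> Rabs (t - s0) <= Rabs h).
      { intros t. unfold Rmin, Rmax. destruct (Rle_dec s0 (s0 + h)); intros Ht; unfold Rabs;
          destruct (Rcase_abs (t - s0)); destruct (Rcase_abs h); lra. }
      destruct (MVT_gen (fun s => f s x) s0 (s0 + h) (fun s => f1 s x)) as [xi [Hxi E]].
      * intros t Ht. apply H1; [|easy]. eapply Rle_lt_trans; [apply Hin; lra|easy].
      * intros t Ht. apply continuity_pt_filterlim.
        apply (continuous_derive (fun s => f s x) _ (f1 t x)), H1; [|easy]. eapply Rle_lt_trans; [now apply Hin|easy].
      * destruct (MVT_gen (fun s => f1 s x) s0 xi (fun s => f2 s x)) as [ze [Hze E2]].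
        -- intros t Ht. apply H2; [|easy]. eapply Rle_lt_trans; [apply Hin|apply Hh].
           revert Ht Hxi. unfold Rmin, Rmax. destruct (Rle_dec s0 xi), (Rle_dec s0 (s0 + h)); lra.
        -- intros t Ht. apply continuity_pt_filterlim.
           apply (continuous_derive (fun s => f1 s x) _ (f2 t x)), H2; [|easy]. eapply Rle_lt_trans; [apply Hin|apply Hh].
           revert Ht Hxi. unfold Rmin, Rmax. destruct (Rle_dec s0 xi), (Rle_dec s0 (s0 + h)); lra.
        -- cbv beta in E, E2. rewrite E.
           replace (f1 xi x * (s0 + h - s0) - h * f1 s0 x) with (h * (f2 ze x * (xi - s0))) by (rewrite <- E2; ring).
           rewrite !Rabs_mult.
           pose proof (Hin xi Hxi) as B1.
           assert (B2 : Rabs (f2 ze x) <= M).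
           { apply HM; [|easy]. eapply Rle_lt_trans; [apply Hin|apply Hh].
             revert Hze Hxi. unfold Rmin, Rmax. destruct (Rle_dec s0 xi), (Rle_dec s0 (s0 + h)); lra. }
           replace (h ^ 2) with (Rabs h * Rabs h) by (rewrite <- Rabs_mult, Rabs_pos_eq; [ring|nra]).
           pose proof (Rabs_pos h). pose proof (Rabs_pos (f2 ze x)). pose proof (Rabs_pos (xi - s0)).
           assert (Rabs (f2 ze x) * Rabs (xi - s0) <= M * Rabs h) by (apply Rmult_le_compat; lra).
           nra.
  - apply is_RInt_unique. apply (is_RInt_minus (V := R_NormedModule)).
    + apply (is_RInt_minus (V := R_NormedModule)); apply (RInt_correct (V := R_CompleteNormedModule)); auto.
    + apply (is_RInt_scal (V := R_NormedModule)). now apply (RInt_correct (V := R_CompleteNormedModule)).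
Qed.

(* Writing z = ln (1 + exp (2 i x)) = ln (2 cos x) + i x, one has [eta c x + i x = z - c] and [den] is its squared modulus. *)
Definition eta (c x : R) : R := ln (2 * cos x) - c.
Definition den (c x : R) : R := eta c x ^ 2 + x ^ 2.

(* Real parts of (p + i q)/(z - c), (p + i q)/(z - c)^2 and 2 (p + i q)/(z - c)^3. *)
Definition W1 (p q : R -> R) (c x : R) : R := (p x * eta c x + q x * x) / den c x.
Definition W2 (p q : R -> R) (c x : R) : R :=
  (p x * (eta c x ^ 2 - x ^ 2) + q x * (2 * eta c x * x)) / den c x ^ 2.
Definition W3 (p q : R -> R) (c x : R) : R :=
  2 * (p x * (eta c x ^ 3 - 3 * eta c x * x ^ 2) + q x * (3 * eta c x ^ 2 * x - x ^ 3)) / den c x ^ 3.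

Lemma cos_pos_dom (x : R) : 0 <= x < PI / 2 -> 0 < cos x.
Proof. intros H. apply cos_gt_0; pose proof PI_RGT_0; lra. Qed.

Lemma eta_derive (c x : R) : 0 < cos x -> is_derive (eta c) x (- (sin x / cos x)).
Proof. intros H. unfold eta. auto_derive; [lra|]. field. lra. Qed.

Lemma eta_lim (c K : R) : exists d, 0 < d /\ forall x, PI / 2 - d < x < PI / 2 -> eta c x < - K.
Proof.
  pose proof PI_RGT_0 as Hpi.
  exists (Rmin (PI / 2) (exp (c - K) / 2)). split.
  - apply Rmin_pos; [lra|]. pose proof (exp_pos (c - K)). lra.
  - intros x Hx. pose proof (Rmin_l (PI / 2) (exp (c - K) / 2)). pose proof (Rmin_r (PI / 2) (exp (c - K) / 2)).
    assert (Hc : 0 < cos x) by (apply cos_pos_dom; lra).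
    assert (cos x < exp (c - K) / 2).
    { rewrite <- sin_shift. eapply Rlt_trans; [apply sin_lt_x; lra|lra]. }
    unfold eta. assert (ln (2 * cos x) < c - K); [|lra].
    rewrite <- (ln_exp (c - K)). apply ln_increasing; lra.
Qed.

(** The logarithm drives [eta] to - infinity at PI / 2, so a decay like 1/|eta| is enough. All the
    tail estimates below are put in this form. *)
Lemma tends_left_eta (f : R -> R) (c C K : R) : 0 < K ->
  (forall x, 0 <= x < PI / 2 -> eta c x < - K -> Rabs (f x) <= C / - eta c x) ->
  tends_left f (PI / 2) 0.
Proof.
  intros HK H eps He. pose proof PI_RGT_0 as Hpi.
  destruct (eta_lim c (K + Rabs C / eps)) as [d [Hd Hx]].
  exists (Rmin d (PI / 2)). split; [apply Rmin_pos; lra|].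
  intros x Hxd. pose proof (Rmin_l d (PI / 2)). pose proof (Rmin_r d (PI / 2)).
  specialize (Hx x ltac:(lra)).
  assert (0 <= Rabs C / eps).
  { unfold Rdiv. apply Rmult_le_pos; [apply Rabs_pos|left; now apply Rinv_0_lt_compat]. }
  rewrite Rminus_0_r. eapply Rle_lt_trans; [apply H; lra|].
  apply Rmult_lt_reg_r with (- eta c x); [lra|]. unfold Rdiv. rewrite Rmult_assoc, Rinv_l, Rmult_1_r by lra.
  apply Rle_lt_trans with (Rabs C); [apply Rle_abs|].
  replace (Rabs C) with (eps * (Rabs C / eps)) by (field; lra).
  apply Rmult_lt_compat_l; lra.
Qed.

Lemma ex_RInt_eta (f : R -> R) (c C K : R) : 0 < K ->
  (forall x, 0 <= x < PI / 2 -> continuous f x) ->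
  (forall x, 0 <= x < PI / 2 -> eta c x < - K -> Rabs (f x) <= C / - eta c x) ->
  ex_RInt f 0 (PI / 2).
Proof.
  intros HK Hc H. pose proof PI_RGT_0 as Hpi.
  apply ex_RInt_tends with 0; [lra|easy|]. now apply tends_left_eta with c C K.
Qed.

Lemma is_RInt_eta (F f : R -> R) (c C K C' K' : R) : 0 < K -> 0 < K' ->
  (forall x, 0 <= x < PI / 2 -> continuous f x) ->
  (forall x, 0 <= x < PI / 2 -> eta c x < - K -> Rabs (f x) <= C / - eta c x) ->
  (forall x, 0 <= x < PI / 2 -> is_derive F x (f x)) ->
  (forall x, 0 <= x < PI / 2 -> eta c x < - K' -> Rabs (F x) <= C' / - eta c x) ->
  is_RInt f 0 (PI / 2) (0 - F 0).
Proof.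
  intros HK HK' Hc H HF HF'. pose proof PI_RGT_0 as Hpi.
  apply is_RInt_tends with 0; [lra|easy| |easy|].
  - now apply tends_left_eta with c C K.
  - now apply tends_left_eta with c C' K'.
Qed.

Definition good (c0 d delta : R) : Prop := 0 < d /\ 0 < delta /\
  forall c x, Rabs (c - c0) < d -> 0 <= x < PI / 2 -> delta <= den c x.

(** The curve x -> ln (2 cos x) + i x meets the real axis only at ln 2, for x = 0. For x < r its
    real part stays near ln 2, away from c; for x >= r its imaginary part is at least r. *)
Lemma good_ex (c0 : R) : c0 <> ln 2 -> exists d delta, good c0 d delta.
Proof.
  intros Hc. pose proof PI_RGT_0 as Hpi.
  set (g := Rabs (c0 - ln 2)).
  assert (Hg : 0 < g) by (apply Rabs_pos_lt; lra).
  assert (Hcont : continuous (eta 0) 0).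
  { apply (continuous_derive _ _ _ (eta_derive 0 0 ltac:(rewrite cos_0; lra))). }
  assert (Hg4 : 0 < g / 4) by lra.
  apply filterlim_locally with (eps := mkposreal _ Hg4) in Hcont.
  destruct Hcont as [r Hr].
  exists (g / 4), (Rmin (r ^ 2) ((g / 2) ^ 2)). split; [lra|]. split.
  - apply Rmin_pos; apply pow_lt; [apply cond_pos|lra].
  - intros c x Hcd Hx. unfold den. destruct (Rlt_dec x r) as [h|h].
    + apply Rle_trans with ((g / 2) ^ 2); [apply Rmin_r|].
      assert (B : ball (eta 0 0) (g / 4) (eta 0 x)).
      { apply Hr. change (Rabs (x - 0) < r). rewrite Rminus_0_r, Rabs_pos_eq; lra. }
      change (Rabs (eta 0 x - eta 0 0) < g / 4) in B.
      unfold eta in B at 2. rewrite cos_0, Rmult_1_r in B.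
      replace (eta c x) with (eta 0 x - c) by (unfold eta; ring).
      assert (g / 2 <= Rabs (eta 0 x - c)).
      { replace (eta 0 x - c) with ((eta 0 x - (ln 2 - 0)) - (c - c0) - (c0 - ln 2)) by ring.
        apply Rabs_def2 in B. apply Rabs_def2 in Hcd. revert B Hcd. clear. unfold g, Rabs.
        destruct (Rcase_abs (c0 - ln 2)); destruct (Rcase_abs _); lra. }
      rewrite <- (pow2_abs (eta 0 x - c)). pose proof (pow2_ge_0 x).
      apply Rle_trans with (Rabs (eta 0 x - c) ^ 2); [apply pow_incr; lra|lra].
    + apply Rle_trans with (r ^ 2); [apply Rmin_l|]. pose proof (pow2_ge_0 (eta c x)).
      pose proof (cond_pos r). assert (r ^ 2 <= x ^ 2) by (apply pow_incr; lra). lra.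
Qed.

Lemma Rabs_comb (p q u v : R) : Rabs p <= 1 -> Rabs q <= 1 -> Rabs (p * u + q * v) <= Rabs u + Rabs v.
Proof.
  intros Hp Hq. eapply Rle_trans; [apply Rabs_triang|]. rewrite !Rabs_mult.
  pose proof (Rabs_pos u). pose proof (Rabs_pos v). nra.
Qed.

Section Weights.
Context (p q : R -> R).
Context (Hp : forall x, Rabs (p x) <= 1) (Hq : forall x, Rabs (q x) <= 1).
Context (Hpd : forall x, ex_derive p x) (Hqd : forall x, ex_derive q x).

Lemma W1_bound (c x : R) : 0 < den c x -> Rabs (W1 p q c x) <= (Rabs (eta c x) + Rabs x) / den c x.
Proof.
  intros H. unfold W1, Rdiv. rewrite Rabs_mult, Rabs_inv, (Rabs_pos_eq (den c x)) by lra.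
  apply Rmult_le_compat_r; [left; now apply Rinv_0_lt_compat|]. now apply Rabs_comb.
Qed.

Lemma W2_bound (c x : R) : 0 < den c x -> Rabs (W2 p q c x) <= 2 / den c x.
Proof.
  intros H. unfold W2, Rdiv. rewrite Rabs_mult, Rabs_inv, (Rabs_pos_eq (den c x ^ 2)) by apply pow2_ge_0.
  replace (2 * / den c x) with (2 * den c x * / den c x ^ 2) by (field; lra).
  apply Rmult_le_compat_r; [left; apply Rinv_0_lt_compat, pow_lt, H|].
  eapply Rle_trans; [now apply Rabs_comb|]. unfold den.
  assert (Rabs (eta c x ^ 2 - x ^ 2) <= eta c x ^ 2 + x ^ 2) by (apply Rabs_le; split; nra).
  assert (Rabs (2 * eta c x * x) <= eta c x ^ 2 + x ^ 2).
  { pose proof (pow2_ge_0 (eta c x + x)). pose proof (pow2_ge_0 (eta c x - x)). apply Rabs_le; lra. }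
  lra.
Qed.

Lemma W3_bound (c x delta : R) : 0 < delta -> delta <= den c x -> Rabs (W3 p q c x) <= 8 / delta ^ 2 + 16 / delta.
Proof.
  intros H1 H2. assert (H : 0 < den c x) by lra.
  unfold W3, Rdiv. rewrite !Rabs_mult, Rabs_inv, (Rabs_pos_eq (den c x ^ 3)), (Rabs_pos_eq 2) by (try lra; left; now apply pow_lt).
  assert (B : Rabs (p x * (eta c x ^ 3 - 3 * eta c x * x ^ 2) + q x * (3 * eta c x ^ 2 * x - x ^ 3))
              <= 4 * den c x * (1 + 2 * den c x)).
  { eapply Rle_trans; [now apply Rabs_comb|].
    assert (E : forall u v, (Rabs (u ^ 3 - 3 * u * v ^ 2)) <= 2 * (u ^ 2 + v ^ 2) * (1 + 2 * (u ^ 2 + v ^ 2))).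
    { intros u v. replace (u ^ 3 - 3 * u * v ^ 2) with (u * (u ^ 2 - 3 * v ^ 2)) by ring.
      rewrite Rabs_mult.
      assert (Rabs (u ^ 2 - 3 * v ^ 2) <= 3 * (u ^ 2 + v ^ 2)) by (apply Rabs_le; split; nra).
      (* This keeps the estimate polynomial in [den]; it is why two powers of delta occur in the
         final bound. *)
      assert (Rabs u <= / 2 * (1 + u ^ 2)).
      { pose proof (pow2_ge_0 (u + 1)). pose proof (pow2_ge_0 (u - 1)). apply Rabs_le; lra. }
      pose proof (Rabs_pos u). pose proof (Rabs_pos (u ^ 2 - 3 * v ^ 2)). pose proof (pow2_ge_0 u). pose proof (pow2_ge_0 v).
      apply Rle_trans with (/ 2 * (1 + u ^ 2) * (3 * (u ^ 2 + v ^ 2))); [apply Rmult_le_compat; lra|].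
      set (s := u ^ 2 + v ^ 2) in *. assert (0 <= s * (s - u ^ 2)) by (apply Rmult_le_pos; unfold s; lra).
      assert (0 <= s * s) by (apply Rle_0_sqr). unfold s in *. lra. }
    pose proof (E (eta c x) x) as E1. pose proof (E x (eta c x)) as E2.
    replace (3 * eta c x ^ 2 * x - x ^ 3) with (- (x ^ 3 - 3 * x * eta c x ^ 2)) by ring. rewrite Rabs_Ropp.
    unfold den. replace (x ^ 2 + eta c x ^ 2) with (eta c x ^ 2 + x ^ 2) in E2 by ring. lra. }
  pose proof (Rinv_0_lt_compat _ H) as Hi.
  apply Rle_trans with (2 * (4 * den c x * (1 + 2 * den c x)) * / den c x ^ 3).
  - apply Rmult_le_compat_r; [left; apply Rinv_0_lt_compat, pow_lt, H|]. lra.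
  - replace (2 * (4 * den c x * (1 + 2 * den c x)) * / den c x ^ 3) with (8 * (/ den c x) ^ 2 + 16 * / den c x) by (field; lra).
    assert (/ den c x <= / delta) by (apply Rinv_le_contravar; lra).
    rewrite <- pow_inv. assert ((/ den c x) ^ 2 <= (/ delta) ^ 2) by (apply pow_incr; lra). lra.
Qed.

Lemma den_eta (c x : R) : eta c x ^ 2 <= den c x.
Proof. unfold den. pose proof (pow2_ge_0 x). lra. Qed.

Lemma W1_tail (c x : R) : 0 <= x < PI / 2 -> eta c x < - 2 -> Rabs (W1 p q c x) <= 2 / - eta c x.
Proof.
  intros Hx He. pose proof PI_4. pose proof (den_eta c x) as Hd.
  assert (0 < den c x) by nra. eapply Rle_trans; [now apply W1_bound|].
  rewrite (Rabs_left (eta c x)), (Rabs_pos_eq x) by lra.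
  apply Rle_trans with ((2 * - eta c x) / (eta c x ^ 2)).
  - unfold Rdiv. apply Rmult_le_compat; [lra|left; now apply Rinv_0_lt_compat|lra|].
    apply Rinv_le_contravar; [nra|easy].
  - right. field. lra.
Qed.

Lemma W2_tail (c x : R) : eta c x < - 2 -> Rabs (W2 p q c x) <= 2 / - eta c x.
Proof.
  intros He. pose proof (den_eta c x) as Hd. assert (0 < den c x) by nra.
  eapply Rle_trans; [now apply W2_bound|]. unfold Rdiv. apply Rmult_le_compat_l; [lra|].
  apply Rinv_le_contravar; nra.
Qed.

Lemma W1_continuous (c x : R) : 0 < cos x -> 0 < den c x -> continuous (W1 p q c) x.
Proof.
  intros Hx Hd. apply (ex_derive_continuous (V := R_NormedModule)). unfold W1, den, eta in *. auto_derive.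
  repeat split; auto; lra.
Qed.

Lemma W2_continuous (c x : R) : 0 < cos x -> 0 < den c x -> continuous (W2 p q c) x.
Proof.
  intros Hx Hd. apply (ex_derive_continuous (V := R_NormedModule)). unfold W2, den, eta in *. auto_derive.
  repeat split; auto; try lra. apply Rgt_not_eq.
  match goal with |- ?e > 0 => replace e with (((ln (2 * cos x) - c) ^ 2 + x ^ 2) ^ 2) by ring end. now apply pow_lt.
Qed.

Lemma W1_derive_c (c x : R) : 0 < den c x -> is_derive (fun c => W1 p q c x) c (W2 p q c x).
Proof.
  intros Hd. unfold W1, W2, den, eta in *. auto_derive; [lra|]. field. lra.
Qed.

Lemma W2_derive_c (c x : R) : 0 < den c x -> is_derive (fun c => W2 p q c x) c (W3 p q c x).
Proof.
  intros Hd. unfold W2, W3, den, eta in *. auto_derive.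
  - apply Rgt_not_eq.
    match goal with |- ?e > 0 => replace e with (((ln (2 * cos x) - c) ^ 2 + x ^ 2) ^ 2) by ring end. now apply pow_lt.
  - field. lra.
Qed.

Lemma ex_RInt_W1 (c : R) : c <> ln 2 -> ex_RInt (W1 p q c) 0 (PI / 2).
Proof.
  intros Hc. destruct (good_ex c Hc) as (d & delta & Hd & Hde & H).
  assert (D : forall x, 0 <= x < PI / 2 -> 0 < den c x).
  { intros x Hx. specialize (H c x). rewrite Rminus_diag, Rabs_R0 in H. specialize (H Hd Hx). lra. }
  apply ex_RInt_eta with c 2 2; [lra| |].
  - intros x Hx. apply W1_continuous; [now apply cos_pos_dom|auto].
  - intros x Hx. now apply W1_tail.
Qed.

Lemma ex_RInt_W2 (c : R) : c <> ln 2 -> ex_RInt (W2 p q c) 0 (PI / 2).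
Proof.
  intros Hc. destruct (good_ex c Hc) as (d & delta & Hd & Hde & H).
  assert (D : forall x, 0 <= x < PI / 2 -> 0 < den c x).
  { intros x Hx. specialize (H c x). rewrite Rminus_diag, Rabs_R0 in H. specialize (H Hd Hx). lra. }
  apply ex_RInt_eta with c 2 2; [lra| |].
  - intros x Hx. apply W2_continuous; [now apply cos_pos_dom|auto].
  - intros x Hx. now apply W2_tail.
Qed.

Lemma RInt_W1_derive (c : R) : c <> ln 2 ->
  is_derive (fun c => RInt (W1 p q c) 0 (PI / 2)) c (RInt (W2 p q c) 0 (PI / 2)).
Proof.
  intros Hc. pose proof PI_RGT_0 as Hpi. destruct (good_ex c Hc) as (d & delta & Hd & Hde & H).
  assert (Hl : 0 < Rabs (c - ln 2)) by (apply Rabs_pos_lt; lra).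
  apply (RInt_param_derive (W1 p q) (W2 p q) (W3 p q) c (Rmin d (Rabs (c - ln 2))) (8 / delta ^ 2 + 16 / delta)).
  - lra.
  - now apply Rmin_pos.
  - intros s x Hs Hx. apply W1_derive_c. assert (Hs' : Rabs (s - c) < d) by (eapply Rlt_le_trans; [apply Hs|apply Rmin_l]).
    specialize (H s x Hs' ltac:(lra)). lra.
  - intros s x Hs Hx. apply W2_derive_c. assert (Hs' : Rabs (s - c) < d) by (eapply Rlt_le_trans; [apply Hs|apply Rmin_l]).
    specialize (H s x Hs' ltac:(lra)). lra.
  - intros s x Hs Hx. apply W3_bound; [easy|]. apply H; [|lra]. eapply Rlt_le_trans; [apply Hs|apply Rmin_l].
  - intros s Hs. apply ex_RInt_W1. intros E. subst s.
    assert (Rabs (ln 2 - c) < Rabs (c - ln 2)) by (eapply Rlt_le_trans; [apply Hs|apply Rmin_r]).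
    rewrite Rabs_minus_sym in H0. lra.
  - now apply ex_RInt_W2.
Qed.
End Weights.

(** Cauchy's integral of cos^r x cos (u x); for r = u its classical value is PI / 2^(u + 1), which
    is the case needed. *)
Definition cosu (r u : R) : R := RInt (fun x => exp (r * ln (cos x)) * cos (u * x)) 0 (PI / 2).

(** * The mean of (1 + w)^s over the unit circle *)

Lemma exp_neg_le (t : R) : 0 < t -> exp (- t) <= / t.
Proof.
  intros H. rewrite exp_Ropp. apply Rinv_le_contravar; [easy|]. pose proof (exp_ineq1 t). lra.
Qed.

Lemma Rabs_cos_le (x : R) : Rabs (cos x) <= 1.
Proof. apply Rabs_le. pose proof (COS_bound x). lra. Qed.
Lemma Rabs_sin_le (x : R) : Rabs (sin x) <= 1.
Proof. apply Rabs_le. pose proof (SIN_bound x). lra. Qed.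

Lemma cosu_tail (r x : R) : 0 < r -> 0 <= x < PI / 2 -> eta 0 x < - 1 ->
  exp (r * ln (cos x)) <= / r / - eta 0 x.
Proof.
  intros Hr Hx He. pose proof (cos_pos_dom x Hx) as Hc.
  unfold eta in *. rewrite ln_mult in * by lra.
  assert (0 < ln 2) by (rewrite <- ln_1; apply ln_increasing; lra).
  apply Rle_trans with (exp (- (r * - (ln 2 + ln (cos x) - 0)))).
  - destruct (Req_dec (r * ln (cos x)) (- (r * - (ln 2 + ln (cos x) - 0)))) as [e|e]; [rewrite e; lra|].
    left. apply exp_increasing. nra.
  - eapply Rle_trans; [apply exp_neg_le; nra|]. right. field. split; nra.
Qed.

Lemma cosu_cont (r u x : R) : 0 < cos x -> continuous (fun x => exp (r * ln (cos x)) * cos (u * x)) x.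
Proof. intros H. apply (ex_derive_continuous (V := R_NormedModule)). auto_derive. lra. Qed.

Lemma ex_cosu (r u : R) : 0 < r -> ex_RInt (fun x => exp (r * ln (cos x)) * cos (u * x)) 0 (PI / 2).
Proof.
  intros Hr. apply ex_RInt_eta with 0 (/ r) 1; [lra| |].
  - intros x Hx. now apply cosu_cont, cos_pos_dom.
  - intros x Hx He. rewrite Rabs_mult, (Rabs_pos_eq (exp _)) by (left; apply exp_pos).
    pose proof (cosu_tail r x Hr Hx He). pose proof (Rabs_cos_le (u * x)). pose proof (Rabs_pos (cos (u * x))).
    pose proof (exp_pos (r * ln (cos x))). nra.
Qed.

Lemma exp_ln_cos2 (r x : R) : 0 < cos x -> exp ((r + 2) * ln (cos x)) = exp (r * ln (cos x)) * cos x ^ 2.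
Proof.
  intros H. replace ((r + 2) * ln (cos x)) with (r * ln (cos x) + (ln (cos x) + ln (cos x))) by ring.
  rewrite !exp_plus, exp_ln by easy. ring.
Qed.

Lemma cosu_rec (r u : R) : 0 < r ->
  ((r + 2) ^ 2 - u ^ 2) * cosu (r + 2) u = (r + 2) * (r + 1) * cosu r u.
Proof.
  intros Hr. pose proof PI_RGT_0 as Hpi.
  (* The boundary term of two integrations by parts; in its derivative the products sin x sin (u x)
     cancel. *)
  pose (G := fun x => exp (r * ln (cos x)) * (- (r + 2) * cos x * sin x * cos (u * x) + u * cos x ^ 2 * sin (u * x))).
  pose (f := fun x => (r + 2) * (r + 1) * (exp (r * ln (cos x)) * cos (u * x))
                      - ((r + 2) ^ 2 - u ^ 2) * (exp ((r + 2) * ln (cos x)) * cos (u * x))).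
  assert (H1 := ex_cosu r u Hr). assert (H2 := ex_cosu (r + 2) u ltac:(lra)).
  assert (E : is_RInt f 0 (PI / 2) (0 - G 0)).
  { pose (C := (r + 2 + Rabs u) * / r). pose (C' := (Rabs ((r + 2) * (r + 1)) + Rabs ((r + 2) ^ 2 - u ^ 2)) * / r).
    apply is_RInt_eta with 0 C' 1 C 1; try lra.
    - intros x Hx. pose proof (cos_pos_dom x Hx) as Hc. unfold f.
      apply (continuous_minus (V := R_NormedModule)); apply (continuous_scal_r (V := R_NormedModule)); now apply cosu_cont.
    - intros x Hx He. pose proof (cosu_tail r x Hr Hx He) as B. pose proof (cos_pos_dom x Hx) as Hc.
      unfold f. rewrite exp_ln_cos2 by easy.
      pose proof (exp_pos (r * ln (cos x))) as Hp. set (e := exp (r * ln (cos x))) in *.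
      replace (_ - _) with (e * ((r + 2) * (r + 1) * cos (u * x) + - ((r + 2) ^ 2 - u ^ 2) * (cos x ^ 2 * cos (u * x)))) by ring.
      rewrite Rabs_mult, (Rabs_pos_eq e) by lra.
      assert (Hb : Rabs ((r + 2) * (r + 1) * cos (u * x) + - ((r + 2) ^ 2 - u ^ 2) * (cos x ^ 2 * cos (u * x)))
                   <= Rabs ((r + 2) * (r + 1)) + Rabs ((r + 2) ^ 2 - u ^ 2)).
      { eapply Rle_trans; [apply Rabs_triang|]. rewrite (Rabs_mult ((r + 2) * (r + 1))), (Rabs_mult (- _)), Rabs_Ropp.
        pose proof (Rabs_cos_le (u * x)). pose proof (Rabs_pos (cos (u * x))).
        assert (Rabs (cos x ^ 2 * cos (u * x)) <= 1).
        { rewrite Rabs_mult, Rabs_pos_eq by apply pow2_ge_0. pose proof (COS_bound x). nra. }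
        pose proof (Rabs_pos ((r + 2) * (r + 1))). pose proof (Rabs_pos ((r + 2) ^ 2 - u ^ 2)). nra. }
      apply Rle_trans with (/ r / - eta 0 x * (Rabs ((r + 2) * (r + 1)) + Rabs ((r + 2) ^ 2 - u ^ 2))).
      + apply Rmult_le_compat; auto using Rabs_pos. lra.
      + right. unfold C', Rdiv. ring.
    - intros x Hx. pose proof (cos_pos_dom x Hx) as Hc. unfold G, f. rewrite exp_ln_cos2 by easy.
      auto_derive; [easy|]. pose proof (sin2_cos2 x) as S. unfold Rsqr in S.
      set (e := exp _). set (k := cos x) in *. set (s := sin x) in *. set (cu := cos (u * x)). set (su := sin (u * x)).
      transitivity (e * ((r * (r + 2) * (s * s) - (r + 2) * (k * k) + (r + 2) * (s * s) + u ^ 2 * (k * k)) * cu)); [field; lra|].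
      replace (s * s) with (1 - k * k) by lra. ring.
    - intros x Hx He. pose proof (cosu_tail r x Hr Hx He) as B. pose proof (cos_pos_dom x Hx) as Hc.
      unfold G. pose proof (exp_pos (r * ln (cos x))) as Hp. set (e := exp (r * ln (cos x))) in *.
      rewrite Rabs_mult, (Rabs_pos_eq e) by lra.
      assert (Hb : Rabs (- (r + 2) * cos x * sin x * cos (u * x) + u * cos x ^ 2 * sin (u * x)) <= r + 2 + Rabs u).
      { eapply Rle_trans; [apply Rabs_triang|]. rewrite !Rabs_mult, Rabs_Ropp, (Rabs_pos_eq (r + 2)) by lra.
        pose proof (Rabs_cos_le (u * x)). pose proof (Rabs_sin_le (u * x)). pose proof (Rabs_sin_le x). pose proof (Rabs_cos_le x).
        pose proof (Rabs_pos (cos (u * x))). pose proof (Rabs_pos (sin (u * x))). pose proof (Rabs_pos (sin x)).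
        pose proof (Rabs_pos (cos x)). rewrite (Rabs_pos_eq (cos x ^ 2)) by apply pow2_ge_0.
        pose proof (COS_bound x). assert (0 <= cos x ^ 2 <= 1) by (split; [apply pow2_ge_0|nra]).
        assert (Rabs (cos x) * Rabs (sin x) <= 1) by nra. assert (0 <= Rabs (cos x) * Rabs (sin x)) by nra.
        assert (Rabs (cos x) * Rabs (sin x) * Rabs (cos (u * x)) <= 1) by nra.
        assert (cos x ^ 2 * Rabs (sin (u * x)) <= 1) by nra. pose proof (Rabs_pos u).
        apply Rplus_le_compat; nra. }
      apply Rle_trans with (/ r / - eta 0 x * (r + 2 + Rabs u)).
      + apply Rmult_le_compat; auto using Rabs_pos. lra.
      + right. unfold C, Rdiv. ring. }
  assert (E2 : is_RInt f 0 (PI / 2) ((r + 2) * (r + 1) * cosu r u - ((r + 2) ^ 2 - u ^ 2) * cosu (r + 2) u)).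
  { unfold f. apply (is_RInt_minus (V := R_NormedModule)); apply (is_RInt_scal (V := R_NormedModule));
      now apply (RInt_correct (V := R_CompleteNormedModule)). }
  apply (is_RInt_unique (V := R_CompleteNormedModule)) in E. apply (is_RInt_unique (V := R_CompleteNormedModule)) in E2. rewrite E in E2.
  assert (G 0 = 0) by (unfold G; rewrite Rmult_0_r, sin_0; ring). lra.
Qed.

Lemma cosu_0 : cosu 0 0 = PI / 2.
Proof.
  unfold cosu. rewrite (RInt_ext _ (fun _ => 1)).
  - rewrite RInt_const. unfold scal; simpl. unfold mult; simpl. ring.
  - intros x _. rewrite !Rmult_0_l, exp_0, cos_0. toR. ring.
Qed.

Lemma cosu_2 : cosu 2 0 = PI / 4.
Proof.
  pose proof PI_RGT_0 as Hpi.
  unfold cosu. rewrite (RInt_ext _ (fun x => cos x ^ 2)).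
  - apply is_RInt_unique. apply (is_RInt_FTC (fun x => (x + sin x * cos x) / 2)); [lra| | |].
    + intros x _. auto_derive; [easy|]. pose proof (sin2_cos2 x) as S. unfold Rsqr in S. nra.
    + intros x _. apply (ex_derive_continuous (V := R_NormedModule)). auto_derive. easy.
    + rewrite cos_PI2, sin_0. field.
  - intros x. rewrite Rmin_left, Rmax_right by lra. intros Hx.
    replace 2 with (0 + 2) at 1 by ring. rewrite exp_ln_cos2 by (apply cos_pos_dom; lra).
    rewrite !Rmult_0_l, exp_0, cos_0. toR. ring.
Qed.

Lemma cosu_rec_n (u : R) (n : nat) : 0 <= u ->
  4 * (INR n + 1) * (INR n + 1 + u) * cosu (u + 2 * INR (S n)) u
  = (u + 2 * INR n + 2) * (u + 2 * INR n + 1) * cosu (u + 2 * INR n) u.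
Proof.
  intros Hu. rewrite S_INR. pose proof (pos_INR n).
  (* [cosu_rec] requires a positive exponent. The exponent vanishes only for u = 0 and n = 0,
     settled by two explicit values. *)
  destruct (Req_dec (u + 2 * INR n) 0) as [e|e].
  - assert (u = 0) by lra. assert (INR n = 0) by lra. subst u. rewrite H1.
    replace (0 + 2 * (0 + 1)) with 2 by ring. replace (0 + 2 * 0) with 0 by ring.
    rewrite cosu_2, cosu_0. field.
  - pose proof (cosu_rec (u + 2 * INR n) u ltac:(lra)) as E.
    replace (u + 2 * (INR n + 1)) with (u + 2 * INR n + 2) by ring. lra.
Qed.

(** The product of 1 + u/i for i from m + 1 to m + l. For m = l = n it tends to 2^u, the origin of
    the factor [exp (u * ln 2)] in [cosu_value]. *)
Fixpoint riseq (u m : R) (l : nat) : R :=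
  match l with O => 1 | S l => riseq u m l * (1 + u / (m + INR (S l))) end.

Lemma riseq_shift (u m : R) (l : nat) : 0 <= m -> riseq u (m + 1) l * (1 + u / (m + 1)) = riseq u m (S l).
Proof.
  intros Hm. induction l as [|l IH]; [simpl; ring|].
  change (riseq u m (S (S l))) with (riseq u m (S l) * (1 + u / (m + INR (S (S l))))).
  rewrite <- IH. change (riseq u (m + 1) (S l)) with (riseq u (m + 1) l * (1 + u / (m + 1 + INR (S l)))).
  replace (m + INR (S (S l))) with (m + 1 + INR (S l)) by (rewrite (S_INR (S l)); ring). ring.
Qed.

Lemma riseq_step (u : R) (n : nat) : 0 <= u ->
  riseq u (INR (S n)) (S n) * (1 + u / (INR n + 1))
  = riseq u (INR n) n * (1 + u / (2 * INR n + 1)) * (1 + u / (2 * INR n + 2)).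
Proof.
  intros Hu. pose proof (pos_INR n). rewrite (S_INR n), riseq_shift by easy. cbn [riseq].
  rewrite !S_INR. replace (INR n + (INR n + 1)) with (2 * INR n + 1) by ring.
  replace (INR n + (INR n + 1 + 1)) with (2 * INR n + 2) by ring. reflexivity.
Qed.

Lemma riseq_pos (u m : R) (l : nat) : 0 <= u -> 0 <= m -> 0 < riseq u m l.
Proof.
  intros Hu Hm. induction l as [|l IH]; [simpl; lra|]. cbn [riseq]. apply Rmult_lt_0_compat; [easy|].
  pose proof (lt_0_INR (S l) ltac:(lia)). assert (0 <= u / (m + INR (S l))); [|lra].
  unfold Rdiv. apply Rmult_le_pos; [easy|]. left. apply Rinv_0_lt_compat. lra.
Qed.

Lemma ln_le_sub (x : R) : 0 < x -> ln x <= x - 1.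
Proof. intros H. pose proof (exp_ineq1_le (ln x)). rewrite exp_ln in H0 by easy. lra. Qed.

Lemma exp_le (x y : R) : x <= y -> exp x <= exp y.
Proof. intros [h| ->]; [left; now apply exp_increasing|lra]. Qed.

(** Each factor satisfies ((i + 1)/i)^u <= 1 + u/i <= (i/(i - 1))^u, and both outer products
    telescope. The left inequality, for u <= 1, gives [riseq_lower]. *)
Lemma riseq_upper (u m : R) (l : nat) : 0 <= u -> 0 < m -> riseq u m l <= exp (u * ln ((m + INR l) / m)).
Proof.
  intros Hu Hm. induction l as [|l IH].
  - simpl. replace ((m + 0) / m) with 1 by (field; lra). rewrite ln_1, Rmult_0_r, exp_0. lra.
  - cbn [riseq]. rewrite S_INR. pose proof (pos_INR l).
    replace ((m + (INR l + 1)) / m) with ((m + INR l) / m * ((m + (INR l + 1)) / (m + INR l))) by (field; lra).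
    assert (0 < (m + INR l) / m) by (apply Rdiv_lt_0_compat; lra).
    assert (0 < (m + (INR l + 1)) / (m + INR l)) by (apply Rdiv_lt_0_compat; lra).
    rewrite ln_mult, (Rmult_plus_distr_l u), exp_plus by easy.
    apply Rmult_le_compat; [left; apply riseq_pos; lra| |easy|].
    + assert (0 <= u / (m + (INR l + 1))); [|lra].
      unfold Rdiv. apply Rmult_le_pos; [easy|]. left. apply Rinv_0_lt_compat. lra.
    + eapply Rle_trans; [apply exp_ineq1_le|]. apply exp_le. unfold Rdiv at 1.
      apply Rmult_le_compat_l; [easy|].
      pose proof (ln_le_sub ((m + INR l) / (m + (INR l + 1))) ltac:(apply Rdiv_lt_0_compat; lra)) as L.
      replace ((m + (INR l + 1)) / (m + INR l)) with (/ ((m + INR l) / (m + (INR l + 1)))) by (field; lra).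
      rewrite ln_Rinv by (apply Rdiv_lt_0_compat; lra).
      replace (/ (m + (INR l + 1))) with (1 - (m + INR l) / (m + (INR l + 1))) by (field; lra). lra.
Qed.

(* Concavity of the logarithm on [1, 1 + t], in exponential form. *)
Lemma Bernoulli_exp (u t : R) : 0 <= u <= 1 -> 0 <= t -> exp (u * ln (1 + t)) <= 1 + u * t.
Proof.
  intros Hu Ht. destruct (Req_dec t 0) as [->|h0]; [rewrite Rplus_0_r, ln_1, Rmult_0_r, exp_0; lra|].
  pose (f := fun t => 1 + u * t - exp (u * ln (1 + t))).
  destruct (MVT_gen f 0 t (fun x => u - u / (1 + x) * exp (u * ln (1 + x)))) as [c [Hc E]].
  - intros x. rewrite Rmin_left, Rmax_right by lra. intros Hx. unfold f. auto_derive; [lra|]. field. lra.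
  - intros x. rewrite Rmin_left, Rmax_right by lra. intros Hx. apply continuity_pt_filterlim.
    apply (ex_derive_continuous (V := R_NormedModule)). unfold f. auto_derive. lra.
  - rewrite Rmin_left, Rmax_right in Hc by lra. unfold f in E at 2. rewrite Rplus_0_r, ln_1, !Rmult_0_r, exp_0 in E.
    assert (exp (u * ln (1 + c)) <= 1 + c).
    { rewrite <- (exp_ln (1 + c)) at 2 by lra. apply exp_le.
      assert (0 <= ln (1 + c)) by (rewrite <- ln_1; destruct (Req_dec c 0) as [->|]; [rewrite Rplus_0_r; lra|]; left; apply ln_increasing; lra).
      nra. }
    assert (u / (1 + c) * exp (u * ln (1 + c)) <= u).
    { apply Rle_trans with (u / (1 + c) * (1 + c)); [|right; field; lra].
      apply Rmult_le_compat_l; [|easy]. unfold Rdiv. apply Rmult_le_pos; [lra|]. left; apply Rinv_0_lt_compat; lra. }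
    unfold f in E. nra.
Qed.

Lemma riseq_lower (u m : R) (l : nat) : 0 <= u <= 1 -> 0 <= m -> exp (u * ln ((m + INR l + 1) / (m + 1))) <= riseq u m l.
Proof.
  intros Hu Hm. induction l as [|l IH].
  - simpl. replace ((m + 0 + 1) / (m + 1)) with 1 by (field; lra). rewrite ln_1, Rmult_0_r, exp_0. lra.
  - cbn [riseq]. rewrite S_INR. pose proof (pos_INR l).
    replace ((m + (INR l + 1) + 1) / (m + 1)) with ((m + INR l + 1) / (m + 1) * (1 + / (m + (INR l + 1)))) by (field; lra).
    pose proof (Rinv_0_lt_compat (m + (INR l + 1)) ltac:(lra)) as Hi.
    assert (0 < (m + INR l + 1) / (m + 1)) by (apply Rdiv_lt_0_compat; lra).
    rewrite ln_mult, (Rmult_plus_distr_l u), exp_plus by lra.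
    apply Rmult_le_compat; [left; apply exp_pos|left; apply exp_pos|easy|].
    apply Bernoulli_exp; lra.
Qed.

(** Dividing the recurrence of [cosu_rec_n] by its case u = 0 leaves exactly the factor by which
    [riseq] changes in [riseq_step]. *)
Lemma cosu_riseq (u : R) (n : nat) : 0 <= u ->
  cosu (u + 2 * INR n) u * (PI / 2) = cosu u u * cosu (2 * INR n) 0 * riseq u (INR n) n.
Proof.
  intros Hu. induction n as [|n IH].
  - simpl INR. rewrite Rmult_0_r, Rplus_0_r, cosu_0. simpl. ring.
  - pose proof (cosu_rec_n u n Hu) as E1. pose proof (cosu_rec_n 0 n ltac:(lra)) as E2.
    rewrite !Rplus_0_l in E2. rewrite Rplus_0_r in E2.
    pose proof (riseq_step u n Hu) as E3. pose proof (pos_INR n) as Hn.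
    set (k1 := cosu (u + 2 * INR (S n)) u) in *. set (k0 := cosu (u + 2 * INR n) u) in *.
    set (z1 := cosu (2 * INR (S n)) 0) in *. set (z0 := cosu (2 * INR n) 0) in *.
    set (q1 := riseq u (INR (S n)) (S n)) in *. set (q0 := riseq u (INR n) n) in *. set (N := INR n) in *.
    assert (Ek : k1 = (u + 2 * N + 2) * (u + 2 * N + 1) * k0 / (4 * (N + 1) * (N + 1 + u))) by (rewrite <- E1; field; lra).
    assert (Ez : z1 = (2 * N + 2) * (2 * N + 1) * z0 / (4 * (N + 1) * (N + 1))) by (rewrite <- E2; field; lra).
    assert (Eq : q1 = q0 * (1 + u / (2 * N + 1)) * (1 + u / (2 * N + 2)) / (1 + u / (N + 1))).
    { rewrite <- E3. field. lra. }
    rewrite Ek, Ez, Eq.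
    transitivity ((u + 2 * N + 2) * (u + 2 * N + 1) / (4 * (N + 1) * (N + 1 + u)) * (k0 * (PI / 2))); [field; lra|].
    rewrite IH. field. lra.
Qed.

(** For 0 <= u <= 1 both cos^u x and cos (u x) lie between cos x and 1, so the integrand is caught
    between cos^(2n+2) and cos^(2n). *)
Lemma cosu_bounds (u : R) (n : nat) : 0 <= u <= 1 -> (1 <= n)%nat ->
  cosu (2 * INR (S n)) 0 <= cosu (u + 2 * INR n) u <= cosu (2 * INR n) 0.
Proof.
  intros Hu Hn. pose proof PI_RGT_0 as Hpi. pose proof (le_INR 1 n Hn) as Hn'. simpl in Hn'.
  assert (B : forall x, 0 < x < PI / 2 -> 0 < cos x <= 1 /\ ln (cos x) <= 0 /\ cos x <= cos (u * x) <= 1).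
  { intros x Hx. pose proof (cos_pos_dom x ltac:(lra)). pose proof (COS_bound x). pose proof (COS_bound (u * x)).
    split; [lra|]. split; [pose proof (ln_le_sub (cos x) H); lra|]. split; [|lra].
    destruct (Req_dec (u * x) x) as [->|h]; [lra|].
    left. apply cos_decreasing_1; nra. }
  split; (apply RInt_le; [lra| | |]).
  1: apply ex_cosu; rewrite S_INR; lra. 1: apply ex_cosu; lra.
  2: apply ex_cosu; lra. 2: apply ex_cosu; lra.
  - intros x Hx. destruct (B x Hx) as (B1 & B2 & B3). rewrite Rmult_0_l, cos_0, Rmult_1_r.
    replace (2 * INR (S n)) with (2 * INR n + 2) by (rewrite S_INR; ring). rewrite exp_ln_cos2 by lra.
    rewrite Rmult_plus_distr_r, exp_plus.
    assert (cos x <= exp (u * ln (cos x))).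
    { rewrite <- (exp_ln (cos x)) at 1 by lra. apply exp_le. nra. }
    pose proof (exp_pos (2 * INR n * ln (cos x))).
    assert (cos x ^ 2 <= exp (u * ln (cos x)) * cos (u * x)) by nra. nra.
  - intros x Hx. destruct (B x Hx) as (B1 & B2 & B3). rewrite Rmult_0_l, cos_0, Rmult_1_r.
    rewrite Rmult_plus_distr_r, exp_plus.
    assert (exp (u * ln (cos x)) <= 1) by (rewrite <- exp_0; apply exp_le; nra).
    pose proof (exp_pos (2 * INR n * ln (cos x))). pose proof (exp_pos (u * ln (cos x))).
    assert (exp (u * ln (cos x)) * cos (u * x) <= 1) by nra. nra.
Qed.

Lemma cosu_even_pos (n : nat) : 0 < cosu (2 * INR n) 0.
Proof.
  induction n as [|n IH].
  - simpl INR. rewrite Rmult_0_r, cosu_0. pose proof PI_RGT_0. lra.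
  - pose proof (cosu_rec_n 0 n ltac:(lra)) as E. rewrite !Rplus_0_l in E. rewrite Rplus_0_r in E.
    pose proof (pos_INR n). assert (0 < (2 * INR n + 2) * (2 * INR n + 1) * cosu (2 * INR n) 0) by (repeat apply Rmult_lt_0_compat; lra).
    rewrite <- E in H0. assert (0 < 4 * (INR n + 1) * (INR n + 1)) by (repeat apply Rmult_lt_0_compat; lra). nra.
Qed.

Lemma is_lim_seq_inv_S : is_lim_seq (fun n => / (INR n + 1)) 0.
Proof.
  apply is_lim_seq_ext with (fun n => / INR (S n)); [intros n; now rewrite S_INR|].
  apply (is_lim_seq_incr_1 (fun n => / INR n)).
  replace (Finite 0) with (Rbar_inv p_infty) by easy. apply is_lim_seq_inv; [apply is_lim_seq_INR|easy].
Qed.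

(* The recurrence reduces [cosu u u] to large exponents, where the weight cos^(2n) squeezes the ratio with the case u = 0. *)
Lemma cosu_value (u : R) : 0 <= u <= 1 -> cosu u u * exp (u * ln 2) = PI / 2.
Proof.
  intros Hu. pose proof PI_RGT_0 as Hpi.
  assert (L1 : is_lim_seq (fun n => riseq u (INR n) n) (exp (u * ln 2))).
  { apply is_lim_seq_le_le_loc with (fun n => exp (u * ln (2 - / (INR n + 1)))) (fun _ => exp (u * ln 2)).
    - exists 1%nat. intros n Hn. pose proof (le_INR 1 n Hn) as Hn'. simpl in Hn'. split.
      + replace (2 - / (INR n + 1)) with ((INR n + INR n + 1) / (INR n + 1)) by (field; lra).
        apply riseq_lower; lra.
      + replace 2 with ((INR n + INR n) / INR n) by (field; lra). apply riseq_upper; lra.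
    - replace (Finite (exp (u * ln 2))) with (Finite (exp (u * ln (2 - 0)))) by (now rewrite Rminus_0_r).
      apply (is_lim_seq_continuous (fun y => exp (u * ln (2 - y))) (fun n => / (INR n + 1)) 0); [|apply is_lim_seq_inv_S].
      apply continuity_pt_filterlim.
      apply (ex_derive_continuous (V := R_NormedModule) (fun y => exp (u * ln (2 - y))) 0). auto_derive. lra.
    - apply is_lim_seq_const. }
  assert (L2 : is_lim_seq (fun n => cosu u u * riseq u (INR n) n) (PI / 2)).
  (* The factor is (2n + 1)/(2n + 2), the ratio of consecutive even Wallis integrals. *)
  { apply is_lim_seq_le_le_loc with (fun n => (1 - / 2 * / (INR n + 1)) * (PI / 2)) (fun _ => PI / 2).
    - exists 1%nat. intros n Hn. pose proof (cosu_bounds u n Hu Hn) as [B1 B2].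
      pose proof (cosu_riseq u n ltac:(lra)) as E. pose proof (cosu_even_pos n) as Hz. pose proof (pos_INR n).
      pose proof (cosu_rec_n 0 n ltac:(lra)) as E2. rewrite !Rplus_0_l in E2. rewrite Rplus_0_r in E2.
      set (z := cosu (2 * INR n) 0) in *.
      assert (Ez : cosu (2 * INR (S n)) 0 = (1 - / 2 * / (INR n + 1)) * z).
      { apply (Rmult_eq_reg_l (4 * (INR n + 1) * (INR n + 1))); [rewrite E2; field; lra|nra]. }
      rewrite Ez in B1. set (X := riseq u (INR n) n) in *.
      split; apply Rmult_le_reg_r with z; try easy; nra.
    - replace (Finite (PI / 2)) with (Finite ((1 - / 2 * 0) * (PI / 2))) by (f_equal; field).
      apply is_lim_seq_mult'; [|apply is_lim_seq_const].
      apply is_lim_seq_minus'; [apply is_lim_seq_const|]. apply is_lim_seq_mult'; [apply is_lim_seq_const|apply is_lim_seq_inv_S].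
    - apply is_lim_seq_const. }
  pose proof (is_lim_seq_mult' _ _ _ _ (is_lim_seq_const (cosu u u)) L1) as L3.
  apply is_lim_seq_unique in L2. apply is_lim_seq_unique in L3. rewrite L2 in L3. now injection L3.
Qed.

(** The integrand is the real part of exp (s z) = (1 + w)^s, whose mean over the circle is its value
    1 at w = 0. *)
Lemma mean_power (s : R) : 0 <= s <= 1 -> 
  RInt (fun x => exp (s * ln (2 * cos x)) * cos (s * x)) 0 (PI / 2) = PI / 2.
Proof.
  intros Hs. pose proof PI_RGT_0 as Hpi. transitivity (cosu s s * exp (s * ln 2)); [|now apply cosu_value].
  unfold cosu.
  assert (Hex : ex_RInt (fun x => exp (s * ln (cos x)) * cos (s * x)) 0 (PI / 2)).
  { destruct (Req_dec s 0) as [->|h]; [|apply ex_cosu; lra].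
    apply ex_RInt_ext with (fun _ => 1); [|apply ex_RInt_const].
    intros x _. rewrite !Rmult_0_l, exp_0, cos_0. toR. ring. }
  rewrite Rmult_comm. match goal with |- _ = ?a * RInt ?f ?b ?c => change (a * RInt f b c) with (scal a (RInt f b c)) end.
  rewrite <- (RInt_scal (V := R_CompleteNormedModule)) by easy.
  apply RInt_ext. intros x. rewrite Rmin_left, Rmax_right by lra. intros Hx.
  pose proof (cos_pos_dom x ltac:(lra)).
  rewrite ln_mult, Rmult_plus_distr_l, exp_plus by lra. unfold scal; simpl. unfold mult; simpl. toR. ring.
Qed.

(** * Fourier coefficients of 1/(ln (1 + w) - c) *)

Definition wcos (x : R) : R := cos (2 * x).
Definition wsin (x : R) : R := sin (2 * x).
Definition wnsin (x : R) : R := - sin (2 * x).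
Definition cst1 (x : R) : R := 1.
Definition cst0 (x : R) : R := 0.

(* Fourier coefficients, up to the factor 2 / PI, of 1/(ln (1 + w) - c) on the circle |w| = 1, against 1, w and 1/w. *)
Definition fc0 (c : R) : R := RInt (W1 cst1 cst0 c) 0 (PI / 2).
Definition fc1 (c : R) : R := RInt (W1 wcos wsin c) 0 (PI / 2).
Definition fcm (c : R) : R := RInt (W1 wcos wnsin c) 0 (PI / 2).

Lemma wcos_bound (x : R) : Rabs (wcos x) <= 1. Proof. apply Rabs_cos_le. Qed.
Lemma wsin_bound (x : R) : Rabs (wsin x) <= 1. Proof. apply Rabs_sin_le. Qed.
Lemma wnsin_bound (x : R) : Rabs (wnsin x) <= 1. Proof. unfold wnsin. rewrite Rabs_Ropp. apply Rabs_sin_le. Qed.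
Lemma cst1_bound (x : R) : Rabs (cst1 x) <= 1. Proof. unfold cst1. rewrite Rabs_R1. lra. Qed.
Lemma cst0_bound (x : R) : Rabs (cst0 x) <= 1. Proof. unfold cst0. rewrite Rabs_R0. lra. Qed.
Lemma wcos_diff (x : R) : ex_derive wcos x. Proof. unfold wcos. now auto_derive. Qed.
Lemma wsin_diff (x : R) : ex_derive wsin x. Proof. unfold wsin. now auto_derive. Qed.
Lemma wnsin_diff (x : R) : ex_derive wnsin x. Proof. unfold wnsin. now auto_derive. Qed.
Lemma cst1_diff (x : R) : ex_derive cst1 x. Proof. apply ex_derive_const. Qed.
Lemma cst0_diff (x : R) : ex_derive cst0 x. Proof. apply ex_derive_const. Qed.
Local Hint Resolve wcos_bound wsin_bound wnsin_bound cst1_bound cst0_bound wcos_diff wsin_diff wnsin_diff cst1_diff cst0_diff : core.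

Lemma den_pos (c x : R) : c <> ln 2 -> 0 <= x < PI / 2 -> 0 < den c x.
Proof.
  intros Hc Hx. destruct (good_ex c Hc) as (d & delta & Hd & Hde & H).
  specialize (H c x). rewrite Rminus_diag, Rabs_R0 in H. specialize (H Hd Hx). lra.
Qed.

Lemma trig2 (x : R) : wcos x = cos x ^ 2 - sin x ^ 2 /\ wsin x = 2 * sin x * cos x /\ wnsin x = - (2 * sin x * cos x)
  /\ cos x ^ 2 + sin x ^ 2 = 1.
Proof.
  unfold wcos, wsin, wnsin. rewrite cos_2a, sin_2a. pose proof (sin2_cos2 x) as E. unfold Rsqr in E.
  repeat split; try ring. lra.
Qed.

Lemma Rabs_cos_sin_le_1 (x : R) : Rabs (cos x * sin x) <= 1.
Proof.
  rewrite Rabs_mult. pose proof (Rabs_cos_le x). pose proof (Rabs_sin_le x).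
  pose proof (Rabs_pos (cos x)). pose proof (Rabs_pos (sin x)). nra.
Qed.
Lemma Rabs_cos_sqr_le_1 (x : R) : Rabs (cos x ^ 2) <= 1.
Proof.
  rewrite Rabs_pos_eq by apply pow2_ge_0. pose proof (COS_bound x). nra.
Qed.

(* With w = exp (2 i x): d/dx ((1 + w)/(z - c)) = 2 i (w/(z - c) - w/(z - c)^2), and the imaginary part of
   (1 + w)/(z - c) vanishes at both ends. *)
Lemma fc1_derive (c : R) : c <> ln 2 -> is_derive fc1 c (fc1 c).
Proof.
  intros Hc. pose proof PI_RGT_0 as Hpi.
  assert (E : is_RInt (fun x => W1 wcos wsin c x - W2 wcos wsin c x) 0 (PI / 2)
     (0 - W1 (fun x => cos x * sin x) (fun x => - cos x ^ 2) c 0)).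
  { apply is_RInt_eta with c 4 2 2 2; try lra.
    - intros x Hx. pose proof (den_pos c x Hc Hx). pose proof (cos_pos_dom x Hx).
      apply (continuous_minus (V := R_NormedModule)); [apply W1_continuous|apply W2_continuous]; auto.
    - intros x Hx He. unfold Rminus at 1. eapply Rle_trans; [apply Rabs_triang|]. rewrite Rabs_Ropp.
      pose proof (W1_tail wcos wsin wcos_bound wsin_bound c x Hx He).
      pose proof (W2_tail wcos wsin wcos_bound wsin_bound c x He).
      replace (4 / - eta c x) with (2 / - eta c x + 2 / - eta c x) by (field; lra). lra.
    - intros x Hx. pose proof (den_pos c x Hc Hx) as Hd. pose proof (cos_pos_dom x Hx) as Hcos.
      destruct (trig2 x) as (T1 & T2 & _ & T4). unfold W1, W2. rewrite T1, T2.
      unfold den, eta in *. auto_derive; [lra|].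
      set (e := ln (2 * cos x) - c) in *. replace (ln (2 * cos x) + - c) with e by (unfold e; ring).
      set (k := cos x) in *. set (s := sin x) in *.
      set (D := e ^ 2 + x ^ 2) in *.
      replace (e * (e * 1) + x * (x * 1)) with D by (unfold D; ring).
      transitivity (((e * (k ^ 2 - s ^ 2) + 2 * x * s * k - (k ^ 2 + s ^ 2)) * D + 2 * (e * s - x * k) ^ 2) / D ^ 2).
      + field. lra.
      + rewrite T4. apply Rminus_diag_uniq.
        transitivity (D * (1 - (k ^ 2 + s ^ 2)) / D ^ 2 - (D * (1 - (k ^ 2 + s ^ 2)) / D ^ 2) + (2 * (e * s - x * k) ^ 2 - D + ((k ^ 2 - s ^ 2) * (e ^ 2 - x ^ 2) + 4 * s * k * e * x)) / D ^ 2).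
        * field. lra.
        * replace (2 * (e * s - x * k) ^ 2 - D + ((k ^ 2 - s ^ 2) * (e ^ 2 - x ^ 2) + 4 * s * k * e * x))
            with (D * ((k ^ 2 + s ^ 2) - 1)) by (unfold D; ring). rewrite T4. unfold Rdiv. ring.
    - intros x Hx He. apply W1_tail; auto.
      + apply Rabs_cos_sin_le_1.
      + intros y. rewrite Rabs_Ropp. apply Rabs_cos_sqr_le_1. }
  assert (E2 : is_RInt (fun x => W1 wcos wsin c x - W2 wcos wsin c x) 0 (PI / 2) (fc1 c - RInt (W2 wcos wsin c) 0 (PI / 2))).
  { apply (is_RInt_minus (V := R_NormedModule)); apply (RInt_correct (V := R_CompleteNormedModule));
      [apply ex_RInt_W1|apply ex_RInt_W2]; auto. }
  apply (is_RInt_unique (V := R_CompleteNormedModule)) in E. apply (is_RInt_unique (V := R_CompleteNormedModule)) in E2.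
  rewrite E in E2. unfold W1 at 1 in E2. rewrite sin_0 in E2.
  replace (fc1 c) with (RInt (W2 wcos wsin c) 0 (PI / 2)) by (unfold Rdiv in E2; lra).
  apply RInt_W1_derive; auto.
Qed.

(* Same argument with d/dx ((1 + 1/w)/(z - c)) = - 2 i ((1/w)/(z - c) + 1/(z - c)^2). *)
Lemma fc0_derive (c : R) : c <> ln 2 -> is_derive fc0 c (- fcm c).
Proof.
  intros Hc. pose proof PI_RGT_0 as Hpi.
  assert (E : is_RInt (fun x => W1 wcos wnsin c x + W2 cst1 cst0 c x) 0 (PI / 2)
     (0 - W1 (fun x => cos x * sin x) (fun x => cos x ^ 2) c 0)).
  { apply is_RInt_eta with c 4 2 2 2; try lra.
    - intros x Hx. pose proof (den_pos c x Hc Hx). pose proof (cos_pos_dom x Hx).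
      apply (continuous_plus (V := R_NormedModule)); [apply W1_continuous|apply W2_continuous]; auto.
    - intros x Hx He. eapply Rle_trans; [apply Rabs_triang|].
      pose proof (W1_tail wcos wnsin wcos_bound wnsin_bound c x Hx He).
      pose proof (W2_tail cst1 cst0 cst1_bound cst0_bound c x He).
      replace (4 / - eta c x) with (2 / - eta c x + 2 / - eta c x) by (field; lra). lra.
    - intros x Hx. pose proof (den_pos c x Hc Hx) as Hd. pose proof (cos_pos_dom x Hx) as Hcos.
      destruct (trig2 x) as (T1 & _ & T3 & T4). unfold W1, W2, cst1, cst0. rewrite T1, T3.
      unfold den, eta in *. auto_derive; [lra|].
      set (e := ln (2 * cos x) - c) in *. replace (ln (2 * cos x) + - c) with e by (unfold e; ring).
      set (k := cos x) in *. set (s := sin x) in *.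
      set (D := e ^ 2 + x ^ 2) in *.
      replace (e * (e * 1) + x * (x * 1)) with D by (unfold D; ring).
      transitivity (((e * (k ^ 2 - s ^ 2) - 2 * x * s * k + (k ^ 2 - s ^ 2)) * D - 2 * (x ^ 2 * k ^ 2 - e ^ 2 * s ^ 2)) / D ^ 2).
      + field. lra.
      + apply Rminus_diag_uniq.
        transitivity (((k ^ 2 - s ^ 2) * D - 2 * (x ^ 2 * k ^ 2 - e ^ 2 * s ^ 2) - (e ^ 2 - x ^ 2)) / D ^ 2).
        * field. lra.
        * replace ((k ^ 2 - s ^ 2) * D - 2 * (x ^ 2 * k ^ 2 - e ^ 2 * s ^ 2) - (e ^ 2 - x ^ 2))
            with ((e ^ 2 - x ^ 2) * ((k ^ 2 + s ^ 2) - 1)) by (unfold D; ring). rewrite T4. unfold Rdiv. ring.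
    - intros x Hx He. apply W1_tail; auto; [apply Rabs_cos_sin_le_1|apply Rabs_cos_sqr_le_1]. }
  assert (E2 : is_RInt (fun x => W1 wcos wnsin c x + W2 cst1 cst0 c x) 0 (PI / 2) (fcm c + RInt (W2 cst1 cst0 c) 0 (PI / 2))).
  { apply (is_RInt_plus (V := R_NormedModule)); apply (RInt_correct (V := R_CompleteNormedModule));
      [apply ex_RInt_W1|apply ex_RInt_W2]; auto. }
  apply (is_RInt_unique (V := R_CompleteNormedModule)) in E. apply (is_RInt_unique (V := R_CompleteNormedModule)) in E2.
  rewrite E in E2. unfold W1 at 1 in E2. rewrite sin_0 in E2.
  replace (- fcm c) with (RInt (W2 cst1 cst0 c) 0 (PI / 2)) by (unfold Rdiv in E2; lra).
  apply RInt_W1_derive; auto.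
Qed.

Lemma fcm_derive (c : R) : c <> ln 2 -> ex_derive fcm c.
Proof. intros Hc. eexists. apply RInt_W1_derive; auto. Qed.

(* Real part of (exp (s (z - c)) - 1)/(z - c). *)
Definition gs (c s x : R) : R :=
  ((exp (s * eta c x) * cos (s * x) - 1) * eta c x + exp (s * eta c x) * sin (s * x) * x) / den c x.
Definition gs1 (c s x : R) : R := exp (s * eta c x) * cos (s * x).
Definition gs2 (c s x : R) : R := exp (s * eta c x) * (eta c x * cos (s * x) - x * sin (s * x)).

Lemma gs_derive (c s x : R) : 0 < den c x -> is_derive (fun s => gs c s x) s (gs1 c s x).
Proof. intros H. unfold gs, gs1, den in *. auto_derive; [easy|]. field. lra. Qed.

Lemma gs1_derive (c s x : R) : is_derive (fun s => gs1 c s x) s (gs2 c s x).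
Proof. unfold gs1, gs2. auto_derive; [easy|]. ring. Qed.

Lemma gs_cont (c s x : R) : 0 < cos x -> 0 < den c x -> continuous (gs c s) x.
Proof.
  intros H1 H2. apply (ex_derive_continuous (V := R_NormedModule)). unfold gs, den, eta in *. auto_derive. repeat split; lra.
Qed.

Lemma gs1_cont (c s x : R) : 0 < cos x -> continuous (gs1 c s) x.
Proof.
  intros H1. apply (ex_derive_continuous (V := R_NormedModule)). unfold gs1, eta in *. auto_derive. lra.
Qed.

Lemma gs_tail (c s x : R) : 0 <= s -> 0 <= x < PI / 2 -> eta c x < - 2 -> Rabs (gs c s x) <= 3 / - eta c x.
Proof.
  intros Hs Hx He. pose proof PI_4. pose proof (den_eta c x) as Hd. assert (Hp : 0 < den c x) by nra.
  unfold gs, Rdiv. rewrite Rabs_mult, Rabs_inv, (Rabs_pos_eq (den c x)) by lra.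
  assert (Ee : 0 < exp (s * eta c x) <= 1) by (split; [apply exp_pos|rewrite <- exp_0; apply exp_le; nra]).
  set (e := exp (s * eta c x)) in *. set (n := eta c x) in *.
  pose proof (Rabs_cos_le (s * x)) as C1. pose proof (Rabs_sin_le (s * x)) as C2.
  assert (B : Rabs ((e * cos (s * x) - 1) * n + e * sin (s * x) * x) <= 3 * - n).
  { apply Rabs_le_between in C1. apply Rabs_le_between in C2.
    assert (-1 <= e * cos (s * x) <= 1) by nra. assert (-1 <= e * sin (s * x) <= 1) by nra.
    apply Rabs_le. split; nra. }
  apply Rle_trans with (3 * - n * / n ^ 2).
  - apply Rmult_le_compat; auto using Rabs_pos.
    + left; now apply Rinv_0_lt_compat.
    + apply Rinv_le_contravar; [nra|easy].
  - right. field. lra.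
Qed.

Lemma gs1_tail (c s x : R) : 0 < s -> 0 <= x < PI / 2 -> eta c x < - 2 -> Rabs (gs1 c s x) <= / s / - eta c x.
Proof.
  intros Hs Hx He. unfold gs1. rewrite Rabs_mult, Rabs_pos_eq by (left; apply exp_pos).
  pose proof (Rabs_cos_le (s * x)). pose proof (exp_pos (s * eta c x)).
  apply Rle_trans with (exp (s * eta c x)); [pose proof (Rabs_pos (cos (s * x))); nra|].
  replace (s * eta c x) with (- (s * - eta c x)) by ring.
  eapply Rle_trans; [apply exp_neg_le; nra|]. right. field. lra.
Qed.

Lemma ex_gs (c s : R) : c <> ln 2 -> 0 <= s -> ex_RInt (gs c s) 0 (PI / 2).
Proof.
  intros Hc Hs. apply ex_RInt_eta with c 3 2; [lra| |].
  - intros x Hx. apply gs_cont; [now apply cos_pos_dom|now apply den_pos].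
  - intros x Hx. now apply gs_tail.
Qed.

Lemma ex_gs1 (c s : R) : 0 < s -> ex_RInt (gs1 c s) 0 (PI / 2).
Proof.
  intros Hs. apply ex_RInt_eta with c (/ s) 2; [lra| |].
  - intros x Hx. apply gs1_cont. now apply cos_pos_dom.
  - intros x Hx. now apply gs1_tail.
Qed.

Lemma eta_upper (c x : R) : 0 <= x < PI / 2 -> eta c x <= ln 2 - c.
Proof.
  intros Hx. unfold eta. pose proof (cos_pos_dom x Hx). pose proof (COS_bound x).
  assert (ln (2 * cos x) <= ln 2); [|lra].
  destruct (Req_dec (cos x) 1) as [->|h]; [rewrite Rmult_1_r; lra|]. left. apply ln_increasing; lra.
Qed.

Lemma RInt_gs1 (c s : R) : 0 <= s <= 1 -> RInt (gs1 c s) 0 (PI / 2) = exp (- (s * c)) * (PI / 2).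
Proof.
  intros Hs. pose proof PI_RGT_0 as Hpi.
  assert (Hex : ex_RInt (fun x => exp (s * ln (2 * cos x)) * cos (s * x)) 0 (PI / 2)).
  { destruct (Req_dec s 0) as [->|h].
    - apply ex_RInt_ext with (fun _ => 1); [|apply ex_RInt_const].
      intros x _. rewrite !Rmult_0_l, exp_0, cos_0. toR. ring.
    - apply ex_RInt_ext with (gs1 0 s); [|apply ex_gs1; lra].
      intros x _. unfold gs1, eta. now rewrite Rminus_0_r. }
  pose proof (mean_power s Hs) as E.
  transitivity (exp (- (s * c)) * RInt (fun x => exp (s * ln (2 * cos x)) * cos (s * x)) 0 (PI / 2)); [|now rewrite E].
  match goal with |- _ = ?a * RInt ?f ?b ?c => change (a * RInt f b c) with (scal a (RInt f b c)) end.
  rewrite <- (RInt_scal (V := R_CompleteNormedModule)) by easy.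
  apply RInt_ext. intros x _. unfold gs1, eta, scal; simpl. unfold mult; simpl.
  replace (s * (ln (2 * cos x) - c)) with (- (s * c) + s * ln (2 * cos x)) by ring. rewrite exp_plus. toR. ring.
Qed.

Lemma gs_RInt_derive (c s : R) : c <> ln 2 -> 0 < s <= 1 ->
  is_derive (fun s => RInt (gs c s) 0 (PI / 2)) s (exp (- (s * c)) * (PI / 2)).
Proof.
  intros Hc Hs. pose proof PI_RGT_0 as Hpi. pose proof PI_4 as Hpi4.
  rewrite <- RInt_gs1 by lra.
  set (B := Rmax 0 (ln 2 - c)). pose proof (Rmax_l 0 (ln 2 - c)) as HB0. pose proof (Rmax_r 0 (ln 2 - c)) as HB1. fold B in HB0, HB1.
  (* Here t lies between s/2 and 2. Where eta < 0, the exponential absorbs |eta| at the cost of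
     1/(s/2); where eta >= 0, it is at most B. This gives the two parts of the bound, and it forces
     s > 0. *)
  apply (RInt_param_derive (gs c) (gs1 c) (gs2 c) s (s / 2) (/ (s / 2) + 2 + exp (2 * B) * (B + 2))); try lra.
  - intros t x Ht Hx. apply gs_derive, den_pos; [easy|lra].
  - intros t x Ht Hx. apply gs1_derive.
  - intros t x Ht Hx. apply Rabs_def2 in Ht.
    pose proof (eta_upper c x ltac:(lra)) as He. unfold gs2.
    rewrite Rabs_mult, Rabs_pos_eq by (left; apply exp_pos).
    set (n := eta c x) in *.
    assert (Hb : Rabs (n * cos (t * x) - x * sin (t * x)) <= Rabs n + 2).
    { unfold Rminus. eapply Rle_trans; [apply Rabs_triang|]. rewrite Rabs_Ropp, !Rabs_mult.
      pose proof (Rabs_cos_le (t * x)). pose proof (Rabs_sin_le (t * x)). pose proof (Rabs_pos n).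
      rewrite (Rabs_pos_eq x) by lra. pose proof (Rabs_pos (sin (t * x))). nra. }
    pose proof (exp_pos (t * n)) as Ep.
    apply Rle_trans with (exp (t * n) * (Rabs n + 2)); [apply Rmult_le_compat_l; lra|].
    pose proof (Rinv_0_lt_compat (s / 2) ltac:(lra)) as Hi.
    pose proof (exp_pos (2 * B)).
    destruct (Rlt_dec n 0) as [h|h].
    + rewrite Rabs_left by easy.
      assert (exp (t * n) <= 1) by (rewrite <- exp_0; apply exp_le; nra).
      assert (exp (t * n) * - n <= / (s / 2)).
      { apply Rle_trans with (exp (- (s / 2 * - n)) * - n).
        - apply Rmult_le_compat_r; [lra|]. apply exp_le. nra.
        - apply Rle_trans with (/ (s / 2 * - n) * - n); [apply Rmult_le_compat_r; [lra|apply exp_neg_le; nra]|].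
          right. field. lra. }
      assert (0 <= exp (2 * B) * (B + 2)) by (apply Rmult_le_pos; lra). lra.
    + rewrite Rabs_pos_eq by lra.
      assert (exp (t * n) <= exp (2 * B)) by (apply exp_le; nra).
      assert (exp (t * n) * (n + 2) <= exp (2 * B) * (B + 2)) by (apply Rmult_le_compat; lra). lra.
  - intros t Ht. apply Rabs_def2 in Ht. apply ex_gs; [easy|lra].
  - apply ex_gs1. lra.
Qed.

(** Continuity at s = 0, the endpoint that [gs_RInt_derive] cannot reach. *)
Lemma gs_small (c s : R) : c <> ln 2 -> 0 < s <= 1 ->
  Rabs (RInt (gs c s) 0 (PI / 2)) <= PI / 2 * (s * exp (Rmax 0 (ln 2 - c))).
Proof.
  intros Hc Hs. pose proof PI_RGT_0 as Hpi.
  set (B := Rmax 0 (ln 2 - c)). pose proof (Rmax_l 0 (ln 2 - c)) as HB0. pose proof (Rmax_r 0 (ln 2 - c)) as HB1. fold B in HB0, HB1.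
  replace (PI / 2 * (s * exp B)) with ((PI / 2 - 0) * (s * exp B)) by ring.
  apply Rabs_RInt_le; [lra|apply ex_gs; [easy|lra]|].
  intros x Hx. pose proof (den_pos c x Hc ltac:(lra)) as Hd.
  destruct (MVT_gen (fun s => gs c s x) 0 s (fun s => gs1 c s x)) as [t [Ht E]].
  - intros t _. now apply gs_derive.
  - intros t _. apply continuity_pt_filterlim. apply (continuous_derive (fun s => gs c s x) _ (gs1 c t x)). now apply gs_derive.
  - rewrite Rmin_left, Rmax_right in Ht by lra.
    replace (gs c 0 x) with 0 in E by (unfold gs; rewrite !Rmult_0_l, exp_0, cos_0, sin_0; unfold Rdiv; ring).
    rewrite !Rminus_0_r in E. rewrite E, Rabs_mult, (Rabs_pos_eq s), Rmult_comm by lra.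
    apply Rmult_le_compat_l; [lra|]. unfold gs1. rewrite Rabs_mult, Rabs_pos_eq by (left; apply exp_pos).
    pose proof (Rabs_cos_le (t * x)). pose proof (Rabs_pos (cos (t * x))). pose proof (exp_pos (t * eta c x)).
    pose proof (eta_upper c x ltac:(lra)) as He.
    assert (exp (t * eta c x) <= exp B) by (apply exp_le; nra). nra.
Qed.

(* ((1 + w) exp (- c) - 1)/(z - c) is the integral over s in [0, 1] of exp (s (z - c)), whose mean over the circle
   is exp (- s c). *)
Lemma fc0_fc1_relation (c : R) : c <> ln 2 ->
  c * ((1 - exp c) * fc0 c + fc1 c) = PI / 2 * (exp c - 1).
Proof.
  intros Hc. pose proof PI_RGT_0 as Hpi.
  destruct (Req_dec c 0) as [->|Hc0]; [rewrite exp_0; ring|].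
  assert (E1 : RInt (gs c 1) 0 (PI / 2) = (exp (- c) - 1) * fc0 c + exp (- c) * fc1 c).
  { apply is_RInt_unique. apply is_RInt_ext with (fun x => plus (scal (exp (- c) - 1) (W1 cst1 cst0 c x)) (scal (exp (- c)) (W1 wcos wsin c x))).
    - intros x. rewrite Rmin_left, Rmax_right by lra. intros Hx.
      pose proof (den_pos c x Hc ltac:(lra)) as Hd. pose proof (cos_pos_dom x ltac:(lra)) as Hcos.
      destruct (trig2 x) as (T1 & T2 & _ & T4).
      unfold gs, W1, cst1, cst0, plus, scal; simpl. unfold mult; simpl. rewrite T1, T2, !Rmult_1_l.
      replace (exp (eta c x)) with (exp (- c) * (2 * cos x)).
      2:{ unfold eta. replace (ln (2 * cos x) - c) with (- c + ln (2 * cos x)) by ring. rewrite exp_plus, exp_ln by lra. ring. }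
      toR. transitivity ((exp (- c) * (((cos x ^ 2 + sin x ^ 2) + (cos x ^ 2 - sin x ^ 2)) * eta c x + 2 * sin x * cos x * x) - eta c x) / den c x).
      + rewrite T4. field. lra.
      + field. lra.
    - apply (is_RInt_plus (V := R_NormedModule)); apply (is_RInt_scal (V := R_NormedModule));
        apply (RInt_correct (V := R_CompleteNormedModule)); apply ex_RInt_W1; auto. }
  (* The second summand is minus a primitive of the mean of exp (s (z - c)). So H is constant on (0,
     1], and its limit at 0 is PI / 2 / c. *)
  set (H := fun s => RInt (gs c s) 0 (PI / 2) + PI / 2 * exp (- (s * c)) / c).
  assert (HH : forall s, 0 < s <= 1 -> is_derive H s 0).
  { intros s Hs. eapply is_derive_eq.
    - apply (is_derive_plus (V := R_NormedModule)); [now apply gs_RInt_derive|].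
      instantiate (1 := - (exp (- (s * c)) * (PI / 2))). auto_derive; [easy|]. field. easy.
    - unfold plus; simpl. ring. }
  assert (Hc1 : forall s, 0 < s <= 1 -> H 1 = H s).
  { intros s Hs. apply (is_derive_0_const H s 1); try lra.
    - intros t Ht. apply HH. lra.
    - intros t Ht. apply (continuous_derive _ _ 0). apply HH. lra. }
  assert (L : is_lim_seq (fun n => H (/ (INR n + 1))) (PI / 2 / c)).
  { replace (PI / 2 / c) with (0 + PI / 2 * exp (- (0 * c)) / c) by (rewrite Rmult_0_l, Ropp_0, exp_0; field; easy).
    assert (Hn : forall n, 0 < / (INR n + 1) <= 1).
    { intros n. pose proof (pos_INR n). split; [apply Rinv_0_lt_compat; lra|].
      rewrite <- Rinv_1. apply Rinv_le_contravar; lra. }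
    apply is_lim_seq_plus'.
    - apply (proj2 (is_lim_seq_abs_0 _)).
      apply is_lim_seq_le_le with (fun _ => 0) (fun n => PI / 2 * (/ (INR n + 1) * exp (Rmax 0 (ln 2 - c)))).
      + intros n. split; [apply Rabs_pos|]. now apply gs_small.
      + apply is_lim_seq_const.
      + replace (Finite 0) with (Finite (PI / 2 * (0 * exp (Rmax 0 (ln 2 - c))))) by (f_equal; ring).
        apply is_lim_seq_mult'; [apply is_lim_seq_const|]. apply is_lim_seq_mult'; [apply is_lim_seq_inv_S|apply is_lim_seq_const].
    - apply (is_lim_seq_continuous (fun s => PI / 2 * exp (- (s * c)) / c)); [|apply is_lim_seq_inv_S].
      apply continuity_pt_filterlim.
      apply (ex_derive_continuous (V := R_NormedModule) (fun s => PI / 2 * exp (- (s * c)) / c) 0). now auto_derive. }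
  assert (H1 : H 1 = PI / 2 / c).
  { apply is_lim_seq_ext with (v := fun _ => H 1) in L.
    - apply is_lim_seq_unique in L. rewrite Lim_seq_const in L. now injection L.
    - intros n. symmetry. apply Hc1. pose proof (pos_INR n). split; [apply Rinv_0_lt_compat; lra|].
      rewrite <- Rinv_1. apply Rinv_le_contravar; lra. }
  unfold H in H1. rewrite E1, Rmult_1_l in H1.
  assert (Ex : exp c * exp (- c) = 1) by (rewrite <- exp_plus, Rplus_opp_r; apply exp_0).
  apply (Rmult_eq_reg_l (exp (- c) / c)).
  2:{ pose proof (exp_pos (- c)). unfold Rdiv. apply Rmult_integral_contrapositive_currified; [lra|now apply Rinv_neq_0_compat]. }
  transitivity ((exp (- c) - exp c * exp (- c)) * fc0 c + exp (- c) * fc1 c); [field; easy|].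
  rewrite Ex. transitivity (PI / 2 * (exp c * exp (- c)) / c - PI / 2 * exp (- c) / c); [|field; easy].
  rewrite Ex. lra.
Qed.

Lemma exp_ode_const (f : R -> R) (x y : R) : x <= y ->
  (forall t, x <= t <= y -> is_derive f t (f t)) -> f x * exp (- x) = f y * exp (- y).
Proof.
  intros Hxy H.
  assert (D : forall t, x <= t <= y -> is_derive (fun t => f t * exp (- t)) t 0).
  { intros t Ht. eapply is_derive_eq.
    - apply (is_derive_mult_R f (fun t => exp (- t))); [now apply H|].
      instantiate (1 := - exp (- t)). auto_derive; [easy|]. ring.
    - ring. }
  apply (is_derive_0_const (fun t => f t * exp (- t)) x y); try lra.
  - intros t Ht. apply D. lra.
  - intros t Ht. apply (continuous_derive _ _ 0), D. easy.
Qed.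

(** The singular point ln 2 cuts the line into two intervals, each with its own constant in the
    solution of f' = f. *)
Lemma fc1_exp (c1 c2 : R) : (c1 < ln 2 /\ c2 < ln 2) \/ (ln 2 < c1 /\ ln 2 < c2) ->
  fc1 c1 * exp (- c1) = fc1 c2 * exp (- c2).
Proof.
  intros H. destruct (Rle_dec c1 c2) as [h|h].
  - apply exp_ode_const; [easy|]. intros t Ht. apply fc1_derive. lra.
  - symmetry. apply exp_ode_const; [lra|]. intros t Ht. apply fc1_derive. lra.
Qed.

Lemma exp_mult_opp (c : R) : exp c * exp (- c) = 1.
Proof. rewrite <- exp_plus, Rplus_opp_r. apply exp_0. Qed.

(* Regularity of [fc0] at c = 0 forces the constant: the relation with [fc1] is differentiated there. *)
Lemma fc1_0 : fc1 0 = PI / 2.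
Proof.
  pose proof ln_lt_2 as Hl.
  pose (F := fun c => c * ((1 - exp c) * fc0 c + fc1 c) - PI / 2 * (exp c - 1)).
  assert (D : is_derive F 0 (fc1 0 - PI / 2)).
  { unfold F. eapply is_derive_eq.
    - apply (is_derive_minus (V := R_NormedModule)).
      + apply (is_derive_mult_R (fun c => c) (fun c => (1 - exp c) * fc0 c + fc1 c)); [apply @is_derive_id|].
        apply (is_derive_plus (V := R_NormedModule)); [|apply fc1_derive; lra].
        apply (is_derive_mult_R (fun c => 1 - exp c) fc0); [|apply fc0_derive; lra].
        instantiate (1 := - exp 0). auto_derive; [easy|]. ring.
      + instantiate (1 := PI / 2 * exp 0). auto_derive; [easy|]. ring.
    - unfold minus, plus, opp, one; simpl. rewrite exp_0. ring. }
  assert (Z : is_derive F 0 0).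
  { apply is_derive_ext_loc with (fun _ => 0); [|apply @is_derive_const].
    apply filter_imp with (fun c => c < ln 2); [|apply locally_lt; lra].
    intros c Hc. unfold F. rewrite fc0_fc1_relation by lra. toR. ring. }
  apply is_derive_unique in D. apply is_derive_unique in Z. rewrite Z in D. lra.
Qed.

Lemma fc1_lt (c : R) : c < ln 2 -> fc1 c = PI / 2 * exp c.
Proof.
  intros H. pose proof ln_lt_2 as Hl. pose proof (fc1_exp c 0 ltac:(lra)) as E.
  rewrite fc1_0, Ropp_0, exp_0 in E.
  transitivity (fc1 c * exp (- c) * exp c); [|rewrite E; ring].
  pose proof (exp_mult_opp c) as E2. transitivity (fc1 c * (exp c * exp (- c))); [rewrite E2; ring|ring].
Qed.

Lemma fc1_far (c : R) : ln 2 + 2 < c -> Rabs (fc1 c) <= PI / 2 * 1.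
Proof.
  intros H. pose proof PI_RGT_0 as Hpi. unfold fc1.
  replace (PI / 2 * 1) with ((PI / 2 - 0) * 1) by ring.
  apply Rabs_RInt_le; [lra|apply ex_RInt_W1; auto using wcos_bound, wsin_bound, wcos_diff, wsin_diff; lra|].
  intros x Hx. pose proof (eta_upper c x ltac:(lra)) as He.
  eapply Rle_trans; [apply W1_tail; auto using wcos_bound, wsin_bound; lra|].
  apply Rmult_le_reg_r with (- eta c x); [lra|]. unfold Rdiv. rewrite Rmult_assoc, Rinv_l; lra.
Qed.

(** The solutions of f' = f are multiples of exp c, while [fc1] stays bounded as c grows. *)
Lemma fc1_gt (c : R) : ln 2 < c -> fc1 c = 0.
Proof.
  intros H. pose proof PI_RGT_0 as Hpi.
  set (k := fc1 c * exp (- c)).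
  assert (Hk : forall t, ln 2 + 2 < t -> Rabs k * exp t <= PI / 2).
  { intros t Ht. unfold k. rewrite (fc1_exp c t) by lra.
    rewrite <- (Rabs_pos_eq (exp t)) by (left; apply exp_pos). rewrite <- Rabs_mult.
    replace (fc1 t * exp (- t) * exp t) with (fc1 t * (exp t * exp (- t))) by ring.
    rewrite exp_mult_opp, Rmult_1_r. pose proof (fc1_far t Ht). lra. }
  assert (k = 0).
  { destruct (Req_dec k 0) as [e|e]; [easy|exfalso].
    assert (Hp : 0 < Rabs k) by now apply Rabs_pos_lt.
    pose proof ln_lt_2 as Hl.
    assert (0 < PI / Rabs k) by (apply Rdiv_lt_0_compat; lra).
    specialize (Hk (ln 2 + 3 + PI / Rabs k) ltac:(lra)).
    pose proof (exp_ineq1 (ln 2 + 3 + PI / Rabs k) ltac:(lra)).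
    assert (Rabs k * (PI / Rabs k) < Rabs k * exp (ln 2 + 3 + PI / Rabs k)) by (apply Rmult_lt_compat_l; lra).
    replace (Rabs k * (PI / Rabs k)) with PI in H2 by (field; lra). lra. }
  unfold k in H0. apply Rmult_integral in H0. destruct H0 as [|E]; [easy|]. pose proof (exp_pos (- c)). lra.
Qed.

Lemma exp_neq_1 (c : R) : c <> 0 -> exp c - 1 <> 0.
Proof. intros H E. apply H. apply exp_inv. rewrite exp_0. lra. Qed.

Lemma fc0_lt (c : R) : c < ln 2 -> c <> 0 -> fc0 c = PI / 2 * (exp c / (exp c - 1) - / c).
Proof.
  intros H H0. pose proof (fc0_fc1_relation c ltac:(lra)) as E. rewrite fc1_lt in E by easy.
  pose proof (exp_neq_1 c H0) as Hn.
  apply (Rmult_eq_reg_l (c * (1 - exp c))); [|apply Rmult_integral_contrapositive_currified; lra].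
  transitivity (PI / 2 * (exp c - 1) - c * (PI / 2 * exp c)); [lra|]. field. auto.
Qed.

Lemma fc0_gt (c : R) : ln 2 < c -> fc0 c = - (PI / 2 / c).
Proof.
  intros H. pose proof ln_lt_2 as Hl. pose proof (fc0_fc1_relation c ltac:(lra)) as E. rewrite fc1_gt in E by easy.
  pose proof (exp_neq_1 c ltac:(lra)) as Hn.
  apply (Rmult_eq_reg_l (c * (1 - exp c))); [|apply Rmult_integral_contrapositive_currified; lra].
  transitivity (PI / 2 * (exp c - 1)); [lra|]. field. lra.
Qed.

Lemma fcm_lt (c : R) : c < ln 2 -> c <> 0 -> fcm c = PI / 2 * (exp c / (exp c - 1) ^ 2 - / c ^ 2).
Proof.
  intros H H0. pose proof (exp_neq_1 c H0) as Hn.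
  assert (D : is_derive fc0 c (- (PI / 2 * (exp c / (exp c - 1) ^ 2 - / c ^ 2)))).
  { apply is_derive_ext_loc with (fun c => PI / 2 * (exp c / (exp c - 1) - / c)).
    (* The closed form of [fc0] must hold in a neighbourhood of c before it is differentiated, so
       both ln 2 and 0 have to be kept out. *)
    - assert (Hd : 0 < Rmin (ln 2 - c) (Rabs c)) by (apply Rmin_pos; [lra|now apply Rabs_pos_lt]).
      exists (mkposreal _ Hd). intros y Hy. change (Rabs (y - c) < Rmin (ln 2 - c) (Rabs c)) in Hy.
      pose proof (Rmin_l (ln 2 - c) (Rabs c)). pose proof (Rmin_r (ln 2 - c) (Rabs c)).
      symmetry. apply fc0_lt.
      + apply Rabs_def2 in Hy. lra.
      + intros ->. rewrite Rminus_0_l, Rabs_Ropp in Hy. lra.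
    - auto_derive; [repeat split; auto|]. field. auto. }
  pose proof (fc0_derive c ltac:(lra)) as D2. apply is_derive_unique in D. apply is_derive_unique in D2. lra.
Qed.

Lemma fcm_gt (c : R) : ln 2 < c -> fcm c = - (PI / 2 / c ^ 2).
Proof.
  intros H. pose proof ln_lt_2 as Hl.
  assert (D : is_derive fc0 c (PI / 2 / c ^ 2)).
  { apply is_derive_ext_loc with (fun c => - (PI / 2 / c)).
    - assert (Hd : 0 < c - ln 2) by lra.
      exists (mkposreal _ Hd). intros y Hy. change (Rabs (y - c) < c - ln 2) in Hy.
      symmetry. apply fc0_gt. apply Rabs_def2 in Hy. lra.
    - auto_derive; [lra|]. field. lra. }
  pose proof (fc0_derive c ltac:(lra)) as D2. apply is_derive_unique in D. apply is_derive_unique in D2. lra.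
Qed.

(** * The integral J attached to a single pole *)

Definition Jf (c x : R) : R := x * sin (2 * x) / den c x.
(** w - 1/w = 2 i sin 2x, and the real part of 2 i sin 2x/(z - c) is twice [Jf c x]. *)
Definition J (c : R) : R := (fc1 c - fcm c) / 2.

Lemma J_is_RInt (c : R) : c <> ln 2 -> is_RInt (Jf c) 0 (PI / 2) (J c).
Proof.
  intros Hc. pose proof PI_RGT_0 as Hpi.
  apply is_RInt_ext with (fun x => scal (/ 2) (minus (W1 wcos wsin c x) (W1 wcos wnsin c x))).
  - intros x. rewrite Rmin_left, Rmax_right by lra. intros Hx.
    pose proof (den_pos c x Hc ltac:(lra)). unfold Jf, W1, wsin, wnsin, scal, minus, plus, opp; simpl.
    unfold mult; simpl. toR. field. lra.
  - replace (J c) with (scal (/ 2) (minus (fc1 c) (fcm c))).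
    + apply (is_RInt_scal (V := R_NormedModule)), (is_RInt_minus (V := R_NormedModule));
        apply (RInt_correct (V := R_CompleteNormedModule)); apply ex_RInt_W1;
        auto using wcos_bound, wsin_bound, wnsin_bound, wcos_diff, wsin_diff, wnsin_diff.
    + unfold J, scal, minus, plus, opp; simpl. unfold mult; simpl. field.
Qed.

Lemma J_gt (c : R) : ln 2 < c -> J c = PI / 4 * / c ^ 2.
Proof.
  intros H. pose proof ln_lt_2. unfold J. rewrite fc1_gt, fcm_gt by easy. field. lra.
Qed.

Lemma exp_sinh (c : R) : (exp c - 1) ^ 2 = 4 * sinh (c / 2) ^ 2 * exp c.
Proof.
  unfold sinh. assert (Ec : exp c = exp (c / 2) * exp (c / 2)) by (rewrite <- exp_plus; f_equal; field).
  rewrite Ec. pose proof (exp_mult_opp (c / 2)) as E. set (u := exp (c / 2)) in *. set (v := exp (- (c / 2))) in *.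
  transitivity ((u * u - u * v) ^ 2); [rewrite E; ring|]. field.
Qed.

Lemma J_lt (c : R) : c < ln 2 -> c <> 0 ->
  J c = PI / 4 * (/ c ^ 2 + exp c - / (4 * sinh (c / 2) ^ 2)).
Proof.
  intros H H0. unfold J. rewrite fc1_lt, fcm_lt, exp_sinh by easy.
  pose proof (exp_pos c). assert (sinh (c / 2) <> 0).
  { intros E. apply H0. rewrite <- sinh_0 in E.
    destruct (Rtotal_order (c / 2) 0) as [h|[h|h]]; [|lra|]; apply sinh_lt in h; lra. }
  field. repeat split; auto; lra.
Qed.

(** * Taylor bounds for sinh and cosh, and the value of J at 0 *)

Lemma le_of_derive_le (f g f' g' : R -> R) (u : R) : 0 <= u ->
  (forall t, 0 <= t <= u -> is_derive f t (f' t)) -> (forall t, 0 <= t <= u -> is_derive g t (g' t)) ->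
  (forall t, 0 <= t <= u -> f' t <= g' t) -> f 0 = g 0 -> f u <= g u.
Proof.
  intros Hu Hf Hg Hle H0.
  destruct (MVT_gen (fun t => g t - f t) 0 u (fun t => g' t - f' t)) as [c [Hc E]].
  - intros t. rewrite Rmin_left, Rmax_right by easy. intros Ht.
    apply (is_derive_minus (V := R_NormedModule)); [apply Hg|apply Hf]; lra.
  - intros t. rewrite Rmin_left, Rmax_right by easy. intros Ht. apply continuity_pt_filterlim.
    apply (continuous_derive (fun t => g t - f t) t (g' t - f' t)). apply (is_derive_minus (V := R_NormedModule)); [apply Hg|apply Hf]; lra.
  - rewrite Rmin_left, Rmax_right in Hc by easy. specialize (Hle c Hc). rewrite H0 in E. nra.
Qed.

Lemma sinh_ge (u : R) : 0 <= u -> u <= sinh u.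
Proof.
  intros H. apply (le_of_derive_le (fun t => t) sinh (fun _ => 1) cosh u); auto.
  - intros; apply @is_derive_id.
  - intros; apply is_derive_sinh.
  - intros t Ht. pose proof (cosh_sqr t). pose proof (cosh_gt_0 t). pose proof (pow2_ge_0 (sinh t)). nra.
  - now rewrite sinh_0.
Qed.

Lemma cosh_ge (u : R) : 0 <= u -> 1 + u ^ 2 / 2 <= cosh u.
Proof.
  intros H. apply (le_of_derive_le (fun t => 1 + t ^ 2 / 2) cosh (fun t => t) sinh u); auto.
  - intros; auto_derive; [easy|field].
  - intros; apply is_derive_cosh.
  - intros t Ht. apply sinh_ge; lra.
  - rewrite cosh_0. field.
Qed.

Lemma sinh_ge3 (u : R) : 0 <= u -> u + u ^ 3 / 6 <= sinh u.
Proof.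
  intros H. apply (le_of_derive_le (fun t => t + t ^ 3 / 6) sinh (fun t => 1 + t ^ 2 / 2) cosh u); auto.
  - intros; auto_derive; [easy|field].
  - intros; apply is_derive_sinh.
  - intros t Ht. apply cosh_ge; lra.
  - rewrite sinh_0. field.
Qed.

(** The crude start of a chain of upper bounds on [0, 1], each obtained by integrating the previous
    one; this explains the coefficients 1/3, 1/12 and 1/60, larger than those of Taylor. *)
Lemma cosh_le_2 (u : R) : 0 <= u <= 1 -> cosh u <= 2.
Proof.
  intros H. unfold cosh. pose proof exp_le_3. assert (exp u <= exp 1) by (apply exp_le; lra).
  assert (exp (- u) <= 1) by (rewrite <- exp_0; apply exp_le; lra). lra.
Qed.

Lemma sinh_le1 (u : R) : 0 <= u <= 1 -> sinh u <= 2 * u.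
Proof.
  intros H. apply (le_of_derive_le sinh (fun t => 2 * t) cosh (fun _ => 2) u); try lra.
  - intros; apply is_derive_sinh.
  - intros; auto_derive; [easy|ring].
  - intros t Ht. apply cosh_le_2; lra.
  - rewrite sinh_0. ring.
Qed.

Lemma cosh_le2 (u : R) : 0 <= u <= 1 -> cosh u <= 1 + u ^ 2.
Proof.
  intros H. apply (le_of_derive_le cosh (fun t => 1 + t ^ 2) sinh (fun t => 2 * t) u); try lra.
  - intros; apply is_derive_cosh.
  - intros; auto_derive; [easy|ring].
  - intros t Ht. apply sinh_le1; lra.
  - rewrite cosh_0. ring.
Qed.

Lemma sinh_le3 (u : R) : 0 <= u <= 1 -> sinh u <= u + u ^ 3 / 3.
Proof.
  intros H. apply (le_of_derive_le sinh (fun t => t + t ^ 3 / 3) cosh (fun t => 1 + t ^ 2) u); try lra.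
  - intros; apply is_derive_sinh.
  - intros; auto_derive; [easy|field].
  - intros t Ht. apply cosh_le2; lra.
  - rewrite sinh_0. field.
Qed.

Lemma cosh_le4 (u : R) : 0 <= u <= 1 -> cosh u <= 1 + u ^ 2 / 2 + u ^ 4 / 12.
Proof.
  intros H. apply (le_of_derive_le cosh (fun t => 1 + t ^ 2 / 2 + t ^ 4 / 12) sinh (fun t => t + t ^ 3 / 3) u); try lra.
  - intros; apply is_derive_cosh.
  - intros; auto_derive; [easy|field].
  - intros t Ht. apply sinh_le3; lra.
  - rewrite cosh_0. field.
Qed.

Lemma sinh_le5 (u : R) : 0 <= u <= 1 -> sinh u <= u + u ^ 3 / 6 + u ^ 5 / 60.
Proof.
  intros H. apply (le_of_derive_le sinh (fun t => t + t ^ 3 / 6 + t ^ 5 / 60) cosh (fun t => 1 + t ^ 2 / 2 + t ^ 4 / 12) u); try lra.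
  - intros; apply is_derive_sinh.
  - intros; auto_derive; [easy|field].
  - intros t Ht. apply cosh_le4; lra.
  - rewrite sinh_0. field.
Qed.

Lemma inv_sinh_expansion (t : R) : 0 < t <= 1 -> Rabs (/ t ^ 2 - / sinh t ^ 2 - / 3) <= 4 * t ^ 2.
Proof.
  intros Ht. pose proof (sinh_ge3 t ltac:(lra)) as H1. pose proof (sinh_le5 t ltac:(lra)) as H2.
  set (s := sinh t) in *.
  assert (Ht2 : 0 < t ^ 2 <= 1) by (split; [apply pow_lt; lra|nra]).
  pose (y := t ^ 2). fold y in Ht2 |- *.
  assert (L : y * (1 + y / 3) <= s ^ 2).
  { apply Rle_trans with ((t + t ^ 3 / 6) ^ 2); [|apply pow_incr; split; [|easy]].
    - replace ((t + t ^ 3 / 6) ^ 2) with (y * (1 + y / 3 + y ^ 2 / 36)) by (unfold y; field).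
      apply Rmult_le_compat_l; [lra|]. pose proof (pow2_ge_0 y). lra.
    - pose proof (pow_lt t 3). lra. }
  assert (U : s ^ 2 <= y * (1 + y / 3 + y ^ 2)).
  { apply Rle_trans with ((t + t ^ 3 / 6 + t ^ 5 / 60) ^ 2).
    - apply pow_incr. split; [|easy]. pose proof (pow_lt t 3). lra.
    - replace ((t + t ^ 3 / 6 + t ^ 5 / 60) ^ 2) with (y * (1 + y / 6 + y ^ 2 / 60) ^ 2) by (unfold y; field).
      apply Rmult_le_compat_l; [lra|].
      replace ((1 + y / 6 + y ^ 2 / 60) ^ 2) with (1 + y / 3 + y ^ 2 * (/ 36 + / 30 + y / 180 + y ^ 2 / 3600)) by field.
      assert (0 <= y ^ 2 <= 1) by nra.
      assert (y ^ 2 * (/ 36 + / 30 + y / 180 + y ^ 2 / 3600) <= y ^ 2 * 1) by (apply Rmult_le_compat_l; lra). lra. }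
  assert (Hs : 0 < s ^ 2) by nra.
  replace (/ y - / s ^ 2 - / 3) with ((s ^ 2 - y - y * s ^ 2 / 3) / (y * s ^ 2)) by (field; split; nra).
  assert (Hys : 0 < y * s ^ 2) by (apply Rmult_lt_0_compat; lra).
  unfold Rdiv. rewrite Rabs_mult, Rabs_inv, (Rabs_pos_eq (y * s ^ 2)) by lra.
  apply Rmult_le_reg_r with (y * s ^ 2); [easy|]. rewrite Rmult_assoc, Rinv_l, Rmult_1_r by lra.
  assert (y * y <= y * s ^ 2) by (apply Rmult_le_compat_l; nra).
  assert (0 <= y * (y * s ^ 2 - y * y)) by (apply Rmult_le_pos; lra).
  assert (0 <= y * (y * (1 + y / 3 + y ^ 2) - s ^ 2)) by (apply Rmult_le_pos; lra).
  assert (0 <= y ^ 3) by (apply pow_le; lra). assert (y ^ 4 <= y ^ 3) by nra.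
  apply Rabs_le. split; nra.
Qed.

(** J is continuous at 0, although its closed form is singular there: 1/c^2 and 1/(4 sinh^2 (c/2))
    cancel up to 1/12, and exp c adds 1. *)
Lemma J_0 : J 0 = PI / 4 * (13 / 12).
Proof.
  pose proof ln_lt_2 as Hl.
  pose (c := fun n => / (INR n + 2)).
  assert (Hc : forall n, 0 < c n <= / 2).
  { intros n. unfold c. pose proof (pos_INR n). split; [apply Rinv_0_lt_compat; lra|apply Rinv_le_contravar; lra]. }
  assert (Lc : is_lim_seq c 0).
  { apply is_lim_seq_ext with (fun n => / (INR (S n) + 1)); [intros n; unfold c; rewrite S_INR; f_equal; ring|].
    apply (is_lim_seq_incr_1 (fun n => / (INR n + 1))), is_lim_seq_inv_S. }
  assert (L1 : is_lim_seq (fun n => J (c n)) (J 0)).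
  { apply (is_lim_seq_continuous J c 0); [|easy]. apply continuity_pt_filterlim.
    apply (ex_derive_continuous (V := R_NormedModule) J 0). unfold J.
    apply ex_derive_div; [|apply ex_derive_const|lra].
    apply (ex_derive_minus (V := R_NormedModule)); [eexists; apply fc1_derive; lra|apply fcm_derive; lra]. }
  assert (L2 : is_lim_seq (fun n => PI / 4 * (exp (c n) + (/ c n ^ 2 - / (4 * sinh (c n / 2) ^ 2)))) (PI / 4 * (exp 0 + / 12))).
  { apply is_lim_seq_mult'; [apply is_lim_seq_const|]. apply is_lim_seq_plus'.
    - apply (is_lim_seq_continuous exp c 0); [|easy]. apply derivable_continuous_pt, derivable_pt_exp.
    - apply is_lim_seq_ext with (fun n => / 12 + (/ c n ^ 2 - / (4 * sinh (c n / 2) ^ 2) - / 12)); [intros; ring|].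
      replace (Finite (/ 12)) with (Finite (/ 12 + 0)) by (f_equal; ring).
      apply is_lim_seq_plus'; [apply is_lim_seq_const|]. apply (proj2 (is_lim_seq_abs_0 _)).
      apply is_lim_seq_le_le with (fun _ => 0) (fun n => / 4 * c n * c n).
      + intros n. split; [apply Rabs_pos|]. specialize (Hc n).
        pose proof (inv_sinh_expansion (c n / 2) ltac:(lra)) as B.
        assert (Hs : sinh (c n / 2) <> 0) by (apply Rgt_not_eq, sinh_gt_0; lra).
        replace (/ c n ^ 2 - / (4 * sinh (c n / 2) ^ 2) - / 12)
          with (/ 4 * (/ (c n / 2) ^ 2 - / sinh (c n / 2) ^ 2 - / 3)) by (field; split; [easy|lra]).
        rewrite Rabs_mult, (Rabs_pos_eq (/ 4)) by lra. nra.
      + apply is_lim_seq_const.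
      + replace (Finite 0) with (Finite (/ 4 * 0 * 0)) by (f_equal; ring).
        apply is_lim_seq_mult'; [|easy]. apply is_lim_seq_mult'; [apply is_lim_seq_const|easy]. }
  apply is_lim_seq_ext with (v := fun n => J (c n)) in L2.
  - apply is_lim_seq_unique in L1. apply is_lim_seq_unique in L2. rewrite L1 in L2. injection L2 as E.
    rewrite E, exp_0. field.
  - intros n. specialize (Hc n). rewrite J_lt by lra. ring.
Qed.

(** * Dyadic form of the partial fractions of the cotangent *)

(* Imaginary part of - cot ((b + i a)/2). *)
Definition Pk (a b : R) : R := sinh a / (cosh a - cos b).

Lemma cosh_gt_1 (a : R) : 0 < a -> 1 < cosh a.
Proof. intros H. pose proof (cosh_ge a ltac:(lra)). assert (0 < a ^ 2) by (apply pow_lt; lra). lra. Qed.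

(** Imaginary part of the duplication formula cot v = (cot (v/2) + cot (v/2 + PI/2))/2. *)
Lemma Pk_half (a b : R) : 0 < a -> Pk a b = / 2 * (Pk (a / 2) (b / 2) + Pk (a / 2) (b / 2 + PI)).
Proof.
  intros Ha. unfold Pk.
  replace (sinh a) with (2 * sinh (a / 2) * cosh (a / 2)) by (rewrite <- sinh_double; f_equal; field).
  replace (cosh a) with (2 * cosh (a / 2) ^ 2 - 1).
  2:{ rewrite cosh_sqr. replace a with (2 * (a / 2)) at 2 by field. rewrite cosh_double. ring. }
  replace (cos b) with (2 * cos (b / 2) ^ 2 - 1).
  2:{ replace b with (2 * (b / 2)) at 2 by field. rewrite cos_2a_cos. ring. }
  rewrite neg_cos. pose proof (cosh_gt_1 (a / 2) ltac:(lra)). pose proof (COS_bound (b / 2)).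
  set (c := cosh (a / 2)) in *. set (k := cos (b / 2)) in *.
  replace (2 * c ^ 2 - 1 - (2 * k ^ 2 - 1)) with (2 * (c - k) * (c - - k)) by ring. field. lra.
Qed.

Lemma Pk_periodic (a b : R) (k : nat) : Pk a (b + 2 * INR k * PI) = Pk a b.
Proof. unfold Pk. now rewrite cos_period. Qed.

Lemma pow2_nat (N : nat) : (2 * (2 ^ N - 1) + 1 = 2 ^ S N - 1)%nat.
Proof. pose proof (Nat.pow_nonzero 2 N). rewrite Nat.pow_succ_r'. lia. Qed.

(** [Pk_half] iterated: at each step its two terms supply the even and the odd indices. *)
Lemma Pk_dyadic (N : nat) (a b : R) : 0 < a ->
  Pk a b = / 2 ^ N * sum_n (fun k => Pk (a / 2 ^ N) ((b + 2 * PI * INR k) / 2 ^ N)) (2 ^ N - 1).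
Proof.
  revert a b. induction N as [|N IH]; intros a b Ha.
  - simpl. rewrite sum_O. simpl. rewrite Rmult_0_r, Rplus_0_r. unfold Rdiv. rewrite Rinv_1, !Rmult_1_r, Rmult_1_l. reflexivity.
  - rewrite Pk_half, (IH (a / 2) (b / 2)), (IH (a / 2) (b / 2 + PI)) by lra.
    rewrite <- pow2_nat, sum_n_even_odd, sum_n_Rplus.
    rewrite <- Rmult_plus_distr_l, <- Rmult_assoc, <- Rinv_mult. f_equal.
    assert (Hp : 2 ^ N <> 0) by (apply pow_nonzero; lra).
    f_equal; apply sum_n_Rext; intros k _; f_equal; cbn [pow].
    + field. auto.
    + rewrite mult_INR. simpl (INR 2). field. auto.
    + field. auto.
    + rewrite plus_INR, mult_INR. simpl (INR 2). simpl (INR 1). field. auto.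
Qed.

Lemma sin_le_id (u : R) : 0 <= u -> sin u <= u.
Proof.
  intros H. apply (le_of_derive_le sin (fun t => t) cos (fun _ => 1) u); auto.
  - intros; apply is_derive_Reals, derivable_pt_lim_sin.
  - intros; apply @is_derive_id.
  - intros t _. pose proof (COS_bound t). lra.
  - apply sin_0.
Qed.

Lemma cos_ge2 (u : R) : 0 <= u -> 1 - u ^ 2 / 2 <= cos u.
Proof.
  intros H. apply (le_of_derive_le (fun t => 1 - t ^ 2 / 2) cos (fun t => - t) (fun t => - sin t) u); auto.
  - intros; auto_derive; [easy|field].
  - intros; apply is_derive_Reals, derivable_pt_lim_cos.
  - intros t Ht. pose proof (sin_le_id t). lra.
  - rewrite cos_0. field.
Qed.

Lemma sin_ge3 (u : R) : 0 <= u -> u - u ^ 3 / 6 <= sin u.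
Proof.
  intros H. apply (le_of_derive_le (fun t => t - t ^ 3 / 6) sin (fun t => 1 - t ^ 2 / 2) cos u); auto.
  - intros; auto_derive; [easy|field].
  - intros; apply is_derive_Reals, derivable_pt_lim_sin.
  - intros t Ht. apply cos_ge2. lra.
  - rewrite sin_0. field.
Qed.

Lemma cos_le4 (u : R) : 0 <= u -> cos u <= 1 - u ^ 2 / 2 + u ^ 4 / 24.
Proof.
  intros H. apply (le_of_derive_le cos (fun t => 1 - t ^ 2 / 2 + t ^ 4 / 24) (fun t => - sin t) (fun t => - t + t ^ 3 / 6) u); auto.
  - intros; apply is_derive_Reals, derivable_pt_lim_cos.
  - intros; auto_derive; [easy|field].
  - intros t Ht. pose proof (sin_ge3 t). lra.
  - rewrite cos_0. field.
Qed.

(** The range is that of b/2 in [Pk_near]; it goes beyond PI / 2, hence the separate use of the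
    decreasing branch. *)
Lemma sin_ge_8 (t : R) : 0 <= t <= 3 * (PI / 4) -> t / 8 <= sin t.
Proof.
  intros Ht. pose proof PI_4 as HP. pose proof PI2_3_2.
  assert (S1 : / 2 <= sin 1) by (pose proof (sin_ge3 1); lra).
  assert (S3 : / 2 <= sin (3 * (PI / 4))).
  { rewrite sin_3PI4. pose proof (sqrt_lt_1 2 4 ltac:(lra) ltac:(lra) ltac:(lra)) as H1.
    replace 4 with (2 ^ 2) in H1 by ring. rewrite sqrt_pow2 in H1 by lra.
    pose proof (sqrt_lt_R0 2 ltac:(lra)). unfold Rdiv. rewrite Rmult_1_l. apply Rinv_le_contravar; lra. }
  destruct (Rle_dec t 1) as [h|h].
  - pose proof (sin_ge3 t ltac:(lra)). assert (t ^ 3 <= t) by nra. lra.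
  - destruct (Rle_dec t (PI / 2)) as [h2|h2].
    + pose proof (sin_incr_1 1 t ltac:(lra) ltac:(lra) ltac:(lra) ltac:(lra) ltac:(lra)). lra.
    + pose proof (sin_decr_1 t (3 * (PI / 4)) ltac:(lra) ltac:(lra) ltac:(lra) ltac:(lra) ltac:(lra)). lra.
Qed.

(** In this range b stays at distance at least PI / 2 from the other poles 2 PI and - 2 PI, so
    removing the pole at 0 leaves an error of order e. *)
Lemma Pk_near (e b : R) : 0 < e <= 1 -> Rabs b <= 3 * (PI / 2) ->
  Rabs (Pk e b - 2 * e / (e ^ 2 + b ^ 2)) <= 128 * e.
Proof.
  intros He Hb.
  assert (W : forall b, 0 <= b <= 3 * (PI / 2) -> Rabs (Pk e b - 2 * e / (e ^ 2 + b ^ 2)) <= 128 * e).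
  2:{ destruct (Rle_dec 0 b) as [h|h].
      - apply W. rewrite Rabs_pos_eq in Hb; lra.
      - rewrite Rabs_left in Hb by lra. pose proof (W (- b) ltac:(lra)) as Wb.
        unfold Pk in *. rewrite cos_neg in Wb. replace ((- b) ^ 2) with (b ^ 2) in Wb by ring. exact Wb. }
  clear b Hb. intros b Hb.
  pose proof (sinh_ge e ltac:(lra)) as S1. pose proof (sinh_le3 e ltac:(lra)) as S2.
  pose proof (cosh_ge e ltac:(lra)) as C1. pose proof (cosh_le4 e ltac:(lra)) as C2.
  pose proof (cos_ge2 b ltac:(lra)) as K1. pose proof (cos_le4 b ltac:(lra)) as K2.
  (* From 2 (1 - cos b) = 4 sin^2 (b/2) and [sin_ge_8]. The 64 here accounts for the constant
     128. *)
  assert (K3 : b ^ 2 / 64 <= 2 * (1 - cos b)).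
  { pose proof (sin_ge_8 (b / 2) ltac:(lra)) as Sb.
    replace (cos b) with (1 - 2 * sin (b / 2) * sin (b / 2)) by (rewrite <- cos_2a_sin; f_equal; field).
    assert ((b / 2 / 8) ^ 2 <= sin (b / 2) ^ 2) by (apply pow_incr; lra). nra. }
  set (s := sinh e) in *. set (E := 2 * (cosh e - 1)). set (B := 2 * (1 - cos b)) in *.
  assert (HE : e ^ 2 <= E <= e ^ 2 + e ^ 4 / 6) by (unfold E; lra).
  assert (HB : b ^ 2 - b ^ 4 / 12 <= B <= b ^ 2) by (unfold B; lra).
  assert (He2 : 0 < e ^ 2) by (apply pow_lt; lra).
  assert (Hb2 : 0 <= b ^ 2) by apply pow2_ge_0.
  pose (X := e ^ 2). pose (Y := b ^ 2).
  replace (e ^ 4) with (X ^ 2) in * by (unfold X; ring). replace (b ^ 4) with (Y ^ 2) in * by (unfold Y; ring).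
  fold X in HE, He2 |- *. fold Y in HB, Hb2, K3 |- *.
  assert (Hs : 0 <= s - e <= e * X / 3).
  { replace (e * X / 3) with (e ^ 3 / 3) by (unfold X; field). lra. }
  unfold Pk. fold s. replace (cosh e - cos b) with ((E + B) / 2) by (unfold E, B; field).
  assert (HEB : 0 < E + B) by lra.
  replace (s / ((E + B) / 2) - 2 * e / (X + Y))
    with (2 * ((s - e) * (X + Y) - e * ((E - X) + (B - Y))) / ((E + B) * (X + Y))) by (field; lra).
  assert (HD : 0 < (E + B) * (X + Y)) by (apply Rmult_lt_0_compat; lra).
  unfold Rdiv. rewrite Rabs_mult, Rabs_inv, (Rabs_pos_eq ((E + B) * (X + Y))) by lra.
  apply Rmult_le_reg_r with ((E + B) * (X + Y)); [easy|]. rewrite Rmult_assoc, Rinv_l, Rmult_1_r by lra.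
  apply Rle_trans with (2 * (e * (X + Y) ^ 2)).
  - assert (HXY : 0 <= X * Y) by (apply Rmult_le_pos; lra).
    assert (A1 : 0 <= (s - e) * (X + Y) <= e * ((X + Y) * X / 3)).
    { split; [apply Rmult_le_pos; lra|].
      replace (e * ((X + Y) * X / 3)) with (e * X / 3 * (X + Y)) by field. apply Rmult_le_compat_r; lra. }
    assert (A2 : - (Y ^ 2 / 12) <= (E - X) + (B - Y) <= X ^ 2 / 6) by lra.
    assert (A3 : e * - (Y ^ 2 / 12) <= e * ((E - X) + (B - Y)) <= e * (X ^ 2 / 6)) by (split; apply Rmult_le_compat_l; lra).
    assert (0 <= e * (X * Y)) by (apply Rmult_le_pos; lra).
    assert (0 <= e * X ^ 2) by (apply Rmult_le_pos; [lra|apply pow2_ge_0]).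
    assert (0 <= e * Y ^ 2) by (apply Rmult_le_pos; [lra|apply pow2_ge_0]).
    apply Rabs_le. split; lra.
  - replace (128 * e * ((E + B) * (X + Y))) with (2 * (e * (64 * (E + B) * (X + Y)))) by ring.
    apply Rmult_le_compat_l; [lra|]. apply Rmult_le_compat_l; [lra|].
    replace ((X + Y) ^ 2) with ((X + Y) * (X + Y)) by ring. apply Rmult_le_compat_r; lra.
Qed.

Lemma INR_two_pow (N : nat) : INR (2 ^ N) = 2 ^ N.
Proof. rewrite pow_INR. reflexivity. Qed.

Lemma sum_n_const_bound (f : nat -> R) (M : R) (n : nat) :
  (forall k, (k <= n)%nat -> Rabs (f k) <= M) -> Rabs (sum_n f n) <= INR (S n) * M.
Proof.
  intros H. eapply Rle_trans; [apply sum_n_Rabs|]. rewrite <- sum_n_const. now apply sum_n_Rle.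
Qed.

(** There are 2^N terms of weight 1/2^N, each with the error 128 a/2^N of [Pk_near]. This is the
    partial fraction expansion with a rate. *)
Lemma Pk_estimate (N : nat) (a b : R) : (1 <= N)%nat -> 0 < a <= 2 ^ N -> Rabs b <= 2 ^ N ->
  Rabs (Pk a b - sum_n (fun k => 2 * a / (a ^ 2 + (b - PI * 2 ^ N + 2 * PI * INR k) ^ 2)) (2 ^ N - 1)) <= 128 * a / 2 ^ N.
Proof.
  intros HN Ha Hb. pose proof PI_RGT_0 as Hpi. pose proof PI2_3_2 as Hpi2.
  assert (Hp : 0 < 2 ^ N) by (apply pow_lt; lra).
  assert (Hn : INR (S (2 ^ N - 1)) = 2 ^ N).
  { replace (S (2 ^ N - 1)) with (2 ^ N)%nat by (pose proof (Nat.pow_nonzero 2 N); lia). apply INR_two_pow. }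
  (* For N >= 1 the shift PI * 2^N is a multiple of 2 PI. It centres the sum, so that the scaled
     arguments stay within 3 PI/2. *)
  replace (Pk a b) with (Pk a (b - PI * 2 ^ N)).
  2:{ rewrite <- (Pk_periodic a (b - PI * 2 ^ N) (2 ^ (N - 1))). f_equal.
      rewrite INR_two_pow. destruct N as [|N]; [lia|]. simpl. rewrite Nat.sub_0_r. ring. }
  rewrite (Pk_dyadic N) by lra. rewrite <- sum_n_Rscal, <- sum_n_Rminus.
  replace (128 * a / 2 ^ N) with (INR (S (2 ^ N - 1)) * (/ 2 ^ N * (128 * (a / 2 ^ N)))) by (rewrite Hn; field; lra).
  apply sum_n_const_bound. intros k Hk.
  set (be := (b - PI * 2 ^ N + 2 * PI * INR k) / 2 ^ N).
  assert (Hbe : b - PI * 2 ^ N + 2 * PI * INR k = be * 2 ^ N) by (unfold be; field; lra).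
  rewrite Hbe.
  replace (2 * a / (a ^ 2 + (be * 2 ^ N) ^ 2)) with (/ 2 ^ N * (2 * (a / 2 ^ N) / ((a / 2 ^ N) ^ 2 + be ^ 2))).
  - rewrite <- Rmult_minus_distr_l, Rabs_mult, Rabs_pos_eq by (left; now apply Rinv_0_lt_compat).
    apply Rmult_le_compat_l; [left; now apply Rinv_0_lt_compat|]. apply Pk_near.
    + split; [apply Rdiv_lt_0_compat; lra|].
      apply Rmult_le_reg_r with (2 ^ N); [lra|]. unfold Rdiv. rewrite Rmult_assoc, Rinv_l; lra.
    + apply Rmult_le_reg_r with (2 ^ N); [lra|].
      rewrite <- (Rabs_pos_eq (2 ^ N)) at 1 by lra. rewrite <- Rabs_mult, <- Hbe.
      pose proof (pos_INR k) as Hk0.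
      assert (Hk1 : INR k <= 2 ^ N - 1).
      { rewrite <- Hn. rewrite S_INR. apply le_INR in Hk. lra. }
      apply Rabs_le_between in Hb.
      assert (PI * INR k <= PI * (2 ^ N - 1)) by (apply Rmult_le_compat_l; lra).
      assert (0 <= PI * INR k) by (apply Rmult_le_pos; lra).
      assert (2 * 2 ^ N <= PI * 2 ^ N) by (apply Rmult_le_compat_r; lra).
      apply Rabs_le. split; lra.
  - assert (0 < a ^ 2) by (apply pow_lt; lra). pose proof (pow2_ge_0 (be * 2 ^ N)) as Hq.
    assert (0 < (a / 2 ^ N) ^ 2) by (apply pow_lt, Rdiv_lt_0_compat; lra). pose proof (pow2_ge_0 be).
    assert (E : (a / 2 ^ N) ^ 2 + be ^ 2 = (a ^ 2 + (be * 2 ^ N) ^ 2) / (2 ^ N) ^ 2) by (field; lra).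
    rewrite E. field. repeat split; lra.
Qed.

Lemma sum_n_middle (u : nat -> R) (M : nat) : (1 <= M)%nat ->
  sum_n u (2 * M - 1) = sum_n (fun j => u (M + j)%nat + u (M - 1 - j)%nat) (M - 1).
Proof.
  intros HM.
  assert (H : forall k, (k <= M - 1)%nat ->
    sum_n (fun j => u (M + j)%nat + u (M - 1 - j)%nat) k = sum_n_m u (M - 1 - k) (M + k)).
  { induction k as [|k IH]; intros Hk.
    - rewrite sum_O. replace (M + 0)%nat with (S (M - 1)) by lia. rewrite sum_n_Sm by lia.
      replace (M - 1 - 0)%nat with (M - 1)%nat by lia. rewrite sum_n_n. unfold plus; simpl. ring.
    - rewrite sum_Sn, IH by lia. replace (M + S k)%nat with (S (M + k)) by lia.
      rewrite sum_n_Sm by lia. rewrite (sum_Sn_m u (M - 1 - S k)) by lia.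
      replace (S (M - 1 - S k)) with (M - 1 - k)%nat by lia. unfold plus; simpl. ring. }
  rewrite H by lia. unfold sum_n. f_equal; lia.
Qed.

Lemma is_lim_seq_pow2_inv : is_lim_seq (fun N => / 2 ^ N) 0.
Proof.
  apply is_lim_seq_ext with (fun N => (/ 2) ^ N); [intros; apply pow_inv|].
  apply is_lim_seq_geom. rewrite Rabs_pos_eq; lra.
Qed.

Lemma ex_series_inv_sqr : ex_series (fun n => / INR (S n) ^ 2).
Proof.
  apply (ex_series_incr_1 (fun n => / INR (S n) ^ 2)).
  apply ex_series_Rabs_le with (fun n => / INR (S n) - / INR (S (S n))).
  - intros n. pose proof (lt_0_INR (S n) ltac:(lia)) as H. rewrite (S_INR (S n)).
    set (x := INR (S n)) in *. rewrite Rabs_pos_eq by (left; apply Rinv_0_lt_compat, pow_lt; lra).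
    replace (/ x - / (x + 1)) with (/ (x * (x + 1))) by (field; lra).
    apply Rinv_le_contravar; nra.
  - exists 1. assert (L : is_lim_seq (sum_n (fun n => / INR (S n) - / INR (S (S n)))) 1); [|exact L].
    apply (is_lim_seq_ext (fun N => 1 - / (INR (S N) + 1))).
    + intros N. induction N as [|N IH].
      * rewrite sum_O. simpl. field.
      * rewrite sum_Sn, <- IH. rewrite (S_INR (S (S N))), (S_INR (S N)). pose proof (pos_INR (S N)). set (x := INR (S N)) in *. unfold plus; simpl. toR. field. lra.
    + replace (Finite 1) with (Finite (1 - 0)) by (f_equal; ring).
      apply is_lim_seq_minus'; [apply is_lim_seq_const|].
      apply (is_lim_seq_incr_1 (fun N => / (INR N + 1))), is_lim_seq_inv_S.
Qed.

Definition oddinv (n : nat) : R := / (2 * INR n + 1) ^ 2.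

Lemma ex_oddinv : ex_series oddinv.
Proof.
  apply ex_series_Rabs_le with (fun n => / INR (S n) ^ 2); [|apply ex_series_inv_sqr].
  intros n. unfold oddinv. pose proof (pos_INR n). rewrite S_INR.
  rewrite Rabs_pos_eq by (left; apply Rinv_0_lt_compat, pow_lt; lra).
  apply Rinv_le_contravar; [apply pow_lt; lra|]. apply pow_incr. lra.
Qed.

Lemma sum_oddinv_middle (N : nat) :
  sum_n (fun k => / (INR k * 2 + 1 - 2 ^ S N) ^ 2) (2 ^ S N - 1) = 2 * sum_n oddinv (2 ^ N - 1).
Proof.
  assert (HM : (1 <= 2 ^ N)%nat) by (pose proof (Nat.pow_nonzero 2 N); lia).
  replace (2 ^ S N - 1)%nat with (2 * 2 ^ N - 1)%nat by (rewrite Nat.pow_succ_r'; lia).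
  rewrite sum_n_middle by easy. rewrite <- sum_n_Rscal. apply sum_n_Rext. intros j Hj.
  rewrite plus_INR, minus_INR, minus_INR, INR_two_pow by lia. simpl (INR 1). rewrite <- (tech_pow_Rmult 2 N).
  unfold oddinv. replace ((2 ^ N + INR j) * 2 + 1 - 2 * 2 ^ N) with (2 * INR j + 1) by ring.
  replace ((2 ^ N - 1 - INR j) * 2 + 1 - 2 * 2 ^ N) with (- (2 * INR j + 1)) by ring.
  replace ((- (2 * INR j + 1)) ^ 2) with ((2 * INR j + 1) ^ 2) by ring. ring.
Qed.

Lemma is_lim_seq_dyadic (u : nat -> R) : ex_series u -> is_lim_seq (fun N => sum_n u (2 ^ N - 1)) (Series u).
Proof.
  intros H. apply (is_lim_seq_subseq (sum_n u) (Series u) (fun N => (2 ^ N - 1)%nat)); [|now apply Series_is_lim].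
  apply eventually_subseq. intros n. pose proof (Nat.pow_nonzero 2 n). rewrite Nat.pow_succ_r'. lia.
Qed.

(** Read off from [Pk_estimate] at b = PI as a = 1/2^(N+1) tends to 0: [Pk a PI / a] tends to 1/2,
    while the sum divided by a tends to 4/PI^2 times the series. *)
Lemma Series_oddinv : Series oddinv = PI ^ 2 / 8.
Proof.
  pose proof PI_RGT_0 as Hpi. pose proof PI2_3_2 as Hpi2.
  pose (t := fun N => sum_n (fun k => 2 / (PI * (INR k * 2 + 1 - 2 ^ S N)) ^ 2) (2 ^ S N - 1)).
  assert (Et : forall N, t N = 4 / PI ^ 2 * sum_n oddinv (2 ^ N - 1)).
  { intros N. unfold t. transitivity (2 / PI ^ 2 * (2 * sum_n oddinv (2 ^ N - 1))); [|toR; field; lra].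
    rewrite <- sum_oddinv_middle, <- sum_n_Rscal. apply sum_n_Rext. intros k _.
    rewrite Rpow_mult_distr. unfold Rdiv. rewrite Rinv_mult. ring. }
  assert (L1 : is_lim_seq t (4 / PI ^ 2 * Series oddinv)).
  { apply is_lim_seq_ext with (fun N => 4 / PI ^ 2 * sum_n oddinv (2 ^ N - 1)); [intros; now rewrite Et|].
    apply is_lim_seq_mult'; [apply is_lim_seq_const|apply is_lim_seq_dyadic, ex_oddinv]. }
  (* 131 = 128 + 2 + 1: the error of [Pk_estimate], the removal of a^2 from the denominators, and
     the expansion of [Pk a PI]. *)
  assert (B : forall N, (1 <= N)%nat -> Rabs (t N - / 2) <= 131 * / 2 ^ S N).
  { intros N HN. set (a := / 2 ^ S N).
    assert (Hp : 2 <= 2 ^ S N) by (cbn [pow]; pose proof (pow_R1_Rle 2 N); lra).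
    assert (Ha : 0 < a <= / 2) by (unfold a; split; [apply Rinv_0_lt_compat; lra|apply Rinv_le_contravar; lra]).
    assert (Hn : INR (S (2 ^ S N - 1)) = / a).
    { unfold a. rewrite Rinv_inv, <- INR_two_pow. f_equal. pose proof (Nat.pow_nonzero 2 (S N)); lia. }
    pose proof (PI_4) as HP4.
    assert (B1 : Rabs (Pk a PI - sum_n (fun k => 2 * a / (a ^ 2 + (PI * (INR k * 2 + 1 - 2 ^ S N)) ^ 2)) (2 ^ S N - 1)) <= 128 * a * a).
    { destruct N as [|N']; [lia|].
      replace (128 * a * a) with (128 * a / 2 ^ S (S N')) by (unfold a, Rdiv; ring).
      assert (H1 : 0 < a <= 2 ^ S (S N')) by lra.
      assert (H2 : Rabs PI <= 2 ^ S (S N')).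
      { rewrite Rabs_pos_eq by lra. cbn [pow]. pose proof (pow_R1_Rle 2 N'). lra. }
      pose proof (Pk_estimate (S (S N')) a PI ltac:(lia) H1 H2) as Q.
      rewrite (sum_n_Rext _ (fun k => 2 * a / (a ^ 2 + (PI * (INR k * 2 + 1 - 2 ^ S (S N'))) ^ 2))) in Q; [exact Q|].
      intros k _. cbv beta. do 3 f_equal. ring. }
    assert (B2 : Rabs (/ a * sum_n (fun k => 2 * a / (a ^ 2 + (PI * (INR k * 2 + 1 - 2 ^ S N)) ^ 2)) (2 ^ S N - 1) - t N) <= 2 * a).
    { unfold t. rewrite <- sum_n_Rscal, <- sum_n_Rminus.
      apply Rle_trans with (INR (S (2 ^ S N - 1)) * (2 * (a * a))); [|rewrite Hn; right; field; lra].
      apply sum_n_const_bound. intros k Hk. cbv beta.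
      set (c := PI * (INR k * 2 + 1 - 2 ^ S N)).
      assert (Hc : 1 <= c ^ 2).
      { assert (Hi : 1 <= (INR k * 2 + 1 - 2 ^ S N) ^ 2).
        { destruct (le_lt_dec (2 ^ N) k) as [h|h].
          - apply le_INR in h. rewrite INR_two_pow in h. cbn [pow]. nra.
          - assert (h' : (k + 1 <= 2 ^ N)%nat) by lia. apply le_INR in h'. rewrite plus_INR, INR_two_pow in h'. simpl (INR 1) in h'. cbn [pow]. nra. }
        unfold c. rewrite Rpow_mult_distr. assert (1 <= PI ^ 2) by nra. nra. }
      assert (Ha2 : 0 < a ^ 2) by (apply pow_lt; lra).
      assert (Hc0 : c <> 0) by (intros Ec; rewrite Ec in Hc; lra).
      replace (/ a * (2 * a / (a ^ 2 + c ^ 2)) - 2 / c ^ 2) with (- (2 * (a * a) * / ((a ^ 2 + c ^ 2) * c ^ 2))) by (field; repeat split; auto; lra).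
      rewrite Rabs_Ropp, Rabs_mult, Rabs_inv, (Rabs_pos_eq (2 * (a * a))) by nra.
      rewrite <- (Rmult_1_r (2 * (a * a))) at 2. apply Rmult_le_compat_l; [nra|].
      rewrite <- Rinv_1. apply Rinv_le_contravar; [lra|]. rewrite Rabs_pos_eq by nra. nra. }
    assert (B3 : Rabs (/ a * Pk a PI - / 2) <= a).
    { unfold Pk. rewrite cos_PI.
      pose proof (sinh_ge a ltac:(lra)) as S1. pose proof (sinh_le3 a ltac:(lra)) as S2.
      pose proof (cosh_ge a ltac:(lra)) as C1. pose proof (cosh_le2 a ltac:(lra)) as C2. pose proof (pow2_ge_0 a).
      set (s := sinh a) in *. set (c := cosh a) in *.
      replace (/ a * (s / (c - -1)) - / 2) with ((2 * (s - a) - a * (c - 1)) / (2 * a * (c + 1))) by (field; lra).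
      assert (HD : 0 < 2 * a * (c + 1)) by (apply Rmult_lt_0_compat; lra).
      unfold Rdiv. rewrite Rabs_mult, Rabs_inv, (Rabs_pos_eq (2 * a * (c + 1))) by lra.
      apply Rmult_le_reg_r with (2 * a * (c + 1)); [easy|]. rewrite Rmult_assoc, Rinv_l, Rmult_1_r by lra.
      assert (0 <= a * (c - 1) <= a * a ^ 2) by (split; [apply Rmult_le_pos; lra|apply Rmult_le_compat_l; lra]).
      assert (a ^ 3 <= a ^ 2) by nra.
      assert (4 * a ^ 2 <= a * (2 * a * (c + 1))) by nra.
      replace (a * a ^ 2) with (a ^ 3) in * by ring.
      apply Rabs_le. split; lra. }
    set (S := sum_n _ _) in B1, B2.
    assert (B1' : Rabs (/ a * Pk a PI - / a * S) <= 128 * a).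
    { rewrite <- Rmult_minus_distr_l, Rabs_mult, Rabs_pos_eq by (left; apply Rinv_0_lt_compat; lra).
      replace (128 * a) with (/ a * (128 * a * a)) by (field; lra).
      apply Rmult_le_compat_l; [left; apply Rinv_0_lt_compat; lra|easy]. }
    apply Rabs_le_between in B1', B2, B3. apply Rabs_le. lra. }
  assert (L2 : is_lim_seq t (/ 2)).
  { apply is_lim_seq_ext with (fun N => / 2 + (t N - / 2)); [intros; ring|].
    replace (Finite (/ 2)) with (Finite (/ 2 + 0)) by (f_equal; ring).
    apply is_lim_seq_plus'; [apply is_lim_seq_const|]. apply (proj2 (is_lim_seq_abs_0 _)).
    apply is_lim_seq_le_le_loc with (fun _ => 0) (fun N => 131 * / 2 ^ S N).
    - exists 1%nat. intros N HN. split; [apply Rabs_pos|now apply B].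
    - apply is_lim_seq_const.
    - replace (Finite 0) with (Finite (131 * 0)) by (f_equal; ring).
      apply is_lim_seq_mult'; [apply is_lim_seq_const|].
      apply (is_lim_seq_incr_1 (fun N => / 2 ^ N)), is_lim_seq_pow2_inv. }
  apply is_lim_seq_unique in L1. apply is_lim_seq_unique in L2. rewrite L1 in L2. apply Rbar_finite_eq in L2 as E.
  assert (0 < PI ^ 2) by (apply pow_lt; lra).
  apply (Rmult_eq_reg_l (4 / PI ^ 2)); [rewrite E; field; lra|].
  apply Rgt_not_eq, Rdiv_lt_0_compat; lra.
Qed.

Lemma Series_inv_sqr : Series (fun n => / INR (S n) ^ 2) = PI ^ 2 / 6.
Proof.
  pose proof (Series_even_odd _ ex_series_inv_sqr) as E. cbv beta in E.
  rewrite (Series_ext (fun n => / INR (S (2 * n)) ^ 2 + / INR (S (2 * n + 1)) ^ 2)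
             (fun n => oddinv n + / 4 * / INR (S n) ^ 2)) in E.
  - rewrite Series_plus, Series_scal_l, Series_oddinv in E; [lra|apply ex_oddinv|apply ex_series_scal_R, ex_series_inv_sqr].
  - intros n. unfold oddinv. pose proof (pos_INR n). rewrite !S_INR, plus_INR, mult_INR. simpl (INR 2). simpl (INR 1).
    f_equal. field. lra.
Qed.

(** * The two integrals *)

Definition integrand (alpha delta x : R) : R :=
  sin (2 * x) * Pk (x / alpha) (ln (2 * cos x) / alpha + delta).

(* The poles c = 2 PI alpha m - alpha delta, m integer, of z |-> cot ((z + alpha delta)/(2 alpha)). *)
Definition pole (alpha delta : R) (N k : nat) : R := - alpha * (delta - PI * 2 ^ N + 2 * PI * INR k).

Lemma exp_opp_le_sqr (t : R) : 0 < t -> exp (- t) <= 4 / t ^ 2.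
Proof.
  intros H. rewrite exp_Ropp.
  assert (E : exp t = exp (t / 2) ^ 2) by (simpl; rewrite Rmult_1_r, <- exp_plus; f_equal; field).
  pose proof (exp_ineq1 (t / 2) ltac:(lra)) as H1.
  replace (4 / t ^ 2) with (/ (t / 2) ^ 2) by (field; lra).
  apply Rinv_le_contravar; [apply pow_lt; lra|]. rewrite E. apply pow_incr. lra.
Qed.

Lemma ln2_lt_1 : ln 2 < 1.
Proof. rewrite <- (ln_exp 1). apply ln_increasing; [lra|]. pose proof (exp_ineq1 1). lra. Qed.

Lemma term_Jf (alpha delta x : R) (N k : nat) : 0 < alpha -> 0 < x < PI / 2 ->
  sin (2 * x) * (2 * (x / alpha) / ((x / alpha) ^ 2
     + (ln (2 * cos x) / alpha + delta - PI * 2 ^ N + 2 * PI * INR k) ^ 2))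
  = 2 * alpha * Jf (pole alpha delta N k) x.
Proof.
  intros Ha Hx. unfold Jf, den, eta.
  assert (E : ln (2 * cos x) - pole alpha delta N k
     = alpha * (ln (2 * cos x) / alpha + delta - PI * 2 ^ N + 2 * PI * INR k)) by (unfold pole; field; lra).
  rewrite E. set (b := ln (2 * cos x) / alpha + delta - PI * 2 ^ N + 2 * PI * INR k).
  assert (0 < x ^ 2) by (apply pow_lt; lra). pose proof (pow2_ge_0 (alpha * b)). pose proof (pow2_ge_0 b).
  assert (0 < (x / alpha) ^ 2) by (apply pow_lt, Rdiv_lt_0_compat; lra).
  assert (E2 : (x / alpha) ^ 2 + b ^ 2 = ((alpha * b) ^ 2 + x ^ 2) / alpha ^ 2) by (field; lra).
  rewrite E2. field. repeat split; lra.
Qed.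

Lemma Pk_bound (a b d : R) : 0 < d -> d <= a -> 0 <= Pk a b <= 1 + 2 / d ^ 2.
Proof.
  intros Hd Ha. unfold Pk. pose proof (sinh_gt_0 a ltac:(lra)) as Hs. pose proof (sinh_lt_cosh a) as Hc.
  pose proof (cosh_ge a ltac:(lra)) as Hg. pose proof (COS_bound b).
  assert (Hd2 : 0 < d ^ 2) by (apply pow_lt; lra). assert (d ^ 2 <= a ^ 2) by (apply pow_incr; lra).
  split; [apply Rlt_le, Rdiv_lt_0_compat; lra|].
  apply Rmult_le_reg_r with (cosh a - cos b); [lra|]. unfold Rdiv at 1. rewrite Rmult_assoc, Rinv_l, Rmult_1_r by lra.
  apply Rle_trans with ((1 + 2 / d ^ 2) * (cosh a - 1)).
  - assert (1 <= 2 / d ^ 2 * (cosh a - 1)).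
    { apply Rle_trans with (2 / d ^ 2 * (d ^ 2 / 2)); [right; field; lra|].
      apply Rmult_le_compat_l; [apply Rlt_le, Rdiv_lt_0_compat; lra|lra]. }
    lra.
  - apply Rmult_le_compat_l; [|lra]. assert (0 < 2 / d ^ 2) by (apply Rdiv_lt_0_compat; lra). lra.
Qed.

Lemma near_end (x : R) : 0 <= x < PI / 2 -> ln (2 * cos x) < - 1 ->
  1 <= x /\ 0 <= sin (2 * x) <= exp (ln (2 * cos x)).
Proof.
  intros Hx Hy. pose proof (cos_pos_dom x Hx) as Hc. rewrite exp_ln by lra.
  assert (2 * cos x < 1).
  { rewrite <- (exp_ln (2 * cos x)) by lra. rewrite <- exp_0. apply exp_increasing. lra. }
  pose proof (cos_ge2 x ltac:(lra)). pose proof (SIN_bound x). split; [nra|].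
  rewrite sin_2a. pose proof (sin_ge_0 x ltac:(lra) ltac:(lra)). split; nra.
Qed.

Section Integral.
Context (alpha delta : R) (Ha : 0 < alpha) (Hdelta : 0 <= delta <= PI).
(** At x = 0 the denominator of the kernel is 1 - cos (ln 2 / alpha + delta); it must not vanish for
    the integrand to be continuous there. *)
Context (H0 : cos (ln 2 / alpha + delta) <> 1).

Lemma integrand_cont (x : R) : 0 <= x < PI / 2 -> continuous (integrand alpha delta) x.
Proof.
  intros Hx. pose proof (cos_pos_dom x Hx) as Hc.
  apply (ex_derive_continuous (V := R_NormedModule)). unfold integrand, Pk. auto_derive.
  split; [lra|]. split; [|easy].
  destruct (Req_dec x 0) as [->|h].
  - unfold Rdiv. rewrite Rmult_0_l, cosh_0, cos_0, Rmult_1_r. intros E. apply H0. unfold Rdiv. lra.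
  - pose proof (cosh_gt_1 (x / alpha) ltac:(apply Rdiv_lt_0_compat; lra)).
    match goal with |- _ + - cos ?t <> 0 => pose proof (COS_bound t) end. unfold Rdiv in *. lra.
Qed.

Lemma integrand_tail (x : R) : 0 <= x < PI / 2 -> ln (2 * cos x) < - 1 ->
  Rabs (integrand alpha delta x) <= exp (ln (2 * cos x)) * (1 + 2 * alpha ^ 2).
Proof.
  intros Hx Hy. destruct (near_end x Hx Hy) as [H1 H2]. unfold integrand.
  assert (B : 0 <= Pk (x / alpha) (ln (2 * cos x) / alpha + delta) <= 1 + 2 / (/ alpha) ^ 2).
  { apply Pk_bound; [now apply Rinv_0_lt_compat|]. unfold Rdiv. pose proof (Rinv_0_lt_compat _ Ha). nra. }
  replace (2 / (/ alpha) ^ 2) with (2 * alpha ^ 2) in B by (field; lra).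
  rewrite Rabs_mult, !Rabs_pos_eq by lra. apply Rmult_le_compat; lra.
Qed.

Lemma ex_RInt_integrand : ex_RInt (integrand alpha delta) 0 (PI / 2).
Proof.
  apply ex_RInt_eta with 0 (1 + 2 * alpha ^ 2) 1; [lra|apply integrand_cont|].
  intros x Hx He. unfold eta in *. rewrite Rminus_0_r in *.
  eapply Rle_trans; [now apply integrand_tail|]. unfold Rdiv. rewrite (Rmult_comm (1 + _)).
  apply Rmult_le_compat_r; [pose proof (pow2_ge_0 alpha); lra|].
  set (y := ln (2 * cos x)) in *. replace y with (- - y) at 1 by ring. apply exp_neg_le. lra.
Qed.

Definition partial (N : nat) (x : R) : R := sum_n (fun k => 2 * alpha * Jf (pole alpha delta N k) x) (2 ^ N - 1).

Lemma partial_eq (N : nat) (x : R) : 0 < x < PI / 2 ->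
  partial N x = sin (2 * x) * sum_n (fun k => 2 * (x / alpha) / ((x / alpha) ^ 2
     + (ln (2 * cos x) / alpha + delta - PI * 2 ^ N + 2 * PI * INR k) ^ 2)) (2 ^ N - 1).
Proof.
  intros Hx. unfold partial. rewrite <- sum_n_Rscal. apply sum_n_Rext. intros k _. symmetry. now apply term_Jf.
Qed.

Let K := 256 / alpha + 4 * (1 + 2 * alpha ^ 2 + 2 * alpha) / alpha ^ 2.

(** While |b| <= 2^N, [Pk_estimate] applies, with 256 = 128 * 2 from x <= 2. Otherwise x is so close
    to PI / 2 that sin 2x is below exp (- alpha 2^N); the bound 4/(alpha 2^N)^2 for it beats the 2^N
    terms of the sum by one power of 2^N. *)
Lemma partial_uniform (N : nat) (x : R) : (1 <= N)%nat -> 2 / alpha + 4 <= 2 ^ N -> 0 < x < PI / 2 ->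
  Rabs (integrand alpha delta x - partial N x) <= K / 2 ^ N.
Proof.
  intros HN Hbig Hx. pose proof PI_4 as HP. pose proof ln2_lt_1 as Hl. pose proof PI_RGT_0 as Hpi.
  assert (Hia : 0 < / alpha) by now apply Rinv_0_lt_compat.
  assert (Hp : 0 < 2 ^ N) by (apply pow_lt; lra). assert (Hip := Rinv_0_lt_compat _ Hp).
  assert (Hxa : 0 < x / alpha <= 2 * / alpha).
  { split; [apply Rdiv_lt_0_compat; lra|]. unfold Rdiv. apply Rmult_le_compat_r; lra. }
  assert (Hpow : 0 < alpha ^ 2) by (apply pow_lt; lra).
  rewrite partial_eq by easy. unfold integrand.
  set (b := ln (2 * cos x) / alpha + delta).
  set (S := sum_n _ _).
  rewrite <- Rmult_minus_distr_l, Rabs_mult.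
  assert (Hs1 : Rabs (sin (2 * x)) <= 1) by apply Rabs_sin_le.
  destruct (Rle_dec (Rabs b) (2 ^ N)) as [h|h].
  - pose proof (Pk_estimate N (x / alpha) b HN ltac:(unfold Rdiv in *; lra) h) as B. fold S in B.
    apply Rle_trans with (1 * (128 * (x / alpha) / 2 ^ N)).
    + apply Rmult_le_compat; auto using Rabs_pos.
    + rewrite Rmult_1_l. unfold Rdiv at 1 3. apply Rmult_le_compat_r; [lra|]. unfold K.
      assert (0 <= 4 * (1 + 2 * alpha ^ 2 + 2 * alpha) / alpha ^ 2) by (apply Rlt_le, Rdiv_lt_0_compat; lra).
      unfold Rdiv in *. lra.
  - pose proof (eta_upper 0 x ltac:(lra)) as Hy. unfold eta in Hy. rewrite !Rminus_0_r in Hy.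
    assert (Hb : b < - 2 ^ N).
    { destruct (Rle_dec 0 b) as [h0|h0].
      - rewrite Rabs_pos_eq in h by easy. exfalso. apply h. unfold b, Rdiv.
        assert (ln (2 * cos x) * / alpha <= 1 * / alpha) by (apply Rmult_le_compat_r; lra). unfold Rdiv in Hbig. lra.
      - rewrite Rabs_left in h by lra. lra. }
    set (y := ln (2 * cos x)) in *.
    assert (Hyn : y < - (alpha * 2 ^ N)).
    { assert (alpha * b < alpha * - 2 ^ N) by (apply Rmult_lt_compat_l; lra).
      replace (alpha * b) with (y + alpha * delta) in H by (unfold b; field; lra).
      assert (0 <= alpha * delta) by (apply Rmult_le_pos; lra). lra. }
    assert (Ha2 : 2 <= alpha * 2 ^ N).
    { apply Rle_trans with (alpha * (2 / alpha + 4)); [|apply Rmult_le_compat_l; lra].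
      replace (alpha * (2 / alpha + 4)) with (2 + 4 * alpha) by (field; lra). lra. }
    destruct (near_end x ltac:(lra) ltac:(fold y; lra)) as [H1 H2]. fold y in H2.
    assert (Hda : / alpha <= x / alpha) by (unfold Rdiv; nra).
    pose proof (Pk_bound (x / alpha) b (/ alpha) Hia Hda) as B.
    replace (2 / (/ alpha) ^ 2) with (2 * alpha ^ 2) in B by (field; lra).
    assert (BS : Rabs S <= 2 ^ N * (2 * alpha)).
    { assert (HnN : INR (Datatypes.S (2 ^ N - 1)) = 2 ^ N).
      { rewrite <- INR_two_pow. f_equal. pose proof (Nat.pow_nonzero 2 N). lia. }
      rewrite <- HnN at 1. unfold S.
      - apply sum_n_const_bound. intros k _. set (q := b - PI * 2 ^ N + 2 * PI * INR k).
        pose proof (pow2_ge_0 q). set (t := x / alpha) in *. assert (0 < t ^ 2) by (apply pow_lt; lra).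
        rewrite Rabs_pos_eq by (apply Rlt_le, Rdiv_lt_0_compat; lra).
        apply Rmult_le_reg_r with (t ^ 2 + q ^ 2); [lra|]. unfold Rdiv at 1. rewrite Rmult_assoc, Rinv_l, Rmult_1_r by lra.
        assert (1 <= alpha * t) by (unfold t; replace (alpha * (x / alpha)) with x by (field; lra); lra).
        assert (t <= alpha * t ^ 2) by nra. assert (0 <= alpha * q ^ 2) by (apply Rmult_le_pos; lra). lra. }
    assert (BP : Rabs (Pk (x / alpha) b - S) <= 1 + 2 * alpha ^ 2 + 2 ^ N * (2 * alpha)).
    { unfold Rminus. eapply Rle_trans; [apply Rabs_triang|]. rewrite Rabs_Ropp, (Rabs_pos_eq (Pk _ _)) by lra. lra. }
    assert (Be : Rabs (sin (2 * x)) <= 4 / (alpha * 2 ^ N) ^ 2).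
    { rewrite Rabs_pos_eq by lra. eapply Rle_trans; [apply H2|].
      apply Rle_trans with (exp (- (alpha * 2 ^ N))); [left; now apply exp_increasing|]. apply exp_opp_le_sqr. lra. }
    apply Rle_trans with (4 / (alpha * 2 ^ N) ^ 2 * (1 + 2 * alpha ^ 2 + 2 ^ N * (2 * alpha))).
    { apply Rmult_le_compat; auto using Rabs_pos. }
    apply Rle_trans with (4 / (alpha * 2 ^ N) ^ 2 * (2 ^ N * (1 + 2 * alpha ^ 2 + 2 * alpha))).
    + apply Rmult_le_compat_l; [apply Rlt_le, Rdiv_lt_0_compat; [lra|apply pow_lt; lra]|].
      assert (1 <= 2 ^ N) by (apply pow_R1_Rle; lra). assert (0 <= 2 * alpha ^ 2 * (2 ^ N - 1)) by (apply Rmult_le_pos; lra). lra.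
    + replace (4 / (alpha * 2 ^ N) ^ 2 * (2 ^ N * (1 + 2 * alpha ^ 2 + 2 * alpha)))
        with (4 * (1 + 2 * alpha ^ 2 + 2 * alpha) / alpha ^ 2 / 2 ^ N) by (field; lra).
      unfold Rdiv at 1 3. apply Rmult_le_compat_r; [lra|]. unfold K.
      assert (0 < 256 / alpha) by (apply Rdiv_lt_0_compat; lra). lra.
Qed.

(** The level N = 0 is left out: its shift PI is not a multiple of 2 PI, so [pole] is then not a
    pole of the kernel and might equal ln 2. *)
Lemma integral_limit : (forall N k, (1 <= N)%nat -> pole alpha delta N k <> ln 2) ->
  is_lim_seq (fun N => sum_n (fun k => 2 * alpha * J (pole alpha delta N k)) (2 ^ N - 1))
    (RInt (integrand alpha delta) 0 (PI / 2)).
Proof.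
  intros Hpole. pose proof PI_RGT_0 as Hpi. pose proof ex_RInt_integrand as Hex.
  set (I := RInt _ _ _).
  assert (HP : forall N, (1 <= N)%nat -> is_RInt (partial N) 0 (PI / 2) (sum_n (fun k => 2 * alpha * J (pole alpha delta N k)) (2 ^ N - 1))).
  { intros N HN. unfold partial. apply (is_RInt_sum_n (fun k x => 2 * alpha * Jf (pole alpha delta N k) x)).
    intros k. apply (is_RInt_scal (V := R_NormedModule)). now apply J_is_RInt, Hpole. }
  apply is_lim_seq_ext with (fun N => I + (sum_n (fun k => 2 * alpha * J (pole alpha delta N k)) (2 ^ N - 1) - I)).
  { intros; toR; ring. }
  replace (Finite I) with (Finite (I + 0)) by (f_equal; ring).
  apply is_lim_seq_plus'; [apply is_lim_seq_const|]. apply (proj2 (is_lim_seq_abs_0 _)).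
  apply is_lim_seq_le_le_loc with (fun _ => 0) (fun N => PI / 2 * (K * / 2 ^ N)).
  - destruct (Pow_x_infinity 2 ltac:(rewrite Rabs_pos_eq; lra) (2 / alpha + 4)) as [N0 HN0].
    exists (N0 + 1)%nat. intros N HN. split; [apply Rabs_pos|].
    rewrite Rabs_minus_sym.
    assert (E : I - sum_n (fun k => 2 * alpha * J (pole alpha delta N k)) (2 ^ N - 1)
       = RInt (fun x => integrand alpha delta x - partial N x) 0 (PI / 2)).
    { symmetry. apply is_RInt_unique. apply (is_RInt_minus (V := R_NormedModule)); [|apply HP; lia].
      now apply (RInt_correct (V := R_CompleteNormedModule)). }
    rewrite E. replace (PI / 2 * (K * / 2 ^ N)) with ((PI / 2 - 0) * (K / 2 ^ N)) by (unfold Rdiv; ring).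
    apply Rabs_RInt_le; [lra| |].
    + apply (ex_RInt_minus (V := R_NormedModule)); [easy|]. eexists; apply HP; lia.
    + intros x Hx. apply partial_uniform; [lia| |easy].
      specialize (HN0 N ltac:(lia)). rewrite Rabs_pos_eq in HN0 by (left; apply pow_lt; lra). lra.
  - apply is_lim_seq_const.
  - replace (Finite 0) with (Finite (PI / 2 * (K * 0))) by (f_equal; ring).
    apply is_lim_seq_mult'; [apply is_lim_seq_const|]. apply is_lim_seq_mult'; [apply is_lim_seq_const|apply is_lim_seq_pow2_inv].
Qed.

(** The dyadic sum of level N + 1 is folded about its middle index 2^N; this pairs the poles and
    turns the dyadic limit into an ordinary series. *)
Lemma integral_value (u : nat -> R) : (forall N k, (1 <= N)%nat -> pole alpha delta N k <> ln 2) ->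
  (forall j, u j = 2 * alpha * J (- alpha * (delta + 2 * PI * INR j))
                   + 2 * alpha * J (- alpha * (delta - 2 * PI * (INR j + 1)))) ->
  ex_series u -> is_RInt (integrand alpha delta) 0 (PI / 2) (Series u).
Proof.
  intros Hpole Hu Hex.
  assert (E : RInt (integrand alpha delta) 0 (PI / 2) = Series u).
  { pose proof (is_lim_seq_dyadic u Hex) as L1.
    pose proof (integral_limit Hpole) as L2. apply is_lim_seq_incr_1 in L2.
    apply (is_lim_seq_ext _ (fun N => sum_n u (2 ^ N - 1))) in L2.
    - apply is_lim_seq_unique in L1. apply is_lim_seq_unique in L2. rewrite L1 in L2. now apply Rbar_finite_eq in L2.
    - intros N. assert (HM : (1 <= 2 ^ N)%nat) by (pose proof (Nat.pow_nonzero 2 N); lia).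
      replace (2 ^ S N - 1)%nat with (2 * 2 ^ N - 1)%nat by (rewrite Nat.pow_succ_r'; lia).
      rewrite sum_n_middle by easy. apply sum_n_Rext. intros j Hj. rewrite Hu. unfold pole.
      rewrite plus_INR, !minus_INR, INR_two_pow by lia. simpl (INR 1). rewrite <- (tech_pow_Rmult 2 N).
      f_equal; do 2 f_equal; ring. }
  rewrite <- E. apply (RInt_correct (V := R_CompleteNormedModule)), ex_RInt_integrand.
Qed.

End Integral.

Lemma integrand_minus_eq (alpha x : R) : integrand alpha 0 x = integrand_minus alpha x.
Proof. unfold integrand, integrand_minus, Pk. rewrite Rplus_0_r. unfold Rdiv. ring. Qed.

Lemma integrand_plus_eq (alpha x : R) : integrand alpha PI x = integrand_plus alpha x.
Proof.
  unfold integrand, integrand_plus, Pk. rewrite neg_cos. unfold Rdiv.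
  replace (cosh (x * / alpha) - - cos (ln (2 * cos x) * / alpha)) with (cosh (x * / alpha) + cos (ln (2 * cos x) * / alpha)) by ring. ring.
Qed.

Lemma J_neg (c : R) : 0 < c -> J (- c) = PI / 4 * (/ c ^ 2 + exp (- c) - / 4 * / sinh (c / 2) ^ 2).
Proof.
  intros H. pose proof ln_lt_2. rewrite J_lt by lra.
  replace (- c / 2) with (- (c / 2)) by field. rewrite sinh_opp.
  replace ((- c) ^ 2) with (c ^ 2) by ring. replace ((- sinh (c / 2)) ^ 2) with (sinh (c / 2) ^ 2) by ring.
  rewrite Rinv_mult. reflexivity.
Qed.

Lemma cos_lt_1 (x : R) : 0 < x < 2 * PI -> cos x <> 1.
Proof.
  intros Hx E. replace x with (2 * (x / 2)) in E by field. rewrite cos_2a_sin in E.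
  pose proof (sin_gt_0 (x / 2) ltac:(lra) ltac:(lra)). nra.
Qed.

Lemma Series_exp_geom (q : R) : 0 < q -> ex_series (fun n => exp (- q) ^ n) /\ Series (fun n => exp (- q) ^ n) = / (1 - exp (- q)).
Proof.
  intros H. assert (Hq : Rabs (exp (- q)) < 1).
  { rewrite Rabs_pos_eq by (left; apply exp_pos). rewrite <- exp_0. apply exp_increasing. lra. }
  split; [now apply ex_series_geom|now apply Series_geom].
Qed.

(** These poles are the odd multiples of PI alpha, so the least positive one exceeds ln 2 by the
    lower bound on alpha. In [pole_minus_neq] they are the multiples of 2 PI alpha, hence the weaker
    bound. *)
Lemma pole_plus_neq (alpha : R) (N k : nat) : 0 < alpha -> ln 2 / PI < alpha -> (1 <= N)%nat -> pole alpha PI N k <> ln 2.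
Proof.
  intros Ha Hal HN. pose proof PI_RGT_0 as Hpi. pose proof ln_lt_2 as Hl.
  assert (H1 : ln 2 < PI * alpha).
  { apply Rmult_lt_compat_l with (r := PI) in Hal; [|lra]. replace (PI * (ln 2 / PI)) with (ln 2) in Hal by (field; lra). lra. }
  destruct N as [|N]; [lia|]. unfold pole. rewrite <- (tech_pow_Rmult 2 N).
  replace (- alpha * (PI - PI * (2 * 2 ^ N) + 2 * PI * INR k)) with (PI * alpha * (2 * (2 ^ N - INR k) - 1)) by ring.
  rewrite <- INR_two_pow.
  destruct (le_lt_dec (2 ^ N) k) as [h|h].
  - apply le_INR in h. nra.
  - assert (h' : (k + 1 <= 2 ^ N)%nat) by lia. apply le_INR in h'. rewrite plus_INR in h'. simpl (INR 1) in h'. nra.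
Qed.

Lemma pole_minus_neq (alpha : R) (N k : nat) : 0 < alpha -> ln 2 / (2 * PI) < alpha -> (1 <= N)%nat -> pole alpha 0 N k <> ln 2.
Proof.
  intros Ha Hal HN. pose proof PI_RGT_0 as Hpi. pose proof ln_lt_2 as Hl.
  assert (H1 : ln 2 < 2 * PI * alpha).
  { apply Rmult_lt_compat_l with (r := 2 * PI) in Hal; [|lra].
    replace (2 * PI * (ln 2 / (2 * PI))) with (ln 2) in Hal by (field; lra). lra. }
  destruct N as [|N]; [lia|]. unfold pole. rewrite <- (tech_pow_Rmult 2 N).
  replace (- alpha * (0 - PI * (2 * 2 ^ N) + 2 * PI * INR k)) with (2 * PI * alpha * (2 ^ N - INR k)) by ring.
  rewrite <- INR_two_pow.
  destruct (le_lt_dec (2 ^ N) k) as [h|h].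
  - apply le_INR in h. nra.
  - assert (h' : (k + 1 <= 2 ^ N)%nat) by lia. apply le_INR in h'. rewrite plus_INR in h'. simpl (INR 1) in h'. nra.
Qed.

(** The pair consists of - c and c, with c beyond ln 2. Both poles give 1/c^2, only the negative one
    gives exp (- c) and the csch^2. *)
Lemma pair_PI (alpha : R) (j : nat) : 0 < alpha -> ln 2 / PI < alpha ->
  2 * alpha * J (- alpha * (PI + 2 * PI * INR j)) + 2 * alpha * J (- alpha * (PI - 2 * PI * (INR j + 1)))
  = 2 * alpha * (PI / 4) * (2 / (PI * alpha) ^ 2 * oddinv j
      + exp (- (PI * alpha)) * exp (- (2 * (PI * alpha))) ^ j
      - / 4 * / sinh ((INR j + / 2) * (PI * alpha)) ^ 2).
Proof.
  intros Ha Hal. pose proof PI_RGT_0 as Hpi. pose proof (pos_INR j) as Hj.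
  assert (H1 : ln 2 < PI * alpha).
  { apply Rmult_lt_compat_l with (r := PI) in Hal; [|lra]. replace (PI * (ln 2 / PI)) with (ln 2) in Hal by (field; lra). lra. }
  assert (Ha' : 0 < PI * alpha) by now apply Rmult_lt_0_compat.
  set (c := PI * alpha * (2 * INR j + 1)).
  assert (Hc : PI * alpha <= c) by (unfold c; nra).
  replace (- alpha * (PI + 2 * PI * INR j)) with (- c) by (unfold c; ring).
  replace (- alpha * (PI - 2 * PI * (INR j + 1))) with c by (unfold c; ring).
  rewrite J_neg, J_gt by lra.
  replace ((INR j + / 2) * (PI * alpha)) with (c / 2) by (unfold c; field).
  rewrite <- exp_INR_mult, <- exp_plus.
  replace (- (PI * alpha) + INR j * - (2 * (PI * alpha))) with (- c) by (unfold c; ring).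
  replace (2 / (PI * alpha) ^ 2 * oddinv j) with (2 * / c ^ 2); [ring|].
  unfold c, oddinv. field. repeat split; lra.
Qed.

Lemma ex_inv_sinh_odd (a : R) : 0 < a -> ex_series (fun j => / sinh ((INR j + / 2) * a) ^ 2).
Proof.
  intros Ha. apply (ex_series_sh_bound a Ha _ (/ lat_sinh a 0)). intros n.
  change (Rabs (/ lat_sinh a n ^ 2) <= / lat_sinh a 0 / lat_sinh a n).
  pose proof (sh_pos a Ha n). pose proof (sh_pos a Ha 0). pose proof (sh_ge_sh0 a Ha n).
  rewrite Rabs_pos_eq by (left; apply Rinv_0_lt_compat, pow_lt; lra).
  unfold Rdiv. rewrite <- Rinv_mult. apply Rinv_le_contravar; [now apply Rmult_lt_0_compat|nra].
Qed.

Lemma ex_inv_sinh_even (a : R) : 0 < a -> ex_series (fun j => / sinh (INR (S j) * a) ^ 2).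
Proof. intros Ha. apply (ex_csch2 a Ha (fun j => j)). lia. Qed.

(** An Euler sum, a geometric series with exp (- a)/(1 - exp (- 2 a)) = 1/(2 sinh a), and a lattice
    sum. *)
Lemma series_PI (alpha : R) : 0 < alpha -> 
  is_series (fun j => 2 * alpha * (PI / 4) * (2 / (PI * alpha) ^ 2 * oddinv j
      + exp (- (PI * alpha)) * exp (- (2 * (PI * alpha))) ^ j
      - / 4 * / sinh ((INR j + / 2) * (PI * alpha)) ^ 2))
   (2 * alpha * (PI / 4) * (2 / (PI * alpha) ^ 2 * (PI ^ 2 / 8) + / (2 * sinh (PI * alpha))
      - / 4 * Series (fun j => / sinh ((INR j + / 2) * (PI * alpha)) ^ 2))).
Proof.
  intros Ha. pose proof PI_RGT_0 as Hpi. assert (Ha' : 0 < PI * alpha) by now apply Rmult_lt_0_compat.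
  set (a := PI * alpha) in *.
  destruct (Series_exp_geom (2 * a) ltac:(lra)) as [G1 G2].
  apply (is_series_scal (V := R_NormedModule)).
  apply (is_series_minus (V := R_NormedModule)).
  - apply (is_series_plus (V := R_NormedModule)).
    + apply (is_series_scal (V := R_NormedModule)). rewrite <- Series_oddinv. apply Series_correct, ex_oddinv.
    + replace (/ (2 * sinh a)) with (scal (exp (- a)) (Series (fun n => exp (- (2 * a)) ^ n))).
      * apply (is_series_scal (V := R_NormedModule)). now apply Series_correct.
      * rewrite G2. unfold scal; simpl. unfold mult; simpl.
        pose proof (sinh_gt_0 a Ha') as Hs. unfold sinh in *.
        replace (exp (- (2 * a))) with (exp (- a) * exp (- a)) by (rewrite <- exp_plus; f_equal; ring).
        pose proof (exp_mult_opp a) as E. pose proof (exp_pos (- a)) as Hp.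
        set (u := exp a) in *. set (v := exp (- a)) in *.
        assert (v <> 0) by lra. assert (Eu : u = / v) by (apply (Rmult_eq_reg_r v); [rewrite E; field|]; auto).
        rewrite Eu in *. assert (0 < 1 - v * v).
        { assert (0 < (/ v - v) / 2 * (2 * v)) by (apply Rmult_lt_0_compat; lra).
          replace ((/ v - v) / 2 * (2 * v)) with (1 - v * v) in H0 by (field; auto). lra. }
        field. repeat split; auto; lra.
  - apply (is_series_scal (V := R_NormedModule)). apply Series_correct, ex_inv_sinh_odd, Ha'.
Qed.

Lemma pair_0 (alpha : R) (j : nat) : 0 < alpha -> ln 2 / (2 * PI) < alpha ->
  2 * alpha * J (- alpha * (0 - 2 * PI * (INR j + 1))) = 2 * alpha * (PI / 4) * (/ (2 * (PI * alpha)) ^ 2 * / INR (S j) ^ 2).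
Proof.
  intros Ha Hal. pose proof PI_RGT_0 as Hpi. pose proof (pos_INR j) as Hj.
  assert (H1 : ln 2 < 2 * PI * alpha).
  { apply Rmult_lt_compat_l with (r := 2 * PI) in Hal; [|lra].
    replace (2 * PI * (ln 2 / (2 * PI))) with (ln 2) in Hal by (field; lra). lra. }
  assert (Ha' : 0 < PI * alpha) by now apply Rmult_lt_0_compat.
  rewrite J_gt by nra. rewrite S_INR. field. repeat split; lra.
Qed.

Lemma neg_0 (alpha : R) (j : nat) : 0 < alpha ->
  2 * alpha * J (- alpha * (0 + 2 * PI * INR (S j)))
  = 2 * alpha * (PI / 4) * (/ (2 * (PI * alpha)) ^ 2 * / INR (S j) ^ 2
      + exp (- (2 * (PI * alpha))) * exp (- (2 * (PI * alpha))) ^ j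
      - / 4 * / sinh (INR (S j) * (PI * alpha)) ^ 2).
Proof.
  intros Ha. pose proof PI_RGT_0 as Hpi. pose proof (lt_0_INR (S j) ltac:(lia)) as Hj.
  assert (Ha' : 0 < PI * alpha) by now apply Rmult_lt_0_compat.
  set (c := 2 * (PI * alpha) * INR (S j)).
  assert (Hc : 0 < c) by (unfold c; apply Rmult_lt_0_compat; lra).
  replace (- alpha * (0 + 2 * PI * INR (S j))) with (- c) by (unfold c; ring).
  rewrite J_neg by easy.
  replace (INR (S j) * (PI * alpha)) with (c / 2) by (unfold c; field).
  rewrite <- exp_INR_mult, <- exp_plus.
  replace (- (2 * (PI * alpha)) + INR j * - (2 * (PI * alpha))) with (- c) by (unfold c; rewrite S_INR; ring).
  replace (/ (2 * (PI * alpha)) ^ 2 * / INR (S j) ^ 2) with (/ c ^ 2); [ring|].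
  unfold c. field. repeat split; lra.
Qed.

(** The index 0 is the pole at the origin, with the value [J_0]. The geometric series is exp (- 2
    a)/(1 - exp (- 2 a)) = (coth a - 1)/2, which brings in the - / 2. *)
Lemma series_neg_0 (alpha : R) : 0 < alpha ->
  is_series (fun j => 2 * alpha * J (- alpha * (0 + 2 * PI * INR j)))
   (2 * alpha * (PI / 4) * (13 / 12 + (/ (2 * (PI * alpha)) ^ 2 * (PI ^ 2 / 6) + (/ (2 * tanh (PI * alpha)) - / 2)
      - / 4 * Series (fun j => / sinh (INR (S j) * (PI * alpha)) ^ 2)))).
Proof.
  intros Ha. pose proof PI_RGT_0 as Hpi. assert (Ha' : 0 < PI * alpha) by now apply Rmult_lt_0_compat.
  apply (is_series_decr_1 (V := R_NormedModule)).
  apply is_series_ext with (fun j => 2 * alpha * (PI / 4) * (/ (2 * (PI * alpha)) ^ 2 * / INR (S j) ^ 2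
      + exp (- (2 * (PI * alpha))) * exp (- (2 * (PI * alpha))) ^ j
      - / 4 * / sinh (INR (S j) * (PI * alpha)) ^ 2)).
  { intros j. symmetry. now apply neg_0. }
  replace (- alpha * (0 + 2 * PI * INR 0)) with 0 by (simpl; ring). rewrite J_0.
  set (a := PI * alpha) in *.
  match goal with |- is_series _ ?l => replace l with (scal (2 * alpha * (PI / 4))
    (minus (plus (scal (/ (2 * a) ^ 2) (PI ^ 2 / 6)) (/ (2 * tanh a) - / 2)) (scal (/ 4) (Series (fun j => / sinh (INR (S j) * a) ^ 2))))) end.
  2:{ unfold scal, minus, plus, opp; simpl. unfold mult; simpl. toR. ring. }
  destruct (Series_exp_geom (2 * a) ltac:(lra)) as [G1 G2].
  apply (is_series_scal (V := R_NormedModule)).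
  apply (is_series_minus (V := R_NormedModule)).
  - apply (is_series_plus (V := R_NormedModule)).
    + apply (is_series_scal (V := R_NormedModule)). rewrite <- Series_inv_sqr. apply Series_correct, ex_series_inv_sqr.
    + replace (/ (2 * tanh a) - / 2) with (scal (exp (- (2 * a))) (Series (fun n => exp (- (2 * a)) ^ n))).
      * apply (is_series_scal (V := R_NormedModule)). now apply Series_correct.
      * rewrite G2. unfold scal; simpl. unfold mult; simpl.
        pose proof (sinh_gt_0 a Ha') as Hs. pose proof (cosh_gt_0 a) as Hch. unfold tanh. unfold sinh, cosh in *.
        replace (exp (- (2 * a))) with (exp (- a) * exp (- a)) by (rewrite <- exp_plus; f_equal; ring).
        pose proof (exp_mult_opp a) as E. pose proof (exp_pos (- a)) as Hp.
        set (u := exp a) in *. set (v := exp (- a)) in *.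
        assert (v <> 0) by lra. assert (Eu : u = / v) by (apply (Rmult_eq_reg_r v); [rewrite E; field|]; auto).
        rewrite Eu in *. assert (0 < 1 - v * v).
        { assert (0 < (/ v - v) / 2 * (2 * v)) by (apply Rmult_lt_0_compat; lra).
          replace ((/ v - v) / 2 * (2 * v)) with (1 - v * v) in H0 by (field; auto). lra. }
        assert (0 < 1 + v * v) by nra.
        field. repeat split; auto; lra.
  - apply (is_series_scal (V := R_NormedModule)). apply Series_correct, ex_inv_sinh_even, Ha'.
Qed.

Theorem theorem3 (alpha k : R)
  (halpha : 0 < alpha)
  (hk : 0 < k < 1)
  (hmod : ellipticK (compl_modulus k) / ellipticK k = alpha) :
  (ln 2 / (2 * PI) < alpha ->
     is_RInt (integrand_minus alpha) 0 (PI / 2)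
       (13 * PI * alpha / 48 + PI / (24 * alpha)
        + PI * alpha / (4 * tanh (PI * alpha))
        + alpha / (4 * PI)
          * (ellipticE k - (2 - k ^ 2) / 3 * ellipticK k) * ellipticK k)) /\
  (ln 2 / PI < alpha ->
     is_RInt (integrand_plus alpha) 0 (PI / 2)
       (PI / (8 * alpha) + PI * alpha / (4 * sinh (PI * alpha))
        + alpha / (4 * PI) * (ellipticE k - ellipticK k) * ellipticK k)).
Proof.
  pose proof PI_RGT_0 as Hpi. pose proof ln_lt_2 as Hl.
  assert (Ha' : 0 < PI * alpha) by now apply Rmult_lt_0_compat.
  destruct (lattice_sums alpha k halpha hk hmod) as [So Se].
  pose proof (sinh_gt_0 _ Ha') as Hs. pose proof (cosh_gt_0 (PI * alpha)) as Hch.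
  assert (Hla : 0 < ln 2 / alpha) by (apply Rdiv_lt_0_compat; lra).
  split; intros Hal.
  - apply is_RInt_ext with (integrand alpha 0); [intros; apply integrand_minus_eq|].
    (* The argument of the cosine at x = 0 lies strictly between 0 and 2 PI, so the denominator does
       not vanish there. *)
    assert (H1 : ln 2 / alpha < 2 * PI).
    { apply Rmult_lt_reg_r with alpha; [easy|]. unfold Rdiv. rewrite Rmult_assoc, Rinv_l, Rmult_1_r by lra.
      apply Rmult_lt_compat_l with (r := 2 * PI) in Hal; [|lra].
      replace (2 * PI * (ln 2 / (2 * PI))) with (ln 2) in Hal by (field; lra). lra. }
    pose (u := fun j => 2 * alpha * J (- alpha * (0 + 2 * PI * INR j)) + 2 * alpha * J (- alpha * (0 - 2 * PI * (INR j + 1)))).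
    assert (S : is_series u (plus (2 * alpha * (PI / 4) * (13 / 12 + (/ (2 * (PI * alpha)) ^ 2 * (PI ^ 2 / 6) + (/ (2 * tanh (PI * alpha)) - / 2)
      - / 4 * Series (fun j => / sinh (INR (S j) * (PI * alpha)) ^ 2))))
       (scal (2 * alpha * (PI / 4)) (scal (/ (2 * (PI * alpha)) ^ 2) (PI ^ 2 / 6))))).
    { apply (is_series_plus (V := R_NormedModule)); [now apply series_neg_0|].
      apply is_series_ext with (fun j => scal (2 * alpha * (PI / 4)) (scal (/ (2 * (PI * alpha)) ^ 2) (/ INR (S j) ^ 2))).
      - intros j. symmetry. now apply pair_0.
      - do 2 apply (is_series_scal (V := R_NormedModule)). rewrite <- Series_inv_sqr. apply Series_correct, ex_series_inv_sqr. }
    assert (V := integral_value alpha 0 halpha ltac:(lra) ltac:(rewrite Rplus_0_r; now apply cos_lt_1) u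
       (fun N j HN => pole_minus_neq alpha N j halpha Hal HN) (fun j => eq_refl) (ex_intro _ _ S)).
    rewrite (is_series_unique _ _ S), Se in V.
    match goal with |- is_RInt _ _ _ ?l => match type of V with is_RInt _ _ _ ?m => replace l with m; [exact V|] end end.
    (* The constants of [J_0], of the geometric series and of the lattice sum combine to 13/12 - 1/2
       - 1/24 = 13/24; multiplied by PI alpha / 2 this is the first term. *)
    unfold plus, scal; simpl. unfold mult; simpl. toR. unfold tanh. field. repeat split; lra.
  - apply is_RInt_ext with (integrand alpha PI); [intros; apply integrand_plus_eq|].
    assert (H1 : ln 2 / alpha < PI).
    { apply Rmult_lt_reg_r with alpha; [easy|]. unfold Rdiv. rewrite Rmult_assoc, Rinv_l, Rmult_1_r by lra.
      apply Rmult_lt_compat_l with (r := PI) in Hal; [|lra].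
      replace (PI * (ln 2 / PI)) with (ln 2) in Hal by (field; lra). lra. }
    pose (u := fun j => 2 * alpha * J (- alpha * (PI + 2 * PI * INR j)) + 2 * alpha * J (- alpha * (PI - 2 * PI * (INR j + 1)))).
    pose proof (is_series_ext _ u _ (fun j => eq_sym (pair_PI alpha j halpha Hal)) (series_PI alpha halpha)) as S.
    assert (V := integral_value alpha PI halpha ltac:(lra) ltac:(apply cos_lt_1; lra) u
       (fun N j HN => pole_plus_neq alpha N j halpha Hal HN) (fun j => eq_refl) (ex_intro _ _ S)).
    rewrite (is_series_unique _ _ S), So in V.
    match goal with |- is_RInt _ _ _ ?l => match type of V with is_RInt _ _ _ ?m => replace l with m; [exact V|] end end.
    toR. field. repeat split; lra.
Qed.
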